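(* Let $c\ge1$ and $0<\gamma c<0.25$. Let $G\sim G(n,p)$ and let $\mathcal{A}(G)$ be a rewiring of $G$ by a $\gamma$-omniscient adversary. The prune-then-mean and prune-then-median estimators (with parameters $\gamma,c$) prune $2c\gamma n$ nodes in total, and with probability $1-n^{-2}$ they estimate $p$ to accuracy $O\!\left(c\gamma^2+\frac{\log n}{n}\right)$ and $O\!\left(c\gamma+\sqrt{\frac{\log n}{n}}\right)$ respectively, where the $O(\cdot)$ hide universal constants.
   Context: $G(n,p)$ is the distribution over undirected graphs on $[n]$ with each edge present independently with probability $p$. A $\gamma$-omniscient adversary knows $p$, observes $G$, chooses $B\subseteq[n]$ with $|B|\le\gamma n$ and arbitrarily changes the status of any edge with at least one endpoint in $B$, producing $\mathcal{A}(G)$. The prune-then-mean/median algorithm: given $\mathcal{A}(G)$, $\gamma$ and $c$, remove the $c\gamma n$ nodes of largest degree and the $c\gamma n$ nodes of smallest degree (degrees in $\mathcal{A}(G)$); on the remaining induced graph $H$ with $m=(1-2c\gamma)n$ nodes, output either the mean estimate $(\text{number of edges of }H)/\binom m2$ or the median estimate $\mathrm{Median}\{\deg_H(v)\}/(m-1)$. *)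

(* Defs.v *)
From HB Require Import structures.
From mathcomp Require Import all_boot all_order all_algebra.
From mathcomp Require Import reals exp.

Set Implicit Arguments.
Unset Strict Implicit.
Unset Printing Implicit Defensive.

Import Order.TTheory GRing.Theory Num.Theory.
Local Open Scope ring_scope.

(* Undirected simple graphs on [n], with [n] rendered as 'I_n: an edge is a
   2-element set of vertices. *)
Record sgraph (n : nat) := SGraph {
  edges :> {set {set 'I_n}};
  edgesP : [forall e in edges, #|e| == 2] }.

HB.instance Definition _ n := [isSub for @edges n].
HB.instance Definition _ n := [Finite of sgraph n by <:].

Section Graphs.
Variable n : nat.
Implicit Types (E : {set {set 'I_n}}) (S T L : {set 'I_n}).

Definition deg E (v : 'I_n) : nat := #|[set e in E | v \in e]|.

Definition induced E S : {set {set 'I_n}} := [set e in E | e \subset S].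

(* T consists of k nodes of largest degree and L of k nodes of smallest degree
   (disjoint, so that 2k nodes are removed); ties may be broken in any way. *)
Definition is_pruning (k : nat) E T L : Prop :=
  [/\ #|T| = k, #|L| = k, [disjoint T & L],
      (forall u v, u \in T -> v \notin T -> (deg E v <= deg E u)%N) &
      (forall u v, u \in L -> v \notin L -> (deg E u <= deg E v)%N)].

End Graphs.

Section Estimation.
Variables (R : realType) (n : nat).
Implicit Types (p gamma c : R) (E : {set {set 'I_n}}) (S : {set 'I_n}).

Definition gnp p (G : sgraph n) : R :=
  \prod_(e : {set 'I_n} | #|e| == 2) (if e \in edges G then p else 1 - p).

Definition Pr_gnp p (event : pred (sgraph n)) : R :=
  \sum_(G : sgraph n | event G) gnp p G.

(* The corrupted set B may depend on the observed graph G. *)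
Definition omniscient_adversary gamma (A : sgraph n -> sgraph n) : Prop :=
  forall G : sgraph n, exists B : {set 'I_n},
    #|B|%:R <= gamma * n%:R /\
    forall e : {set 'I_n},
      [disjoint e & B] -> (e \in edges (A G)) = (e \in edges G).

(* The number c * gamma * n of nodes pruned at each end, rounded down. *)
Definition prune_size gamma c : nat := Num.truncn (c * gamma * n%:R).

Definition pruning_rule gamma c (T L : sgraph n -> {set 'I_n}) : Prop :=
  forall G : sgraph n, is_pruning (prune_size gamma c) (edges G) (T G) (L G).

(* For a sequence of even length, the average of the two middle values. *)
Definition median (s : seq nat) : R :=
  let t := sort leq s in
  ((nth 0%N t ((size t).-1 %/ 2))%:R + (nth 0%N t (size t %/ 2))%:R) / 2.

Definition mean_estimate E S : R :=
  #|induced E S|%:R / 'C(#|S|, 2)%:R.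

Definition median_estimate E S : R :=
  median [seq deg (induced E S) v | v <- enum S] / (#|S|.-1)%:R.

Definition pruned (T L : sgraph n -> {set 'I_n}) (G : sgraph n) : {set 'I_n} :=
  T G :|: L G.

Definition prune_then_mean (T L : sgraph n -> {set 'I_n}) (G : sgraph n) : R :=
  mean_estimate (edges G) (~: pruned T L G).

Definition prune_then_median (T L : sgraph n -> {set 'I_n}) (G : sgraph n) : R :=
  median_estimate (edges G) (~: pruned T L G).

End Estimation.

(* Main.v *)
(* Let [W] be the adjacency matrix centred by [p] off the diagonal, [d v] its row
   sums, [U] the pruned set and [S] its complement, and put [s = gamma n],
   [k = c gamma n].  Up to [O(s sqrt(n log n) + k s)] coming from the corrupted rows,
   the mean estimator has error [1_S W 1_S / |S|^2], and
   [1_S W 1_S = 1 W 1 - 2 sum_U d + 1_U W 1_U].  Since [c] is unbounded, the last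
   two terms are only small because the top and the bottom of the degree
   sequence cancel.

   - [sum_U d]: an exchange argument replaces the pruned sets by the true top and
     bottom [k] vertices at a cost [O(k s)]; a trimmed sum is controlled by the
     soft-thresholded sums [sum_v soft_t (d v)], which concentrate, and whose means
     are bounded because the binomial law is almost symmetric around its mode.
   - [1_U W 1_U]: a union bound over sets of size [2 k] suffices unless
     [k sigma rho >> n log n + k s], where [sigma^2 = n p (1 - p)] and
     [rho = (k / n)^(1/4)].  In that regime [U] is, off the corrupted vertices, a
     degree-determined extreme set plus a subset of the few vertices whose degree is
     within [s] of the two thresholds.  For degree-determined [X, Y] the form is
     bounded through switchings [ac, bd <-> ad, bc], which preserve both the
     degrees and the law of the graph: averaging the signs of many commuting
     switchings gives an exponential moment bound for a quadrilinear statistic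
     close to [p (1 - p) n^2] times the centred form of [X, Y].

   The median estimator only needs that every surviving vertex has a corrupted
   degree within [O(sqrt(n log n)) + s] of [p (n - 1)]. *)

Require Import Defs.
From HB Require Import structures.
From mathcomp Require Import all_boot all_order all_algebra.
From mathcomp Require Import reals exp.
From mathcomp Require Import boolp binomial_distribution perm ring lra zify.

Set Implicit Arguments.
Unset Strict Implicit.
Unset Printing Implicit Defensive.

Import Order.TTheory GRing.Theory Num.Theory.
Local Open Scope ring_scope.

Local Notation expR := sequences.expR.

(** * Product measures *)

Section ExponentialBounds.
Variable R : realType.
Implicit Types a b r t x : R.

(* [e^x = (e^(x/2))^2 <= (1 - x/2)^(-2)] *)
Lemma expR_le_quadratic x : x <= 1 / 3 -> expR x <= 1 + x + x ^+ 2.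
Proof.
move=> x_le; have half_gt0 : 0 < 1 - x / 2 by lra.
have expR_half_le : expR (x / 2) * (1 - x / 2) <= 1.
  rewrite -[leRHS](expRxMexpNx_1 (x / 2)) ler_pM2l ?expR_gt0 //.
  by have := expR_ge1Dx (- (x / 2)).
have sqr_half_gt0 : 0 < (1 - x / 2) ^+ 2 by rewrite exprn_gt0.
rewrite -(ler_pM2r sqr_half_gt0); apply: (@le_trans _ _ 1).
  have -> : expR x = expR (x / 2) ^+ 2 by rewrite -expRM_natr; congr expR; lra.
  rewrite -exprMn; apply: exprn_ile1 => //.
  by rewrite mulr_ge0 ?expR_ge0 ?ltW.
have -> : (1 + x + x ^+ 2) * (1 - x / 2) ^+ 2
    = 1 + x ^+ 2 / 4 * ((1 - 3 * x) + x ^+ 2) by field.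
by rewrite lerDl mulr_ge0 ?divr_ge0 ?sqr_ge0 // addr_ge0 ?sqr_ge0 //; lra.
Qed.

Lemma expR1_le : expR (1 : R) <= 7 / 2.
Proof.
have -> : expR (1 : R) = expR (1 / 3) ^+ 3 by rewrite -expRM_natr; congr expR; lra.
have third_le : expR (1 / 3 : R) <= 13 / 9.
  by apply: le_trans (expR_le_quadratic _) _; lra.
apply: le_trans (_ : (13 / 9) ^+ 3 <= _); last by lra.
by rewrite lerXn2r ?nnegrE ?expR_ge0 //; lra.
Qed.

Lemma expR_ge2 x : 1 <= x -> 2 <= expR x.
Proof. by have := expR_ge1Dx x; lra. Qed.

Lemma two_point_mgf_le r a b : 0 <= r <= 1 -> `|a - b| <= 1 / 3 ->
  r * expR a + (1 - r) * expR b
    <= expR (r * a + (1 - r) * b + r * (1 - r) * (a - b) ^+ 2).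
Proof.
move=> /andP[r_ge0 r_le1] ab_le; have s_ge0 : 0 <= 1 - r by rewrite subr_ge0.
have ab_le' : a - b <= 1 / 3 := le_trans (ler_norm _) ab_le.
have ba_le : - (a - b) <= 1 / 3 by rewrite ler_norml in ab_le; lra.
set m := r * a + (1 - r) * b.
have a_eq : a = m + (1 - r) * (a - b) by rewrite /m; ring.
have b_eq : b = m - r * (a - b) by rewrite /m; ring.
rewrite [in expR a]a_eq [in expR b]b_eq.
move: (a - b) m ab_le' ba_le {a_eq b_eq ab_le} => d m d_le Nd_le.
rewrite !expRD mulrCA [X in _ + X]mulrCA -mulrDr ler_wpM2l ?expR_ge0 //.
apply: le_trans (expR_ge1Dx _).
have upper : expR ((1 - r) * d) <= 1 + (1 - r) * d + ((1 - r) * d) ^+ 2.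
  by apply: expR_le_quadratic; nra.
have lower : expR (- (r * d)) <= 1 - r * d + (- (r * d)) ^+ 2.
  by apply: expR_le_quadratic; nra.
apply: le_trans (lerD (ler_wpM2l r_ge0 upper) (ler_wpM2l s_ge0 lower)) _.
by rewrite le_eqVlt; apply/orP; left; apply/eqP; ring.
Qed.

Lemma expRD_expRN_le t : `|t| <= 1 / 3 -> expR t + expR (- t) <= 2 * expR (t ^+ 2).
Proof.
rewrite ler_norml => /andP[t_ge t_le].
have := @expR_le_quadratic t t_le; have := @expR_le_quadratic (- t); rewrite sqrrN.
by have := expR_ge1Dx (t ^+ 2); lra.
Qed.

Lemma expR_mean_le (T : finType) (f : T -> R) : (0 < #|T|)%N ->
  expR ((\sum_i f i) / #|T|%:R) <= (\sum_i expR (f i)) / #|T|%:R.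
Proof.
move=> T_gt0; have card_gt0 : 0 < #|T|%:R :> R by rewrite ltr0n.
set m := (\sum_i f i) / _; rewrite ler_pdivlMr //.
have -> : expR m * #|T|%:R = \sum_i (expR m * (1 + (f i - m))).
  rewrite -mulr_sumr big_split /= sumrB !sumr_const -(mulr_natr m).
  by rewrite /m divfK ?gt_eqF // subrr addr0.
apply: ler_sum => i _; rewrite -[X in _ <= expR X](subrK m) expRD mulrC.
by rewrite ler_wpM2r ?expR_ge0 ?expR_ge1Dx.
Qed.

End ExponentialBounds.

Section SetToggles.
Variable T : finType.
Implicit Types (i j : T) (w : {set T}).

Lemma setU1_id i w : i |: (i |: w) = i |: w.
Proof. by rewrite setUA setUid. Qed.

Lemma setU1D1 i w : i |: (w :\ i) = i |: w.
Proof. by apply/setP => k; rewrite !inE; case: eqP. Qed.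

Lemma setD1U1 i w : (i |: w) :\ i = w :\ i.
Proof. by apply/setP => k; rewrite !inE; case: eqP. Qed.

Lemma setD1_id i w : (w :\ i) :\ i = w :\ i.
Proof. by rewrite setDDl setUid. Qed.

Lemma setU1D1C i j w : i != j -> (i |: w) :\ j = i |: (w :\ j).
Proof.
move=> neq_ij; apply/setP => k; rewrite !inE.
by case: (eqVneq k i) => [->|//]; rewrite neq_ij.
Qed.

Lemma setD1C i j w : (w :\ i) :\ j = (w :\ j) :\ i.
Proof. by rewrite !setDDl setUC. Qed.

Definition insensitive (A : Type) (f : {set T} -> A) i := forall w, f (i |: w) = f (w :\ i).

Lemma insensitive_toggle (A : Type) (f : {set T} -> A) i w : insensitive f i ->
  f (i |: w) = f w /\ f (w :\ i) = f w.
Proof.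
move=> f_ins; case: (boolP (i \in w)) => iw.
  have wU : i |: w = w by apply/setUidPr; rewrite sub1set.
  by rewrite -f_ins wU.
have wD : w :\ i = w by apply/setDidPl; rewrite disjoint_sym disjoints1.
by rewrite f_ins wD.
Qed.

Lemma insensitive_constant (A : Type) (f : {set T} -> A) w :
  (forall i, insensitive f i) -> f w = f set0.
Proof.
move=> f_ins; have [m] := ubnP #|w|; elim: m w => // m IH w.
case: (set_0Vmem w) => [->//|[i iw]] w_lt.
rewrite -(insensitive_toggle w (f_ins i)).2; apply: IH.
by rewrite (cardsD1 i w) iw in w_lt.
Qed.

End SetToggles.

Section ProductMeasure.
Variables (R : realType) (I : finType) (p : I -> R).
Hypothesis p01 : forall i, 0 <= p i <= 1.
Implicit Types (f g h : {set I} -> R) (w : {set I}) (s : seq I).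

Definition bernoulli_weight w : R := \prod_i (if i \in w then p i else 1 - p i).

Definition expect f : R := \sum_w bernoulli_weight w * f w.

Definition resample i f w : R := p i * f (i |: w) + (1 - p i) * f (w :\ i).

Definition resample_all s f : {set I} -> R := foldr resample f s.

Lemma bernoulli_weight_ge0 w : 0 <= bernoulli_weight w.
Proof.
apply: prodr_ge0 => i _; have /andP[p_ge0 p_le1] := p01 i.
by case: ifP => // _; rewrite subr_ge0.
Qed.

Lemma expect_le f g : (forall w, f w <= g w) -> expect f <= expect g.
Proof. by move=> fg; apply: ler_sum => w _; rewrite ler_wpM2l ?bernoulli_weight_ge0. Qed.

Lemma eq_expect f g : (forall w, f w = g w) -> expect f = expect g.
Proof. by move=> fg; apply: eq_bigr => w _; rewrite fg. Qed.

Lemma expect_cst (c : R) : expect (fun=> c) = c.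
Proof.
rewrite /expect -mulr_suml /bernoulli_weight.
have := @bigA_distr R 0 1 *%R +%R I p (fun i => 1 - p i); rewrite big1 => [/esym|i _].
  by under eq_bigl do rewrite inE; move=> ->; rewrite mul1r.
by rewrite /=; ring.
Qed.

Lemma expectZl (c : R) f : expect (fun w => c * f w) = c * expect f.
Proof. by rewrite /expect mulr_sumr; apply: eq_bigr => w _; rewrite mulrCA. Qed.

Lemma expectD f g : expect (fun w => f w + g w) = expect f + expect g.
Proof. by rewrite /expect -big_split; apply: eq_bigr => w _; rewrite mulrDr. Qed.

Lemma expect_sum (J : finType) (P : pred J) (F : J -> {set I} -> R) :
  expect (fun w => \sum_(j | P j) F j w) = \sum_(j | P j) expect (F j).
Proof.
rewrite /expect exchange_big; apply: eq_bigr => w _.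
by rewrite mulr_sumr.
Qed.

Lemma sum_set_split (i : I) (F : {set I} -> R) :
  \sum_w F w = \sum_(w : {set I} | i \notin w) (F w + F (i |: w)).
Proof.
rewrite (bigID (fun w : {set I} => i \notin w)) big_split; congr (_ + _).
rewrite (reindex_onto (fun w => i |: w) (fun w => w :\ i)); last first.
  by move=> w; rewrite negbK => iw; rewrite setD1K.
apply: eq_bigl => w; rewrite negbK setU11 /=.
apply/eqP/idP => [<-|iw]; first by rewrite setD11.
by rewrite setU1K.
Qed.

Lemma expect_resample i f : expect (resample i f) = expect f.
Proof.
rewrite /expect !(sum_set_split i); apply: eq_bigr => w iw.
pose rest := \prod_(j | j != i) (if j \in w then p j else 1 - p j).
have weight_out : bernoulli_weight w = (1 - p i) * rest.
  by rewrite /bernoulli_weight (bigD1 i) //= (negbTE iw).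
have weight_in : bernoulli_weight (i |: w) = p i * rest.
  rewrite /bernoulli_weight (bigD1 i) //= setU11; congr (_ * _).
  by apply: eq_bigr => j ji; rewrite in_setU1 (negbTE ji).
have wD : w :\ i = w by apply/setDidPl; rewrite disjoint_sym disjoints1.
by rewrite /resample setU1_id setD1U1 wD weight_out weight_in; ring.
Qed.

Lemma expect_resample_all s f : expect (resample_all s f) = expect f.
Proof. by elim: s => //= i s IH; rewrite expect_resample. Qed.

Lemma resample_le i f g w : (forall w', f w' <= g w') -> resample i f w <= resample i g w.
Proof.
move=> fg; have /andP[? ?] := p01 i.
by rewrite /resample lerD // ler_wpM2l ?subr_ge0.
Qed.

Lemma resample_bounded_diff i j f w (c : R) :
    (forall w', `|f (i |: w') - f (w' :\ i)| <= c) ->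
  `|resample j f (i |: w) - resample j f (w :\ i)| <= c.
Proof.
move=> f_diff; have c_ge0 : 0 <= c by apply: le_trans (f_diff w).
rewrite /resample; case: (eqVneq i j) => [<-|ij].
  by rewrite setU1_id setU1D1 setD1U1 setD1_id subrr normr0.
rewrite setUCA (@setU1D1C _ i j) // -(@setU1D1C _ j i) 1?eq_sym // (@setD1C _ i j).
rewrite opprD addrACA -!mulrBr; have /andP[p_ge0 p_le1] := p01 j.
apply: le_trans (ler_normD _ _) _; rewrite !normrM (ger0_norm p_ge0).
rewrite (@ger0_norm _ (1 - p j)) ?subr_ge0 //.
rewrite -[leRHS]mul1r -[X in X * c](subrKC (p j)) [leRHS]mulrDl.
by rewrite lerD // ler_wpM2l ?subr_ge0.
Qed.

Lemma resample_all_bounded_diff i s f w (c : R) :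
    (forall w', `|f (i |: w') - f (w' :\ i)| <= c) ->
  `|resample_all s f (i |: w) - resample_all s f (w :\ i)| <= c.
Proof. by move=> f_diff; elim: s w => [|j s IH] w //=; apply: resample_bounded_diff. Qed.

Lemma insensitive_resample i j f : insensitive f i -> insensitive (resample j f) i.
Proof.
move=> f_ins w; apply/eqP; rewrite -subr_eq0 -normr_le0; apply: resample_bounded_diff => w'.
by rewrite f_ins subrr normr0.
Qed.

Lemma insensitive_resample_all i s f : i \in s -> insensitive (resample_all s f) i.
Proof.
elim: s => //= j s IH; rewrite inE => /orP[/eqP <-|/IH]; last exact: insensitive_resample.
by move=> w; rewrite /resample setU1_id setU1D1 setD1U1 setD1_id.
Qed.

Lemma resample_all_enum f w : resample_all (enum I) f w = expect f.
Proof.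
rewrite -(expect_resample_all (enum I) f).
have ins i : insensitive (resample_all (enum I) f) i.
  by apply: insensitive_resample_all; rewrite mem_enum.
rewrite (insensitive_constant w ins) -[LHS]expect_cst.
by apply: eq_expect => v; rewrite [RHS](insensitive_constant v ins).
Qed.

(* Resampling one coordinate at a time, each coordinate costs the two-point bound. *)
Lemma expect_expR_bounded_diff f (c : I -> R) :
    (forall i w, `|f (i |: w) - f (w :\ i)| <= c i) -> (forall i, c i <= 1 / 3) ->
  expect (fun w => expR (f w)) <= expR (expect f + \sum_i p i * (1 - p i) * c i ^+ 2).
Proof.
move=> f_diff c_le.
suff partial s w : resample_all s (fun w => expR (f w)) w
    <= expR (resample_all s f w + \sum_(i <- s) p i * (1 - p i) * c i ^+ 2).
  by have := partial (enum I) set0; rewrite !resample_all_enum big_enum.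
elim: s w => [|j s IH] w /=; first by rewrite big_nil addr0.
apply: le_trans (resample_le _ _ IH) _; rewrite /resample big_cons.
set rest := \sum_(i <- s) _; set cost := p j * _ * c j ^+ 2.
have diff := resample_all_bounded_diff s w (f_diff j).
have /andP[p_ge0 p_le1] := p01 j.
rewrite addrA (expRD (_ + _)) !(expRD _ rest) !mulrA -mulrDl ler_wpM2r ?expR_ge0 //.
apply: le_trans (two_point_mgf_le (p01 j) (le_trans diff (c_le j))) _.
rewrite ler_expR lerD2l ler_wpM2l ?mulr_ge0 ?subr_ge0 //.
by rewrite -[X in X <= _]real_normK ?num_real // lerXn2r // nnegrE (le_trans _ diff).
Qed.

Definition failure_prob (P : {set I} -> Prop) : R := expect (fun w => (~~ `[< P w >])%:R).

Implicit Types (P Q : {set I} -> Prop).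

Lemma failure_prob_mono P Q : (forall w, P w -> Q w) -> failure_prob Q <= failure_prob P.
Proof.
move=> PQ; apply: expect_le => w; rewrite ler_nat.
by case: asboolP => // nQ; case: asboolP => // /PQ.
Qed.

Lemma failure_prob_and P Q (a b : R) : failure_prob P <= a -> failure_prob Q <= b ->
  failure_prob (fun w => P w /\ Q w) <= a + b.
Proof.
move=> P_le Q_le; apply: le_trans (lerD P_le Q_le); rewrite -expectD; apply: expect_le => w.
by rewrite -natrD ler_nat asbool_and negb_and; do 2 case: `[< _ >].
Qed.

Lemma failure_prob_markov P h (t : R) : (forall w, 0 <= h w) -> expect h <= 1 ->
    (forall w, h w <= expR t -> P w) -> failure_prob P <= expR (- t).
Proof.
move=> h_ge0 h_le1 hP; apply: (@le_trans _ _ (expR (- t) * expect h)); last first.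
  by rewrite ler_piMr ?expR_ge0.
rewrite -expectZl; apply: expect_le => w; case: asboolP => /= nP.
  by rewrite mulr_ge0 ?expR_ge0.
rewrite expRN mulrC ler_pdivlMr ?expR_gt0 // mul1r ltW // ltNge.
by apply/negP => /hP.
Qed.

Lemma failure_prob_chernoff (J : finType) (f : J -> {set I} -> R) (t b : R) :
    #|J|%:R <= expR b -> (forall j, expect (fun w => expR (f j w)) <= 1) ->
  failure_prob (fun w => forall j, f j w <= t + b) <= expR (- t).
Proof.
move=> cardJ mgf; apply: (@failure_prob_markov _ (fun w => expR (- b) * \sum_j expR (f j w))).
- by move=> w; rewrite mulr_ge0 ?expR_ge0 // sumr_ge0 // => j _; exact: expR_ge0.
- rewrite expectZl expect_sum expRN mulrC ler_pdivrMr ?expR_gt0 // mul1r.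
  by apply: le_trans cardJ; rewrite -sum1_card natr_sum; apply: ler_sum => j _.
- move=> w; rewrite expRN mulrC ler_pdivrMr ?expR_gt0 // -expRD => sum_le j.
  rewrite -ler_expR; apply: le_trans sum_le; rewrite (bigD1 j) //= lerDl.
  by apply: sumr_ge0 => i _; exact: expR_ge0.
Qed.

Lemma failure_prob_chernoff2 (J : finType) (f g : J -> {set I} -> R) (t b : R) :
    2 * #|J|%:R <= expR b -> (forall j, expect (fun w => expR (f j w)) <= 1) ->
    (forall j, expect (fun w => expR (g j w)) <= 1) ->
  failure_prob (fun w => forall j, f j w <= t + b /\ g j w <= t + b) <= expR (- t).
Proof.
move=> cardJ mgf_f mgf_g; pose fg (jb : J * bool) := if jb.2 then f jb.1 else g jb.1.
apply: le_trans (failure_prob_mono _) (@failure_prob_chernoff _ fg t b _ _).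
- by move=> w fg_le j; split; [exact: (fg_le (j, true))|exact: (fg_le (j, false))].
- by rewrite card_prod card_bool natrM mulrC.
- by case=> j []; [exact: mgf_f|exact: mgf_g].
Qed.

End ProductMeasure.

(** * Binomial means *)

Section BinomialMass.
Variable R : realType.
Implicit Types (p c d l : R) (f g h : nat -> R) (N m i j : nat).

Lemma binomial_pmfE N p i : binomial_pmf N p i = 'C(N, i)%:R * p ^+ i * (1 - p) ^+ (N - i).
Proof. by rewrite /binomial_pmf -mulr_natl mulrA. Qed.

Lemma binomial_pmf_gt0 N p i : 0 < p < 1 -> (i <= N)%N -> 0 < binomial_pmf N p i.
Proof.
move=> /andP[p_gt0 p_lt1] iN.
by rewrite binomial_pmfE !mulr_gt0 ?exprn_gt0 ?subr_gt0 // ltr0n bin_gt0.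
Qed.

Lemma binomial_pmf_gtn N p i : (N < i)%N -> binomial_pmf N p i = 0.
Proof. by move=> Ni; rewrite binomial_pmfE bin_small // !mul0r. Qed.

Lemma binomial_pmfS N p i :
  binomial_pmf N.+1 p i.+1 = p * binomial_pmf N p i + (1 - p) * binomial_pmf N p i.+1.
Proof.
rewrite !binomial_pmfE binS natrD subSS exprS.
case: (ltnP i N) => iN.
  by rewrite -(subSS i N) subSn // exprS; ring.
by rewrite (@bin_small N i.+1) // add0r !mul0r mulr0 addr0; ring.
Qed.

Lemma binomial_pmfS0 N p : binomial_pmf N.+1 p 0 = (1 - p) * binomial_pmf N p 0.
Proof. by rewrite !binomial_pmfE !bin0 !subn0 exprS; ring. Qed.

Lemma binomial_pmf_ratio N p i : (i <= N)%N ->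
  binomial_pmf N p i.+1 * (i.+1%:R * (1 - p)) = binomial_pmf N p i * ((N%:R - i%:R) * p).
Proof.
rewrite leq_eqVlt => /orP[/eqP->|iN].
  by rewrite binomial_pmf_gtn // mul0r subrr mul0r mulr0.
rewrite !binomial_pmfE -natrB 1?ltnW //.
have bin_ratio : (i.+1%:R * 'C(N, i.+1)%:R = (N - i)%:R * 'C(N, i)%:R :> R).
  by rewrite -!natrM mul_bin_left.
set M := (N - i)%:R in bin_ratio *.
rewrite -(subSS i N) subSn // exprS (exprS _ (N - _)).
transitivity ((i.+1%:R * 'C(N, i.+1)%:R) * (p * p ^+ i * (1 - p) ^+ (N - i.+1) * (1 - p))).
  by ring.
by rewrite bin_ratio; ring.
Qed.

(* The mean of [f X] for [X] binomial, conditioning on one trial at a time. *)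
Fixpoint binomial_mean N p f : R :=
  if N is N'.+1 then p * binomial_mean N' p (fun i => f i.+1) + (1 - p) * binomial_mean N' p f
  else f 0%N.

Lemma eq_binomial_mean N p f g : (forall i, (i <= N)%N -> f i = g i) ->
  binomial_mean N p f = binomial_mean N p g.
Proof.
elim: N f g => [|N IH] f g fg /=; first exact: fg.
rewrite (IH f g); last by move=> i iN; apply: fg; exact: leqW.
by rewrite (IH _ (fun i => g i.+1)) // => i iN; exact: fg.
Qed.

Lemma binomial_meanE N p f m : (N < m)%N ->
  binomial_mean N p f = \sum_(i < m) binomial_pmf N p i * f i.
Proof.
elim: N f m => [|N IH] f m Nm.
  case: m Nm => // m _; rewrite big_ord_recl big1 ?addr0 => [|i _].
    by rewrite binomial_pmfE bin0 !expr0 !mul1r.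
  by rewrite binomial_pmf_gtn ?mul0r.
case: m Nm => // m Nm; rewrite /= (IH _ m) // (IH f m.+1) ?leqW //.
rewrite !big_ord_recl binomial_pmfS0 mulrDr mulrA addrCA; congr (_ + _).
rewrite !mulr_sumr -big_split; apply: eq_bigr => i _ /=.
by rewrite binomial_pmfS; ring.
Qed.

Lemma binomial_mean_le N p f g : 0 <= p <= 1 -> (forall i, f i <= g i) ->
  binomial_mean N p f <= binomial_mean N p g.
Proof.
move=> /andP[p_ge0 p_le1]; elim: N f g => //= N IH f g fg.
by rewrite lerD // ler_wpM2l ?subr_ge0 ?IH.
Qed.

Lemma binomial_mean_cst N p c : binomial_mean N p (fun=> c) = c.
Proof. by elim: N => //= N ->; ring. Qed.

Lemma binomial_meanP N p c f g :
  binomial_mean N p (fun i => c * f i + g i) = c * binomial_mean N p f + binomial_mean N p g.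
Proof. by elim: N f g => //= N IH f g; rewrite !IH; ring. Qed.

Lemma binomial_meanZ N p c f : binomial_mean N p (fun i => c * f i) = c * binomial_mean N p f.
Proof. by elim: N f => //= N IH f; rewrite !IH; ring. Qed.

Lemma binomial_meanB N p f g :
  binomial_mean N p (fun i => f i - g i) = binomial_mean N p f - binomial_mean N p g.
Proof. by elim: N f g => //= N IH f g; rewrite !IH; ring. Qed.

Lemma binomial_mean_ge0 N p f : 0 <= p <= 1 -> (forall i, 0 <= f i) -> 0 <= binomial_mean N p f.
Proof. by move=> p01 f_ge0; rewrite -(binomial_mean_cst N p 0); apply: binomial_mean_le. Qed.

Lemma binomial_mean_norm_le N p c f : 0 <= p <= 1 -> (forall i, `|f i| <= c) ->
  `|binomial_mean N p f| <= c.
Proof.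
move=> p01 f_le; rewrite ler_norml -{1}(binomial_mean_cst N p (- c)).
rewrite -{2}(binomial_mean_cst N p c).
by rewrite !binomial_mean_le // => i; have := f_le i; rewrite ler_norml => /andP[].
Qed.

Lemma binomial_mean_id N p c : binomial_mean N p (fun i => i%:R - c) = N%:R * p - c.
Proof.
elim: N c => [|N IH] c /=; first by ring.
rewrite IH (@eq_binomial_mean _ _ _ (fun i => i%:R - (c - 1))) ?IH => [|i _];
  by rewrite -natr1; ring.
Qed.

Lemma binomial_mean_sqr N p c :
  binomial_mean N p (fun i => (i%:R - c) ^+ 2) = N%:R * p * (1 - p) + (N%:R * p - c) ^+ 2.
Proof.
elim: N c => [|N IH] c /=; first by ring.
rewrite IH (@eq_binomial_mean _ _ _ (fun i => (i%:R - (c - 1)) ^+ 2)) ?IH => [|i _];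
  by rewrite -natr1; ring.
Qed.

Lemma binomial_mean_abs_le N p s : 0 <= p <= 1 -> 0 < s -> s ^+ 2 = N%:R * p * (1 - p) ->
  binomial_mean N p (fun i => `|i%:R - N%:R * p|) <= s.
Proof.
move=> p01 s_gt0 s_sqr; have two_s_gt0 : 0 < 2 * s by lra.
rewrite -(ler_pM2l two_s_gt0) -binomial_meanZ.
apply: (@le_trans _ _ (binomial_mean N p (fun i => 1 * (i%:R - N%:R * p) ^+ 2 + s ^+ 2))).
  apply: binomial_mean_le => // i; have := sqr_ge0 (`|i%:R - N%:R * p| - s).
  rewrite sqrrB real_normK ?num_real //; lra.
rewrite binomial_meanP binomial_mean_cst binomial_mean_sqr subrr expr0n addr0 -s_sqr.
by rewrite -mulrA -expr2; lra.
Qed.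

Lemma binomial_mean_rev N p f :
  binomial_mean N p f = binomial_mean N (1 - p) (fun i => f (N - i)%N).
Proof.
elim: N f => [|N IH] f //=; rewrite subKr addrC; congr (_ * _ + _ * _).
  by rewrite IH; apply: eq_binomial_mean => i _; rewrite subSS.
by rewrite IH; apply: eq_binomial_mean => i iN; rewrite subSn.
Qed.

Lemma binomial_pmf_mean N p i : binomial_pmf N p i = binomial_mean N p (fun k => (k == i)%:R).
Proof.
have iM : (i < N.+1 + i.+1)%N by rewrite ltn_addl.
rewrite (@binomial_meanE _ _ _ (N.+1 + i.+1)) ?leq_addr //.
rewrite (bigD1 (Ordinal iM)) //= eqxx mulr1 big1 ?addr0 // => j.
by rewrite -val_eqE /= => /negbTE ->; rewrite mulr0.
Qed.

Lemma sum_nat_shift m M (F : nat -> R) :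
  \sum_(m <= i < m + M) F i = \sum_(0 <= i < M) F (m + i)%N.
Proof.
rewrite -{1}[m]add0n big_addn addKn.
by apply: eq_bigr => i _; rewrite addnC.
Qed.

Lemma binomial_mean_split N p f m : binomial_mean N p f =
  \sum_(0 <= i < m) binomial_pmf N p i * f i
  + \sum_(0 <= j < N.+1) binomial_pmf N p (m + j) * f (m + j)%N.
Proof.
rewrite (@binomial_meanE _ _ _ (m + N.+1)); last by rewrite addnS ltnS leq_addl.
rewrite -(big_mkord xpredT (fun i => binomial_pmf N p i * f i)).
by rewrite (@big_cat_nat _ _ _ m) ?leq_addr //= [X in _ + X]sum_nat_shift.
Qed.

Lemma binomial_mean_tail_ge N p f m M : 0 <= p <= 1 -> (forall i, 0 <= f i) ->
  \sum_(0 <= j < M) binomial_pmf N p (m + j) * f (m + j)%N <= binomial_mean N p f.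
Proof.
move=> p01 f_ge0; have term_ge0 i : 0 <= binomial_pmf N p i * f i.
  by rewrite mulr_ge0 ?binomial_pmf_ge0.
rewrite (@binomial_meanE _ _ _ (m + (M + N.+1))); last by rewrite !addnS ltnS addnA leq_addl.
rewrite -(big_mkord xpredT (fun i => binomial_pmf N p i * f i)).
rewrite [leRHS](@big_cat_nat _ _ _ m) ?leq_addr //= [X in _ <= _ + X]sum_nat_shift.
rewrite [X in _ <= _ + X](@big_cat_nat _ _ _ M) ?leq_addr //= addrCA lerDl.
by rewrite addr_ge0 ?sumr_ge0.
Qed.

Lemma binomial_mgf_le N p l : 0 <= p <= 1 -> `|l| <= 1 / 3 ->
  binomial_mean N p (fun i => expR (l * (i%:R - N%:R * p)))
    <= expR (l ^+ 2 * (N%:R * p * (1 - p))).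
Proof.
move=> p01 l_le; have /andP[p_ge0 p_le1] := p01.
have shifted c : binomial_mean N p (fun i => expR (l * i%:R + c))
    <= expR (l * (N%:R * p) + c + l ^+ 2 * (N%:R * p * (1 - p))).
  elim: N c => [|N IH] c /=; first by rewrite ler_expR; lra.
  rewrite (@eq_binomial_mean _ _ _ (fun i => expR (l * i%:R + (c + l)))); last first.
    by move=> i _; congr expR; rewrite -natr1; ring.
  pose E := l * (N%:R * p) + l ^+ 2 * (N%:R * p * (1 - p)).
  apply: (@le_trans _ _ (expR E * (p * expR (c + l) + (1 - p) * expR c))).
    rewrite mulrDr; apply: lerD; rewrite mulrCA -expRD ler_wpM2l ?subr_ge0 //;
      by apply: le_trans (IH _) _; rewrite ler_expR /E; lra.
  have l_eq : c + l - c = l by ring.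
  have step := @two_point_mgf_le R p (c + l) c p01.
  rewrite l_eq in step; apply: le_trans (ler_wpM2l (expR_ge0 _) (step l_le)) _.
  by rewrite -expRD ler_expR /E -natr1; lra.
rewrite (@eq_binomial_mean _ _ _ (fun i => expR (l * i%:R - l * (N%:R * p)))) => [|i _].
  by apply: le_trans (shifted _) _; rewrite ler_expR; lra.
by rewrite mulrBr.
Qed.

End BinomialMass.

Section BinomialReflection.
Variable R : realType.
Implicit Types (p n x y a c : R) (N m i j : nat).

Definition up_factor n p x y : R := (n - x - y) * (n - x + y + 1) * p ^+ 2.

Definition down_factor n p x y : R := (x + y + 1) * (x - y) * (1 - p) ^+ 2.

Lemma up_factor_ge n p x y : 0 <= n -> 0 < p -> p <= 1 -> x <= n * p -> 0 <= y ->
  (n * p * (1 - p)) ^+ 2 + n * p * (1 - p) * p - p ^+ 2 * (y ^+ 2 + y) <= up_factor n p x y.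
Proof.
move=> n_ge0 p_gt0 p_le1 x_le y_ge0; have p_ge0 := ltW p_gt0.
have lam_ge0 : 0 <= n * p * (1 - p) by rewrite !mulr_ge0 // subr_ge0.
have lam_le : n * p * (1 - p) <= (n - x) * p by rewrite mulrAC ler_wpM2r //; lra.
have -> : up_factor n p x y
    = ((n - x) * p) ^+ 2 + (n - x) * p * p - p ^+ 2 * (y ^+ 2 + y).
  by rewrite /up_factor; ring.
rewrite lerD2r lerD ?ler_wpM2r // lerXn2r ?nnegrE //.
exact: le_trans lam_le.
Qed.

Lemma down_factor_le n p x y : 0 <= x -> p <= 1 -> x <= n * p -> 0 <= y ->
  down_factor n p x y
    <= (n * p * (1 - p)) ^+ 2 + n * p * (1 - p) * (1 - p) - (1 - p) ^+ 2 * (y ^+ 2 + y).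
Proof.
move=> x_ge0 p_le1 x_le y_ge0; have q_ge0 : 0 <= 1 - p by rewrite subr_ge0.
have xq_le : x * (1 - p) <= n * p * (1 - p) by rewrite ler_wpM2r.
have xq_ge0 : 0 <= x * (1 - p) by rewrite mulr_ge0.
have -> : down_factor n p x y
    = (x * (1 - p)) ^+ 2 + x * (1 - p) * (1 - p) - (1 - p) ^+ 2 * (y ^+ 2 + y).
  by rewrite /down_factor; ring.
rewrite lerD2r lerD ?ler_wpM2r // lerXn2r ?nnegrE //.
exact: le_trans xq_le.
Qed.

Lemma down_factor_le_up_far n p x y : 0 <= n -> 0 < p -> p <= 1 / 2 -> 0 <= x ->
    x <= n * p -> 0 <= y -> n * p * (1 - p) <= y ^+ 2 + y ->
  down_factor n p x y <= up_factor n p x y.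
Proof.
move=> n_ge0 p_gt0 p_le x_ge0 x_le y_ge0 far; have p_le1 : p <= 1 by lra.
apply: le_trans (down_factor_le x_ge0 p_le1 x_le y_ge0) _.
apply: le_trans (up_factor_ge n_ge0 p_gt0 p_le1 x_le y_ge0).
move: (n * p * (1 - p)) (y ^+ 2 + y) far => lam z far.
have : 0 <= (1 - 2 * p) * (z - lam) by apply: mulr_ge0; lra.
by lra.
Qed.

Lemma down_factor_le_up_near n p x y : 0 <= n -> 0 < p -> p <= 1 / 2 -> 0 <= x ->
    x <= n * p -> 0 <= y -> 1 <= n * p * (1 - p) -> y ^+ 2 + y <= n * p * (1 - p) ->
  (1 - 1 / (n * p * (1 - p))) * down_factor n p x y <= up_factor n p x y.
Proof.
move=> n_ge0 p_gt0 p_le x_ge0 x_le y_ge0 lam_ge1 near; have p_le1 : p <= 1 by lra.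
have down_le := down_factor_le x_ge0 p_le1 x_le y_ge0.
apply: le_trans (up_factor_ge n_ge0 p_gt0 p_le1 x_le y_ge0).
have z_ge0 : 0 <= y ^+ 2 + y by rewrite addr_ge0 ?sqr_ge0.
move: (n * p * (1 - p)) (y ^+ 2 + y) (down_factor n p x y) near lam_ge1 z_ge0 down_le.
move=> lam z down /= near lam_ge1 z_ge0 down_le; have lam_gt0 : 0 < lam by lra.
have factor_ge0 : 0 <= 1 - 1 / lam by rewrite subr_ge0 ler_pdivrMr // mul1r.
pose D := lam ^+ 2 + lam * (1 - p) - (1 - p) ^+ 2 * z.
apply: le_trans (ler_wpM2l factor_ge0 down_le) _; rewrite -/D.
have lam_le_D : lam <= D / lam.
  rewrite ler_pdivlMr // -expr2 /D -addrA lerDl subr_ge0 expr2 -mulrA mulrC.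
  by rewrite ler_wpM2r //; [lra|nra].
have -> : (1 - 1 / lam) * D = D - D / lam by field; rewrite gt_eqF.
rewrite /D in lam_le_D *; have : 0 <= (1 - 2 * p) * z by apply: mulr_ge0; lra.
have : 0 <= p * lam by apply: mulr_ge0; lra.
by lra.
Qed.

Lemma binomial_pmf_mirror_ratio N p m j : (j < m)%N -> (m + m <= N)%N ->
  binomial_pmf N p (m + j.+1) * binomial_pmf N p (m - j) * down_factor N%:R p m%:R j%:R
  = binomial_pmf N p (m + j) * binomial_pmf N p (m - j.+1) * up_factor N%:R p m%:R j%:R.
Proof.
move=> jm mN; have up_le : (m + j <= N)%N by lia.
have down_le : (m - j.+1 <= N)%N by lia.
have up := binomial_pmf_ratio p up_le.
have down := binomial_pmf_ratio p down_le.
rewrite (_ : (m - j.+1).+1 = (m - j)%N) in down; last by lia.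
rewrite addnS; move: up down; rewrite -natr1 natrD (natrB _ (ltnW jm)) (natrB _ jm) => up down.
transitivity (binomial_pmf N p (m + j).+1 * ((m%:R + j%:R + 1) * (1 - p))
    * (binomial_pmf N p (m - j) * ((m%:R - j%:R) * (1 - p)))).
  by rewrite /down_factor; ring.
by rewrite up down -natr1 /up_factor; ring.
Qed.

Lemma binomial_pmf_reflect_step N p m j a c : 0 < p < 1 -> (j < m)%N -> (m + m <= N)%N ->
    0 <= a -> 0 <= c -> c * down_factor N%:R p m%:R j%:R <= up_factor N%:R p m%:R j%:R ->
    a * binomial_pmf N p (m - j) <= binomial_pmf N p (m + j) ->
  a * c * binomial_pmf N p (m - j.+1) <= binomial_pmf N p (m + j.+1).
Proof.
move=> p01 jm mN a_ge0 c_ge0 c_le IH; have /andP[p_gt0 p_lt1] := p01.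
have below_gt0 i : 0 < binomial_pmf N p (m - i).
  apply: binomial_pmf_gt0 => //; apply: leq_trans mN.
  exact: leq_trans (leq_subr _ _) (leq_addr _ _).
have j_ge0 : 0 <= j%:R :> R by [].
have j_lt : j%:R + 1 <= m%:R :> R by rewrite natr1 ler_nat.
have down_gt0 : 0 < down_factor N%:R p m%:R j%:R.
  by rewrite !mulr_gt0 ?exprn_gt0 //; lra.
rewrite -(ler_pM2r (mulr_gt0 (below_gt0 j) down_gt0)) [leRHS]mulrA binomial_pmf_mirror_ratio //.
rewrite [leRHS]mulrAC [leLHS](_ : _ = a * binomial_pmf N p (m - j)
  * (c * down_factor N%:R p m%:R j%:R) * binomial_pmf N p (m - j.+1)); last by ring.
rewrite ler_pM2r //; apply: ler_pM => //; rewrite mulr_ge0 //; exact: ltW.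
Qed.

(* The binomial law is almost symmetric about its mode: the mass lost by reflecting
   in [m] is at most of the order of one standard deviation. *)
Lemma binomial_pmf_reflect N p m j : 0 < p -> p <= 1 / 2 -> m%:R <= N%:R * p ->
    1 <= N%:R * p * (1 - p) -> (j <= m)%N ->
  (1 - Num.min j%:R (Num.sqrt (N%:R * p * (1 - p)) + 1) / (N%:R * p * (1 - p)))
    * binomial_pmf N p (m - j) <= binomial_pmf N p (m + j).
Proof.
move=> p_gt0 p_le mNp; set lam := N%:R * p * (1 - p) => lam_ge1.
have lam_gt0 : 0 < lam by lra.
have p01 : 0 < p < 1 by apply/andP; lra.
have m_ge0 : 0 <= m%:R :> R by [].
have mN : (m + m <= N)%N.
  by rewrite -(ler_nat R) natrD; have : 0 <= N%:R :> R by []; nra.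
set s := Num.sqrt lam; have s_ge0 : 0 <= s by exact: sqrtr_ge0.
have s_sqr : s ^+ 2 = lam by rewrite sqr_sqrtr // ltW.
set loss := fun i : nat => Num.min (i%:R : R) (s + 1) / lam.
elim: j => [|j IH] jm.
  by rewrite subn0 addn0 min_l ?mul0r ?subr0 ?mul1r //; lra.
rewrite -/(loss _) in IH *; have {}IH := IH (ltnW jm).
have loss_mono : loss j <= loss j.+1.
  rewrite /loss ler_pM2r ?invr_gt0 // le_min ge_min ge_min lexx orbT andbT.
  by rewrite ler_nat leqnSn.
have pmf_ge0 i : 0 <= binomial_pmf N p i by rewrite binomial_pmf_ge0 //; apply/andP; lra.
have [full|partial] := ltP (1 - loss j.+1) 0.
  by apply: le_trans (pmf_ge0 _); rewrite nmulr_rle0.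
have kept_ge0 : 0 <= 1 - loss j by lra.
have j_ge0 : 0 <= j%:R :> R by [].
have [near|far] := leP (j%:R ^+ 2 + j%:R) lam; last first.
  have down_le_up := down_factor_le_up_far (ler0n R N) p_gt0 p_le m_ge0 mNp j_ge0 (ltW far).
  apply: le_trans (binomial_pmf_reflect_step (c := 1) p01 jm mN kept_ge0 ler01 _ IH).
    by rewrite mulr1; apply: ler_wpM2r => //; rewrite lerD2l lerN2.
  by rewrite mul1r.
have shrink_ge0 : 0 <= 1 - 1 / lam by rewrite subr_ge0 ler_pdivrMr // mul1r.
have down_le_up := down_factor_le_up_near (ler0n R N) p_gt0 p_le m_ge0 mNp j_ge0 lam_ge1 near.
apply: le_trans (binomial_pmf_reflect_step p01 jm mN kept_ge0 shrink_ge0 down_le_up IH).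
apply: ler_wpM2r => //; have j_le_s : j%:R <= s.
  by rewrite -(@ler_pXn2r _ 2) ?nnegrE // s_sqr; nra.
rewrite /loss !min_l -?natr1; [|lra|lra].
have : 0 <= j%:R / lam * (1 / lam) by rewrite mulr_ge0 ?divr_ge0 // ltW.
by rewrite mulrDl; lra.
Qed.

Lemma binomial_mean_below N p m (h : nat -> R) : h 0%N = 0 ->
  binomial_mean N p (fun i => h (m - i)%N)
  = \sum_(0 <= j < m.+1) binomial_pmf N p (m - j) * h j.
Proof.
move=> h0; rewrite (binomial_mean_split _ _ _ m.+1) [X in _ + X]big1 ?addr0; last first.
  by move=> j _; rewrite (_ : (m - (m.+1 + j) = 0)%N) ?h0 ?mulr0 //; lia.
rewrite big_nat_rev /= add0n !big_nat; apply: eq_bigr => i im.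
by rewrite subSS subKn.
Qed.

Lemma binomial_mean_above N p m (h : nat -> R) : 0 <= p <= 1 -> (forall i, 0 <= h i) ->
  \sum_(0 <= j < m.+1) binomial_pmf N p (m + j) * h j
    <= binomial_mean N p (fun i => h (i - m)%N).
Proof.
move=> p01 h_ge0; have := @binomial_mean_tail_ge R N p (fun i => h (i - m)%N) m m.+1 p01.
move=> /(_ (fun i => h_ge0 _)); apply: le_trans; rewrite le_eqVlt; apply/orP; left.
by apply/eqP/eq_bigr => j _; rewrite addKn.
Qed.

Lemma binomial_mean_reflect N p m (h : nat -> R) : 0 < p -> p <= 1 / 2 ->
    m%:R <= N%:R * p -> 1 <= N%:R * p * (1 - p) ->
    (forall i, 0 <= h i) -> (forall i, h i <= i%:R) ->
  binomial_mean N p (fun i => h (m - i)%N) - 2 <= binomial_mean N p (fun i => h (i - m)%N).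
Proof.
move=> p_gt0 p_le mNp lam_ge1 h_ge0 h_le.
have p01 : 0 <= p <= 1 by apply/andP; lra.
have h0 : h 0%N = 0 by apply/eqP; rewrite eq_le h_le h_ge0.
have lam_ge0 : 0 <= N%:R * p * (1 - p) by lra.
set s := Num.sqrt (N%:R * p * (1 - p)).
have s_sqr : s ^+ 2 = N%:R * p * (1 - p) by rewrite sqr_sqrtr.
have s_ge1 : 1 <= s by rewrite -(@ler_pXn2r _ 2) ?nnegrE ?sqrtr_ge0 // s_sqr expr1n.
have s_gt0 : 0 < s by lra.
have mass_le j : (j <= m)%N ->
    (1 - 2 / s) * binomial_pmf N p (m - j) <= binomial_pmf N p (m + j).
  move=> jm; apply: le_trans (binomial_pmf_reflect p_gt0 p_le mNp lam_ge1 jm).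
  apply: ler_wpM2r; first exact: binomial_pmf_ge0.
  rewrite lerD2l lerN2 -/s -s_sqr ler_pdivrMr ?exprn_gt0 //.
  rewrite expr2 mulrA divfK ?gt_eqF // ge_min; apply/orP; right; lra.
apply: le_trans (binomial_mean_above _ _ p01 h_ge0).
apply: (@le_trans _ _ ((1 - 2 / s) * binomial_mean N p (fun i => h (m - i)%N))); last first.
  rewrite binomial_mean_below // mulr_sumr !big_nat; apply: ler_sum => j /andP[_ jm].
  by rewrite mulrA ler_wpM2r ?mass_le.
rewrite mulrBl mul1r lerD2l lerN2 mulrAC ler_pdivrMr // ler_pM2l //.
apply: le_trans (binomial_mean_abs_le p01 s_gt0 s_sqr).
apply: binomial_mean_le => // i; apply: le_trans (h_le _) _.
have [im|im] := leqP i m; last by rewrite (eqP (ltnW im)) normr_ge0.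
by rewrite natrB // distrC; apply: le_trans (ler_norm _); rewrite lerD2r.
Qed.

End BinomialReflection.

Section SoftThreshold.
Variable R : realDomainType.
Implicit Types t x y : R.

Definition soft_threshold t y : R := Num.max (y - t) 0 - Num.max (- y - t) 0.

Lemma soft_thresholdN t y : soft_threshold t (- y) = - soft_threshold t y.
Proof. by rewrite /soft_threshold opprK opprB. Qed.

Lemma maxr0E y : Num.max y 0 = y + Num.max (- y) 0.
Proof. by case: (leP y 0); case: (leP (- y) 0); lra. Qed.

Lemma soft_threshold0 y : soft_threshold 0 y = y.
Proof. by rewrite /soft_threshold !subr0 (maxr0E y) addrK. Qed.

Lemma soft_threshold_neg t y : soft_threshold (- t) y = 2 * y - soft_threshold t y.
Proof.
rewrite /soft_threshold (maxr0E (y - - t)) (maxr0E (- y - - t)) !opprB !opprK.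
by rewrite [- y - t]addrC [- t + y]addrC; ring.
Qed.

Lemma soft_threshold_homo t x y : 0 <= t -> x <= y ->
  0 <= soft_threshold t y - soft_threshold t x <= y - x.
Proof.
rewrite /soft_threshold; case: (leP (y - t) 0); case: (leP (- y - t) 0);
  case: (leP (x - t) 0); case: (leP (- x - t) 0); lra.
Qed.

Lemma soft_threshold_lipschitz t x y : 0 <= t ->
  `|soft_threshold t y - soft_threshold t x| <= `|y - x|.
Proof.
move=> t_ge0.
wlog xy : x y / x <= y.
  by case: (leP x y) => [|/ltW] yx /(_ _ _ yx) //; rewrite distrC [leRHS]distrC.
have /andP[diff_ge0 diff_le] := soft_threshold_homo t_ge0 xy.
by rewrite ger0_norm // ger0_norm // subr_ge0.
Qed.

Lemma soft_threshold_norm_le t y : 0 <= t -> `|soft_threshold t y| <= `|y|.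
Proof.
move=> t_ge0; have := soft_threshold_lipschitz 0 y t_ge0; rewrite subr0.
by rewrite [soft_threshold t 0]/soft_threshold oppr0 subrr subr0.
Qed.

Lemma soft_threshold_natr t (m i : nat) : 0 <= t -> soft_threshold t (i%:R - m%:R) =
  Num.max ((i - m)%N%:R - t) 0 - Num.max ((m - i)%N%:R - t) 0.
Proof.
move=> t_ge0; rewrite /soft_threshold opprB.
have [im|/ltnW mi] := leqP i m.
  rewrite (eqP im) natrB // sub0r (@max_r _ _ (i%:R - m%:R - t)) ?(@max_r _ _ (- t)) ?oppr_le0 //.
  by rewrite subr_le0 (le_trans _ t_ge0) // subr_le0 ler_nat.
rewrite (eqP mi) natrB // sub0r (@max_r _ _ (m%:R - i%:R - t)) ?(@max_r _ _ (- t)) ?oppr_le0 //.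
by rewrite subr_le0 (le_trans _ t_ge0) // subr_le0 ler_nat.
Qed.

End SoftThreshold.

Section BinomialSoftThreshold.
Variable R : realType.
Implicit Types (p t : R) (N m : nat).

Lemma binomial_mean_soft_small N p m t : 0 <= p <= 1 -> 0 <= t ->
    m%:R <= N%:R * p -> N%:R * p < m%:R + 1 -> N%:R * p * (1 - p) <= 1 ->
  `|binomial_mean N p (fun i => soft_threshold t (i%:R - m%:R))| <= 3.
Proof.
move=> p01 t_ge0 mNp Npm lam_le1.
have dev_le i : `|soft_threshold t (i%:R - m%:R : R)| <= (i%:R - m%:R) ^+ 2.
  apply: le_trans (soft_threshold_norm_le _ t_ge0) _.
  have -> : i%:R - m%:R = (i%:Z - m%:Z)%:~R :> R by rewrite rmorphB.
  rewrite -intr_norm -rmorphXn ler_int; nia.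
have mean_le : binomial_mean N p (fun i => (i%:R - m%:R) ^+ 2) <= 3.
  by rewrite binomial_mean_sqr expr2; nra.
rewrite ler_norml; apply/andP; split; last first.
  apply: le_trans mean_le; apply: binomial_mean_le => // i.
  by have := dev_le i; rewrite ler_norml => /andP[].
apply: (@le_trans _ _ (binomial_mean N p (fun i => -1 * (i%:R - m%:R) ^+ 2))).
  by rewrite binomial_meanZ mulN1r lerN2.
apply: binomial_mean_le => // i; rewrite mulN1r.
by have := dev_le i; rewrite ler_norml => /andP[].
Qed.

Lemma binomial_mean_soft_half N p m t : 0 <= p -> p <= 1 / 2 -> 0 <= t ->
    m%:R <= N%:R * p -> N%:R * p < m%:R + 1 ->
  `|binomial_mean N p (fun i => soft_threshold t (i%:R - m%:R))| <= 3.
Proof.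
move=> p_ge0 p_le t_ge0 mNp Npm; have p01 : 0 <= p <= 1 by apply/andP; lra.
have [lam_le1|lam_gt1] := leP (N%:R * p * (1 - p)) 1.
  exact: binomial_mean_soft_small.
have p_gt0 : 0 < p.
  rewrite lt_neqAle p_ge0 andbT; apply/eqP => p0; move: lam_gt1.
  by rewrite -p0 mulr0 mul0r ltr10.
have lam_ge1 := ltW lam_gt1.
pose over i : R := Num.max (i%:R - t) 0; pose under_ i : R := i%:R - over i.
have over_ge0 i : 0 <= over i by rewrite le_max lexx orbT.
have over_le i : over i <= i%:R by rewrite ge_max ler0n gerBl t_ge0.
have under_ge0 i : 0 <= under_ i by rewrite subr_ge0.
have under_le i : under_ i <= i%:R by rewrite gerBl.
have reflect_over := binomial_mean_reflect p_gt0 p_le mNp lam_ge1 over_ge0 over_le.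
have reflect_under := binomial_mean_reflect p_gt0 p_le mNp lam_ge1 under_ge0 under_le.
have mean_eq : binomial_mean N p (fun i => (i - m)%N%:R)
    - binomial_mean N p (fun i => (m - i)%N%:R) = N%:R * p - m%:R.
  rewrite -binomial_mean_id -binomial_meanB; apply: eq_binomial_mean => i _.
  have [im|/ltnW mi] := leqP i m; first by rewrite (eqP im) natrB // sub0r opprB.
  by rewrite (eqP mi) natrB // subr0.
rewrite (@eq_binomial_mean _ _ _ _ (fun i => over (i - m)%N - over (m - i)%N)) => [|i _].
  by move: reflect_under; rewrite !binomial_meanB ler_norml; lra.
exact: soft_threshold_natr.
Qed.

Lemma binomial_mean_soft_le N p m t : 0 <= p <= 1 -> 0 <= t ->
    m%:R <= N%:R * p -> N%:R * p < m%:R + 1 ->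
  `|binomial_mean N p (fun i => soft_threshold t (i%:R - m%:R))| <= 4.
Proof.
move=> p01 t_ge0 mNp Npm; have /andP[p_ge0 p_le1] := p01.
have [p_le|p_gt] := leP p (1 / 2).
  by apply: le_trans (binomial_mean_soft_half _ _ _ _ _) _ => //; lra.
have q_ge0 : 0 <= 1 - p by lra.
have q_le : 1 - p <= 1 / 2 by lra.
have q01 : 0 <= 1 - p <= 1 by apply/andP; lra.
have mN : (m <= N)%N.
  by rewrite -(ler_nat R); apply: le_trans mNp _; rewrite ler_piMr.
pose soft_q d := binomial_mean N (1 - p) (fun i => soft_threshold t (i%:R - d%:R)).
have -> : binomial_mean N p (fun i => soft_threshold t (i%:R - m%:R)) = - soft_q (N - m)%N.
  rewrite binomial_mean_rev -[RHS]mulN1r /soft_q -binomial_meanZ; apply: eq_binomial_mean => i iN.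
  by rewrite mulN1r -soft_thresholdN !natrB //; congr soft_threshold; ring.
rewrite normrN; have N_eq : N%:R = (N - m)%:R + m%:R :> R by rewrite -natrD subnK.
have [floor_gt|floor_le] := ltP (N%:R * (1 - p)) (N - m)%:R; last first.
  apply: le_trans (binomial_mean_soft_half _ _ _ _ _) _ => //; lra.
case: (N - m)%N N_eq floor_gt => [|d] N_eq floor_gt.
  by have := mulr_ge0 (ler0n R N) q_ge0; lra.
rewrite -natr1 in N_eq floor_gt.
have floor_mean : `|soft_q d| <= 3 by apply: binomial_mean_soft_half => //; lra.
have shift : `|soft_q d.+1 - soft_q d| <= 1.
  rewrite /soft_q -binomial_meanB; apply: binomial_mean_norm_le => // i.
  apply: le_trans (soft_threshold_lipschitz _ _ t_ge0) _; rewrite -natr1.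
  by rewrite ler_norml; lra.
have := ler_normD (soft_q d.+1 - soft_q d) (soft_q d); rewrite subrK; lra.
Qed.

End BinomialSoftThreshold.

Section BinomialHazard.
Variable R : realType.
Implicit Types (p u s d r : R) (N m i j l : nat).

Definition upper_tail N p i : R := binomial_mean N p (fun l => (i <= l)%N%:R).

Lemma upper_tail_ge0 N p i : 0 <= p <= 1 -> 0 <= upper_tail N p i.
Proof. by move=> p01; apply: binomial_mean_ge0. Qed.

Lemma binomial_pmf_succ_ge N p s d l : 0 < p < 1 -> s ^+ 2 = N%:R * p * (1 - p) -> 0 <= d ->
    l%:R + 1 - N%:R * p <= d * s ^+ 2 ->
  (1 - d) * binomial_pmf N p l <= binomial_pmf N p l.+1.
Proof.
move=> p01 s_sqr d_ge0 l_le; have /andP[p_gt0 p_lt1] := p01.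
have pmf_ge0 i : 0 <= binomial_pmf N p i by rewrite binomial_pmf_ge0 // !ltW.
have [Nl|lN] := ltnP N l; first by rewrite (binomial_pmf_gtn _ Nl) mulr0.
have weight_gt0 : 0 < l.+1%:R * (1 - p) by rewrite mulr_gt0 ?ltr0n // subr_gt0.
rewrite -(ler_pM2r weight_gt0) (binomial_pmf_ratio p lN) mulrAC mulrC ler_wpM2l //.
suff drop_le : l%:R + 1 - N%:R * p - p <= d * (l.+1%:R * (1 - p)).
  by move: drop_le; rewrite -natr1; lra.
have [neg|pos] := leP (l%:R + 1 - N%:R * p - p) 0.
  by apply: le_trans neg _; rewrite mulr_ge0 // ltW.
apply: (@le_trans _ _ (d * s ^+ 2)); first by lra.
by rewrite ler_wpM2l // s_sqr ler_wpM2r -?natr1; lra.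
Qed.

Lemma binomial_pmf_run_ge N p d i m : 0 <= p <= 1 -> 0 <= d ->
    (forall j, (j < m)%N -> (1 - d) * binomial_pmf N p (i + j) <= binomial_pmf N p (i + j).+1) ->
    m%:R * d <= 1 ->
  (1 - m%:R * d) * binomial_pmf N p i <= binomial_pmf N p (i + m).
Proof.
move=> p01 d_ge0; elim: m => [|m IH] step md; first by rewrite mul0r subr0 mul1r addn0.
have m_ge0 : 0 <= m%:R :> R by [].
have md_ge0 : 0 <= m%:R * d by rewrite mulr_ge0.
rewrite addnS; rewrite -natr1 in md *; apply: le_trans (step m _) => //.
have {}IH := IH (fun j jm => step j (ltnW jm)) _.
have kept_ge0 : 0 <= 1 - d by lra.
apply: le_trans (ler_wpM2l kept_ge0 (IH _)); last by lra.
rewrite mulrA ler_wpM2r ?binomial_pmf_ge0 //; nra.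
Qed.

Lemma binomial_pmf_le_upper_tail_run N p d i M : 0 <= p <= 1 -> 0 <= d -> M%:R * d <= 1 / 2 ->
    (forall j, (j < M)%N -> (1 - d) * binomial_pmf N p (i + j) <= binomial_pmf N p (i + j).+1) ->
  M.+1%:R / 2 * binomial_pmf N p i <= upper_tail N p i.
Proof.
move=> p01 d_ge0 Md step.
apply: le_trans (binomial_mean_tail_ge N i M.+1 p01 (fun l => ler0n R (i <= l)%N)).
have -> : M.+1%:R / 2 * binomial_pmf N p i = \sum_(0 <= l < M.+1) binomial_pmf N p i / 2.
  by rewrite sumr_const_nat subn0 -mulr_natl; ring.
rewrite !big_nat; apply: ler_sum => l /andP[_ lM]; rewrite leq_addr mulr1.
have ld : l%:R * d <= 1 / 2 by apply: le_trans Md; rewrite ler_wpM2r // ler_nat.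
have ld1 : l%:R * d <= 1 by lra.
have step_l j : (j < l)%N -> (1 - d) * binomial_pmf N p (i + j) <= binomial_pmf N p (i + j).+1.
  by move=> jl; apply: step; apply: leq_trans jl lM.
apply: le_trans (binomial_pmf_run_ge p01 d_ge0 step_l ld1).
by rewrite mulrC ler_wpM2r ?binomial_pmf_ge0 //; lra.
Qed.

(* The mass at [i] is repeated, up to a factor [2], over a window of length [s^2 / (u + s)]. *)
Lemma binomial_pmf_le_upper_tail N p i u s : 0 < p < 1 -> 0 < s ->
    s ^+ 2 = N%:R * p * (1 - p) -> 0 <= u -> i%:R - N%:R * p <= u ->
  binomial_pmf N p i * s ^+ 2 <= 4 * (u + s) * upper_tail N p i.
Proof.
move=> p01 s_gt0 s_sqr u_ge0 i_le; have /andP[p_gt0 p_lt1] := p01.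
have p01w : 0 <= p <= 1 by rewrite !ltW.
have ss_gt0 : 0 < s ^+ 2 by rewrite exprn_gt0.
pose window := s ^+ 2 / (2 * (u + s)).
have us_gt0 : 0 < 2 * (u + s) by lra.
have window_eq : window * (2 * (u + s)) = s ^+ 2 by rewrite divfK // gt_eqF.
have window_ge0 : 0 <= window by rewrite divr_ge0 ?sqr_ge0 // ltW.
have /andP[M_le M_gt] := truncn_itv window_ge0; set M := Num.truncn window in M_le M_gt.
have M_ge0 : 0 <= M%:R :> R by [].
pose d := (u + M%:R) / s ^+ 2.
have d_ge0 : 0 <= d by rewrite divr_ge0 ?addr_ge0 // ltW.
have Md : M%:R * d <= 1 / 2.
  have window_le : window <= s / 2 by rewrite /window ler_pdivrMr // expr2; nra.
  rewrite /d mulrA ler_pdivrMr //; apply: (@le_trans _ _ (window * (u + s / 2))).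
    by apply: ler_pM; rewrite ?addr_ge0 ?lerD2l ?(le_trans M_le).
  by rewrite -window_eq; have := mulr_ge0 window_ge0 (ltW s_gt0); nra.
have step j : (j < M)%N ->
    (1 - d) * binomial_pmf N p (i + j) <= binomial_pmf N p (i + j).+1.
  move=> jM; apply: (binomial_pmf_succ_ge p01 s_sqr d_ge0).
  have : j%:R + 1 <= M%:R :> R by rewrite natr1 ler_nat.
  by rewrite /d divfK ?gt_eqF // natrD; lra.
have := binomial_pmf_le_upper_tail_run p01w d_ge0 Md step.
have pmf_ge0 := binomial_pmf_ge0 N i p01w.
have := ler_wpM2r pmf_ge0 (ltW M_gt); rewrite -window_eq.
move: (binomial_pmf N p i) (upper_tail N p i) (M.+1%:R) => b T M1 window_le tail_ge.
have := ler_wpM2l (ltW us_gt0) window_le; have := ler_wpM2l (ltW us_gt0) tail_ge; lra.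
Qed.

Lemma upper_tail_le N p i s : 0 <= p <= 1 -> 1 <= s -> s ^+ 2 = N%:R * p * (1 - p) ->
  upper_tail N p i <= 2 * expR (- ((i%:R - N%:R * p) / s / 3)).
Proof.
move=> p01 s_ge1 s_sqr; have s_gt0 : 0 < s by lra.
pose tilt := (3 * s)^-1; have tilt_ge0 : 0 <= tilt by rewrite invr_ge0; lra.
have tilt_le : `|tilt| <= 1 / 3.
  by rewrite ger0_norm // div1r lef_pV2 ?posrE; lra.
apply: (@le_trans _ _ (binomial_mean N p (fun l => expR (- (tilt * (i%:R - N%:R * p))) *
    expR (tilt * (l%:R - N%:R * p))))).
  apply: binomial_mean_le => // l; rewrite -expRD; case: leqP => il; last exact: expR_ge0.
  rewrite -[leLHS]expR0 ler_expR -mulrN -mulrDr mulr_ge0 //.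
  have : i%:R <= l%:R :> R by rewrite ler_nat.
  by lra.
rewrite binomial_meanZ mulrC.
have -> : tilt * (i%:R - N%:R * p) = (i%:R - N%:R * p) / s / 3 by rewrite /tilt invfM; ring.
apply: ler_wpM2r; first exact: expR_ge0.
apply: le_trans (binomial_mgf_le _ p01 tilt_le) _; rewrite -s_sqr -exprMn.
have -> : tilt * s = 1 / 3 by rewrite /tilt invfM -mulrA mulVf ?gt_eqF //; lra.
by apply: le_trans (expR_le_quadratic _) _; lra.
Qed.

Lemma pow4_mul_expRN_le (x : R) : 0 <= x -> x ^+ 4 * expR (- (x / 3)) <= 12 ^+ 4.
Proof.
move=> x_ge0; rewrite expRN ler_pdivrMr ?expR_gt0 //.
have -> : expR (x / 3) = expR (x / 12) ^+ 4 by rewrite -expRM_natr; congr expR; lra.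
rewrite -exprMn lerXn2r ?nnegrE ?mulr_ge0 ?expR_ge0 //.
by have := expR_ge1Dx (x / 12); lra.
Qed.

End BinomialHazard.

Section BinomialPointMass.
Variables (R : realType) (N : nat) (p K r s : R).
Hypotheses (K_ge : 16 * 12 ^+ 4 <= K) (p01 : 0 < p < 1) (s_ge1 : 1 <= s)
  (s_sqr : s ^+ 2 = N%:R * p * (1 - p)) (r_ge1 : 1 <= r).
Implicit Types (k : R) (m i j l : nat).

Let p01w : 0 <= p <= 1. Proof. by have /andP[/ltW -> /ltW ->] := p01. Qed.
Let s_gt0 : 0 < s. Proof. exact: lt_le_trans ltr01 s_ge1. Qed.
Let r_gt0 : 0 < r. Proof. exact: lt_le_trans ltr01 r_ge1. Qed.
Let K_ge16 : 16 <= K.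
Proof. by apply: le_trans K_ge; rewrite ler_peMr // exprn_ege1 //; lra. Qed.
Let K_ge0 : 0 <= K. Proof. by apply: le_trans K_ge16. Qed.

Lemma binomial_pmf_le_near i : i%:R - N%:R * p <= r * s ->
  binomial_pmf N p i <= K / s * (r * upper_tail N p i).
Proof.
move=> near; have tail_ge0 := upper_tail_ge0 N i p01w.
have rs_ge0 : 0 <= r * s by rewrite mulr_ge0 // ltW.
have ss_gt0 : 0 < s ^+ 2 by rewrite exprn_gt0.
rewrite -(ler_pM2r ss_gt0); apply: le_trans (binomial_pmf_le_upper_tail p01 s_gt0 s_sqr rs_ge0 near) _.
have -> : K / s * (r * upper_tail N p i) * s ^+ 2 = K * (r * s) * upper_tail N p i.
  by field; rewrite gt_eqF.
apply: ler_wpM2r => //; apply: (@le_trans _ _ (16 * (r * s))); last by rewrite ler_wpM2r.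
have : s <= r * s by rewrite ler_peMl // ltW.
by lra.
Qed.

Lemma binomial_pmf_le_far i : r * s <= i%:R - N%:R * p ->
  binomial_pmf N p i <= K / s * (r ^+ 3)^-1.
Proof.
move=> far; have [tail_ge0 pmf_ge0] := (upper_tail_ge0 N i p01w, binomial_pmf_ge0 N i p01w).
pose u := i%:R - N%:R * p; pose t := u / s; have u_eq : u = t * s by rewrite /t divfK // gt_eqF.
have r_le_t : r <= t by rewrite /t ler_pdivlMr.
have t_gt0 : 0 < t by apply: lt_le_trans r_le_t.
have t_ge1 : 1 <= t := le_trans r_ge1 r_le_t.
have u_ge0 : 0 <= u by rewrite u_eq mulr_ge0 // ltW.
have mass_le : binomial_pmf N p i * s <= 8 * t * upper_tail N p i.
  rewrite -(ler_pM2r s_gt0) [leLHS](_ : _ = binomial_pmf N p i * s ^+ 2); last by ring.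
  apply: le_trans (binomial_pmf_le_upper_tail p01 s_gt0 s_sqr u_ge0 (lexx _)) _.
  rewrite u_eq; have := mulr_ge0 (mulr_ge0 (ltW s_gt0) tail_ge0) (_ : 0 <= t - 1).
  by rewrite subr_ge0 => /(_ t_ge1); lra.
have tail_le : upper_tail N p i <= 2 * expR (- (t / 3)) by apply: upper_tail_le.
have r3_gt0 : 0 < r ^+ 3 by rewrite exprn_gt0.
rewrite mulrAC ler_pdivlMr // ler_pdivlMr //.
apply: (@le_trans _ _ (8 * t * upper_tail N p i * t ^+ 3)).
  have cube_le : r ^+ 3 <= t ^+ 3 by rewrite lerXn2r // nnegrE ltW.
  by apply: ler_pM => //; [rewrite mulr_ge0 // ltW | exact: ltW].
have := ler_wpM2l (exprn_ge0 4 (ltW t_gt0)) tail_le.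
have := pow4_mul_expRN_le (ltW t_gt0); move: (upper_tail _ _ _) (expR _) K_ge => T E.
by rewrite (_ : t ^+ 4 * (2 * E) = 2 * (t ^+ 4 * E)); [lra|ring].
Qed.

(* The factor [r] trades the Gaussian correction of the hazard rate against a
   polynomially small additive error. *)
Lemma binomial_pmf_le_hazard i :
  binomial_pmf N p i <= K / s * (r * upper_tail N p i + (r ^+ 3)^-1).
Proof.
have Ks_ge0 : 0 <= K / s by rewrite divr_ge0 // ltW.
have tail_ge0 := upper_tail_ge0 N i p01w.
have [near|/ltW far] := leP (i%:R - N%:R * p) (r * s).
  apply: le_trans (binomial_pmf_le_near near) _.
  by rewrite ler_wpM2l // lerDl invr_ge0 exprn_ge0 // ltW.
apply: le_trans (binomial_pmf_le_far far) _.
by rewrite ler_wpM2l // lerDr mulr_ge0 // ltW.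
Qed.

Lemma binomial_point_le_above m j :
  binomial_mean N p (fun l => (m + l == j)%N%:R)
    <= K / s * (r * binomial_mean N p (fun l => (j <= m + l)%N%:R) + (r ^+ 3)^-1).
Proof.
have [jm|mj] := ltnP j m.
  rewrite (@eq_binomial_mean _ _ _ _ (fun=> 0)) => [|l _]; last first.
    by rewrite gtn_eqF // ltn_addr.
  rewrite binomial_mean_cst mulr_ge0 ?divr_ge0 ?(ltW s_gt0) // addr_ge0 ?mulr_ge0 ?(ltW r_gt0) //.
    exact: binomial_mean_ge0.
  by rewrite invr_ge0 exprn_ge0 // ltW.
rewrite (@eq_binomial_mean _ _ _ _ (fun l => (l == j - m)%N%:R)) => [|l _]; last first.
  by rewrite -(eqn_add2l m l) subnKC.
rewrite -binomial_pmf_mean; apply: le_trans (binomial_pmf_le_hazard _) _.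
rewrite /upper_tail (@eq_binomial_mean _ _ _ _ (fun l => (j <= m + l)%N%:R)) // => l _.
by rewrite leq_subLR.
Qed.

End BinomialPointMass.

Lemma binomial_point_le_below (R : realType) N (p K r s : R) m j :
    16 * 12 ^+ 4 <= K -> 0 < p < 1 -> 1 <= s -> s ^+ 2 = N%:R * p * (1 - p) -> 1 <= r ->
  binomial_mean N p (fun l => (m + l == j)%N%:R)
    <= K / s * (r * binomial_mean N p (fun l => (m + l <= j)%N%:R) + (r ^+ 3)^-1).
Proof.
move=> K_ge p01 s_ge1 s_sqr r_ge1; have /andP[p_gt0 p_lt1] := p01.
have q01 : 0 < 1 - p < 1 by apply/andP; lra.
have s_sqr' : s ^+ 2 = N%:R * (1 - p) * (1 - (1 - p)) by rewrite s_sqr; ring.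
have [jN|jN] := leqP j (m + N); last first.
  rewrite (@eq_binomial_mean _ _ _ _ (fun=> 0)) => [|l lN]; last first.
    by rewrite ltn_eqF // (leq_ltn_trans _ jN) // leq_add2l.
  have K_ge0 : 0 <= K by apply: le_trans K_ge; rewrite mulr_ge0 ?exprn_ge0.
  have [r_ge0 s_ge0] : 0 <= r /\ 0 <= s by split; lra.
  have mean_ge0 : 0 <= binomial_mean N p (fun l => (m + l <= j)%N%:R).
    by apply: binomial_mean_ge0 => //; rewrite !ltW.
  by rewrite binomial_mean_cst mulr_ge0 ?divr_ge0 // addr_ge0 ?mulr_ge0 ?invr_ge0 ?exprn_ge0.
have := binomial_point_le_above K_ge q01 s_ge1 s_sqr' r_ge1 0 (m + N - j).
rewrite !(binomial_mean_rev _ p).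
rewrite (@eq_binomial_mean _ _ _ _ (fun l => (m + (N - l) == j)%N%:R)) => [|l lN]; last first.
  by congr (nat_of_bool _)%:R; lia.
rewrite (@eq_binomial_mean _ _ _ (fun l => (_ <= 0 + l)%N%:R) (fun l => (m + (N - l) <= j)%N%:R)) //.
by move=> l lN; congr (nat_of_bool _)%:R; lia.
Qed.

Lemma binomial_mean_expR_penalty (R : realType) N (p k k' : R) (a b : pred nat) :
    0 <= p <= 1 -> 0 <= k <= 1 / 3 -> (forall l, a l -> b l) ->
    3 * binomial_mean N p (fun l => (a l)%:R)
      <= k / 2 * binomial_mean N p (fun l => (b l)%:R) + k' ->
  binomial_mean N p (fun l => expR ((a l)%:R - k * (b l)%:R - k')) <= 1.
Proof.
move=> p01 /andP[k_ge0 k_le] ab mean_le.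
apply: (@le_trans _ _ (binomial_mean N p (fun l => expR (- k') *
    (3 * (a l)%:R + (- (k / 2) * (b l)%:R + 1))))).
  apply: binomial_mean_le => // l; rewrite addrC expRD ler_wpM2l ?expR_ge0 //.
  case: (boolP (a l)) => [/ab ->|_] /=.
    by apply: le_trans (_ : expR 1 <= _); [rewrite ler_expR; lra|have := @expR1_le R; lra].
  case: (b l) => /=; last by rewrite !mulr0 subr0 expR0; lra.
  by apply: le_trans (expR_le_quadratic _) _; nra.
rewrite binomial_meanZ !binomial_meanP binomial_mean_cst.
rewrite expRN mulrC ler_pdivrMr ?expR_gt0 // mul1r.
by apply: le_trans (expR_ge1Dx _); lra.
Qed.

Section PenalizedMgf.
Variables (R : realType) (N : nat) (p K r s k k' : R).
Hypotheses (K_ge : 16 * 12 ^+ 4 <= K) (p01 : 0 < p < 1) (s_ge1 : 1 <= s)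
  (s_sqr : s ^+ 2 = N%:R * p * (1 - p)) (r_ge1 : 1 <= r)
  (k_eq : k = 6 * K * r / s) (k'_eq : k' = 3 * K * (r ^+ 3)^-1 / s) (k_le : k <= 1 / 3).

Let p01w : 0 <= p <= 1. Proof. by have /andP[/ltW -> /ltW ->] := p01. Qed.

Let k_bounds : 0 <= k <= 1 / 3.
Proof.
have K_ge0 : 0 <= K by apply: le_trans K_ge; rewrite mulr_ge0 ?exprn_ge0.
have [r_ge0 s_ge0] := (le_trans ler01 r_ge1, le_trans ler01 s_ge1).
by rewrite k_le andbT k_eq divr_ge0 // !mulr_ge0.
Qed.

Let hazard_eq (a b : R) : a <= K / s * (r * b + (r ^+ 3)^-1) -> 3 * a <= k / 2 * b + k'.
Proof.
rewrite k_eq k'_eq; have s_neq0 : s != 0 by rewrite gt_eqF // (lt_le_trans ltr01).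
have -> : 6 * K * r / s / 2 * b + 3 * K * (r ^+ 3)^-1 / s
    = 3 * (K / s * (r * b + (r ^+ 3)^-1)) by field; rewrite s_neq0 gt_eqF // (lt_le_trans ltr01).
by rewrite ler_pM2l.
Qed.

Lemma binomial_mgf_point_above m j :
  binomial_mean N p (fun l => expR ((m + l == j)%N%:R - k * (j <= m + l)%N%:R - k')) <= 1.
Proof.
apply: (@binomial_mean_expR_penalty _ _ _ _ _
  (fun l => m + l == j) (fun l => j <= m + l))%N p01w k_bounds _ _.
  by move=> l /eqP ->.
exact/hazard_eq/binomial_point_le_above.
Qed.

Lemma binomial_mgf_point_below m j :
  binomial_mean N p (fun l => expR ((m + l == j)%N%:R - k * (m + l <= j)%N%:R - k')) <= 1.
Proof.
apply: (@binomial_mean_expR_penalty _ _ _ _ _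
  (fun l => m + l == j) (fun l => m + l <= j))%N p01w k_bounds _ _.
  by move=> l /eqP ->.
exact/hazard_eq/binomial_point_le_below.
Qed.

End PenalizedMgf.

(** * Graphs as random edge sets *)

Section GraphDegrees.
Variable n : nat.
Implicit Types (E : {set {set 'I_n}}) (S : {set 'I_n}) (u v : 'I_n).

Lemma set2_injr u v v' : v != u -> [set u; v] = [set u; v'] -> v = v'.
Proof.
move=> vu /setP /(_ v); rewrite !inE eqxx orbT (negbTE vu) /=.
by move/esym/eqP.
Qed.

Lemma deg_neighbours E v : [forall e in E, #|e| == 2] ->
  deg E v = #|[set u | (u != v) && ([set v; u] \in E)]|.
Proof.
move=> /forall_inP edge2; rewrite /deg.
rewrite -(@card_in_imset _ _ (fun u => [set v; u])); last first.
  by move=> u u'; rewrite !inE => /andP[uv _] _; exact: set2_injr.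
apply: eq_card => e; rewrite inE; apply/andP/imsetP => [[eE ve]|[u]].
  have /cards2P[x [y [xy exy]]] := edge2 e eE.
  move: ve; rewrite exy !inE => /orP[/eqP vx|/eqP vy].
    by exists y; rewrite ?inE vx // eq_sym xy -exy.
  by exists x; rewrite ?inE vy ?xy setUC // -exy.
by rewrite inE => /andP[uv uE] ->; rewrite uE !inE eqxx.
Qed.

Lemma sum_deg E : [forall e in E, #|e| == 2] -> (\sum_v deg E v = 2 * #|E|)%N.
Proof.
move=> /forall_inP edge2; rewrite /deg.
under eq_bigr => v _ do rewrite -sum1_card.
under eq_bigr => v _ do under eq_bigl => e do rewrite inE.
rewrite (exchange_big_dep (mem E)) /=; last by move=> v e _ /andP[].
rewrite mulnC -sum_nat_const; apply: eq_bigr => e eE.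
under eq_bigl => v do rewrite eE.
by rewrite sum1_card; apply/eqP; exact: edge2.
Qed.

Lemma induced_card2 E S : [forall e in E, #|e| == 2] ->
  [forall e in induced E S, #|e| == 2].
Proof.
move=> /forall_inP edge2.
by apply/forall_inP => e; rewrite inE => /andP[eE _]; exact: edge2.
Qed.

End GraphDegrees.

Section EdgeCoordinates.
Variables (R : realType) (n : nat) (p : R).
Hypothesis p01 : 0 <= p <= 1.
Local Notation coord := ('I_n * 'I_n)%type.
Implicit Types (w : {set coord}) (i : coord) (u v x y : 'I_n) (G : sgraph n).

(* The pair [(x, y)] with [x < y] is the coordinate of the edge [{x, y}]; the
   other pairs are never sampled. *)
Definition edge_prob i : R := if (i.1 < i.2)%N then p else 0.

Definition edge_index u v : coord := if (u < v)%N then (u, v) else (v, u).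

Definition adj w u v := (u != v) && (edge_index u v \in w).

Definition degree w v : nat := \sum_u adj w v u.

Definition graph_coords G : {set coord} :=
  [set i : coord | (i.1 < i.2)%N && ([set i.1; i.2] \in edges G)].

Lemma edge_prob01 i : 0 <= edge_prob i <= 1.
Proof. by rewrite /edge_prob; case: ifP => // _; rewrite lexx ler01. Qed.

Lemma edge_indexC u v : u != v -> edge_index u v = edge_index v u.
Proof. by rewrite /edge_index => uv; case: ltngtP uv => // /val_inj ->; rewrite eqxx. Qed.

Lemma edge_index_lt u v : u != v -> ((edge_index u v).1 < (edge_index u v).2)%N.
Proof.
rewrite /edge_index => uv; case: (ltnP u v) => vu //=.
by rewrite ltn_neqAle vu andbT; apply: contra_neq uv => /val_inj.
Qed.

Lemma edge_index_set2 u v : [set (edge_index u v).1; (edge_index u v).2] = [set u; v].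
Proof. by rewrite /edge_index; case: ifP => //= _; rewrite setUC. Qed.

Lemma edge_index_eq u v x y : u != v -> x != y ->
  (edge_index u v == edge_index x y) = ((u, v) == (x, y)) || ((u, v) == (y, x)).
Proof.
move=> uv xy; apply/eqP/idP => [e|/orP[]/eqP[-> ->] //]; last by rewrite edge_indexC // eq_sym.
move: uv (edge_index_set2 u v); rewrite e edge_index_set2 => uv /setP sets.
have := sets u; have := sets v; rewrite !inE !eqxx orbT /= => /orP[]/eqP ve /orP[]/eqP ue.
- by rewrite ve ue eqxx in uv.
- by rewrite ve ue eqxx orbT.
- by rewrite ve ue eqxx.
- by rewrite ve ue eqxx in uv.
Qed.

Lemma adjC w u v : adj w u v = adj w v u.
Proof.
rewrite /adj eq_sym; case: (eqVneq v u) => //= vu.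
by rewrite (edge_indexC vu).
Qed.

Lemma adj_irrefl w v : adj w v v = false.
Proof. by rewrite /adj eqxx. Qed.

Lemma adjU i w u v : adj (i |: w) u v = ((u != v) && (edge_index u v == i)) || adj w u v.
Proof. by rewrite /adj in_setU1; case: (u != v). Qed.

Lemma adjD i w u v : adj (w :\ i) u v = adj w u v && (edge_index u v != i).
Proof. by rewrite /adj in_setD1; case: (u != v) => //=; rewrite andbC. Qed.

Lemma degree_lt w v : (degree w v < n)%N.
Proof.
rewrite /degree (bigD1 v) //= adj_irrefl add0n.
apply: (@leq_ltn_trans (\sum_(u | u != v) 1)); first by apply: leq_sum => u _; case: adj.
have n_gt0 : (0 < n)%N by apply: leq_trans (ltn_ord v).
by rewrite sum1_card cardC1 card_ord ltn_predL.
Qed.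

Lemma degree_toggle_le i w v : (degree (w :\ i) v <= degree (i |: w) v)%N.
Proof.
apply: leq_sum => u _; rewrite adjU adjD.
by case: (adj w v u) => //=; rewrite orbT; case: (_ != _).
Qed.

Lemma adj_graph_coords G u v : adj (graph_coords G) u v = (u != v) && ([set u; v] \in edges G).
Proof.
rewrite /adj; case: eqVneq => //= uv.
by rewrite inE edge_index_lt //= edge_index_set2.
Qed.

Lemma degree_graph_coords G v : degree (graph_coords G) v = deg (edges G) v.
Proof.
rewrite deg_neighbours; last exact: edgesP.
rewrite /degree -sum1_card big_mkcond [RHS]big_mkcond; apply: eq_bigr => u _ /=.
by rewrite inE adj_graph_coords eq_sym; case: ifP; case: (_ && _).
Qed.

Lemma card2_edge_coord (e : {set 'I_n}) : #|e| == 2 ->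
  exists2 i : coord, (i.1 < i.2)%N & e = [set i.1; i.2].
Proof.
move=> /cards2P[x [y [xy ->]]]; exists (edge_index x y); first exact: edge_index_lt.
by rewrite edge_index_set2.
Qed.

Lemma edge_coord_inj (i j : coord) : (i.1 < i.2)%N -> (j.1 < j.2)%N ->
  [set i.1; i.2] = [set j.1; j.2] -> i = j.
Proof.
case: i j => [x y] [x' y'] /= xy xy' e.
have xy_eq : edge_index x y = (x, y) by rewrite /edge_index xy.
have xy'_eq : edge_index x' y' = (x', y') by rewrite /edge_index xy'.
have : x \in [set x'; y'] by rewrite -e !inE eqxx.
have : y \in [set x'; y'] by rewrite -e !inE eqxx orbT.
rewrite !inE => /orP[]/eqP ey /orP[]/eqP ex; rewrite ex ey // in xy *.
- by rewrite ltnn in xy.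
- by rewrite ltnNge ltnW in xy.
- by rewrite ltnn in xy.
Qed.

Lemma edge_coord_card2 i : (i.1 < i.2)%N -> #|[set i.1; i.2]| = 2.
Proof. by move=> i_lt; rewrite cards2 (_ : i.1 != i.2) // neq_ltn i_lt. Qed.

Lemma bernoulli_weight_graph_coords G : bernoulli_weight edge_prob (graph_coords G) = gnp p G.
Proof.
rewrite /bernoulli_weight /gnp (bigID (fun i : coord => (i.1 < i.2)%N)) /=.
rewrite [X in _ * X]big1 ?mulr1; last first.
  by move=> i /negbTE i_ge; rewrite inE /edge_prob i_ge subr0.
pose sampled := [set i : coord | (i.1 < i.2)%N].
transitivity (\prod_(e in [set [set i.1; i.2] | i in sampled])
   (if e \in edges G then p else 1 - p)).
  rewrite big_imset /=; last by move=> i j; rewrite !inE; exact: edge_coord_inj.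
  apply: eq_big => i; first by rewrite inE.
  by move=> i_lt; rewrite inE i_lt /= /edge_prob i_lt.
apply: eq_bigl => e; apply/imsetP/idP => [[i]|].
  by rewrite inE => i_lt ->; rewrite edge_coord_card2.
by case/card2_edge_coord => i i_lt ->; exists i; rewrite ?inE.
Qed.

Lemma graph_coords_inj : injective graph_coords.
Proof.
move=> G G' coords_eq; apply: val_inj; apply/setP => e /=.
case: (boolP (#|e| == 2)) => [/card2_edge_coord[i i_lt ->]|e_card].
  by have /setP /(_ i) := coords_eq; rewrite !inE i_lt.
have not_edge (H : sgraph n) : (e \in edges H) = false.
  apply/negbTE/negP => eH; have /forall_inP /(_ e eH) := edgesP H.
  by rewrite (negbTE e_card).
by rewrite !not_edge.
Qed.

Lemma coords_edges_card2 w :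
  [forall e in [set [set i.1; i.2] | i : coord in w & (i.1 < i.2)%N], #|e| == 2].
Proof.
apply/forall_inP => e /imsetP[i]; rewrite inE => /andP[_ i_lt] ->.
by rewrite edge_coord_card2.
Qed.

Definition graph_of_coords w : sgraph n := SGraph (coords_edges_card2 w).

Lemma graph_of_coordsK w : (forall i, i \in w -> (i.1 < i.2)%N) ->
  graph_coords (graph_of_coords w) = w.
Proof.
move=> w_lt; apply/setP => i; rewrite inE; apply/andP/idP => [[i_lt]|iw].
  case/imsetP => j; rewrite inE => /andP[jw j_lt] /edge_coord_inj.
  by move=> /(_ i_lt j_lt) ->.
split; first exact: w_lt.
by apply/imsetP; exists i; rewrite // inE iw w_lt.
Qed.

Lemma expect_gnp (f : {set coord} -> R) :
  expect edge_prob f = \sum_(G : sgraph n) gnp p G * f (graph_coords G).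
Proof.
rewrite /expect (bigID (mem (graph_coords @: setT))) /= [X in _ + X]big1 ?addr0.
  rewrite big_imset /=; last by move=> x y _ _; exact: graph_coords_inj.
  by apply: eq_big => G; rewrite ?inE // => _; rewrite bernoulli_weight_graph_coords.
move=> w w_out; have [/exists_inP[i iw /negbTE i_ge]|] := boolP [exists i in w, ~~ (i.1 < i.2)%N].
  by rewrite /bernoulli_weight (bigD1 i) //= iw /edge_prob i_ge !mul0r.
rewrite negb_exists_in => /forall_inP w_lt; case/negP: w_out.
apply/imsetP; exists (graph_of_coords w) => //; rewrite graph_of_coordsK // => i /w_lt.
by rewrite negbK.
Qed.

Lemma Pr_gnp_ge (P : {set coord} -> Prop) (ev : pred (sgraph n)) :
    (forall G, P (graph_coords G) -> ev G) ->
  1 - failure_prob edge_prob P <= Pr_gnp p ev.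
Proof.
move=> P_ev; rewrite -(expect_cst edge_prob 1) /failure_prob !expect_gnp -sumrB.
rewrite /Pr_gnp [leRHS]big_mkcond; apply: ler_sum => G _; rewrite -mulrBr.
have gnp_ge0 : 0 <= gnp p G.
  by rewrite -bernoulli_weight_graph_coords bernoulli_weight_ge0 //; exact: edge_prob01.
case: asboolP => /= [/P_ev ->|_]; first by rewrite subr0 mulr1.
by rewrite subrr mulr0; case: (ev G).
Qed.

End EdgeCoordinates.

Section LinearStatistics.
Variables (R : realType) (n : nat) (p : R).
Hypothesis p01 : 0 <= p <= 1.
Local Notation coord := ('I_n * 'I_n)%type.
Local Notation edge_prob := (@edge_prob R n p).
Implicit Types (w : {set coord}) (i : coord) (u v : 'I_n) (c : 'I_n -> 'I_n -> R).

Definition centered_adj w u v : R := if u == v then 0 else (adj w u v)%:R - p.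

Definition centered_degree w v : R := \sum_u centered_adj w v u.

Lemma centered_adjC w u v : centered_adj w u v = centered_adj w v u.
Proof. by rewrite /centered_adj eq_sym adjC. Qed.

Lemma centered_adj_shift01 w u v : 0 <= p + centered_adj w u v <= 1.
Proof.
have /andP[p_ge0 p_le1] := p01; rewrite /centered_adj.
case: eqP => _; first by rewrite addr0.
by rewrite subrKC; case: (adj w u v); rewrite ?lexx ?ler01.
Qed.

Lemma centered_adj_norm_le w u v : `|centered_adj w u v| <= 1.
Proof.
have /andP[p_ge0 p_le1] := p01; have /andP[? ?] := centered_adj_shift01 w u v.
by rewrite ler_norml; apply/andP; lra.
Qed.

Lemma centered_adj_toggle i w u v :
  centered_adj (i |: w) u v - centered_adj (w :\ i) u v
  = ((u != v) && (edge_index u v == i))%:R.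
Proof.
rewrite /centered_adj; case: eqVneq => [_|uv] /=; first by rewrite subr0.
rewrite adjU adjD uv opprB addrA subrK.
by case: eqVneq => _ /=; rewrite ?andbF ?andbT ?subr0 ?subrr.
Qed.

Lemma centered_degreeE w v : centered_degree w v = (degree w v)%:R - (n%:R - 1) * p.
Proof.
have n_gt0 : (0 < n)%N by apply: leq_trans (ltn_ord v).
rewrite /centered_degree (bigD1 v) //= {1}/centered_adj eqxx add0r.
rewrite (eq_bigr (fun u => (adj w v u)%:R - p)) => [|u uv]; last first.
  by rewrite /centered_adj eq_sym (negbTE uv).
rewrite sumrB sumr_const cardC1 card_ord /degree [in RHS](bigD1 v) //= adj_irrefl add0n natr_sum.
by rewrite -subn1 -(mulr_natl p) natrB.
Qed.

Lemma expect_adj u v : u != v -> expect edge_prob (fun w => (adj w u v)%:R) = p.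
Proof.
move=> uv; rewrite -(expect_resample edge_prob (edge_index u v)) -[RHS](expect_cst edge_prob).
apply: eq_expect => w; rewrite /resample adjU adjD eqxx uv /= andbF mulr1 mulr0 addr0.
by rewrite /edge_prob edge_index_lt.
Qed.

Lemma expect_centered_adj u v : expect edge_prob (fun w => centered_adj w u v) = 0.
Proof.
rewrite /centered_adj; case: eqVneq => [_|uv]; first exact: expect_cst.
by rewrite expectD expect_adj // expect_cst subrr.
Qed.

Definition linear_stat c w : R := \sum_u \sum_v c u v * centered_adj w u v.

Lemma linear_statZ (a : R) c w : linear_stat (fun u v => a * c u v) w = a * linear_stat c w.
Proof.
rewrite /linear_stat mulr_sumr; apply: eq_bigr => u _.
by rewrite mulr_sumr; apply: eq_bigr => v _; rewrite mulrA.
Qed.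

Lemma expect_linear_stat c : expect edge_prob (linear_stat c) = 0.
Proof.
rewrite /linear_stat expect_sum big1 // => u _; rewrite expect_sum big1 // => v _.
by rewrite expectZl expect_centered_adj mulr0.
Qed.

Lemma linear_stat_toggle c i w : linear_stat c (i |: w) - linear_stat c (w :\ i)
  = if (i.1 < i.2)%N then c i.1 i.2 + c i.2 i.1 else 0.
Proof.
rewrite /linear_stat -sumrB; under eq_bigr => u _ do rewrite -sumrB.
under eq_bigr => u _ do under eq_bigr => v _ do rewrite -mulrBr centered_adj_toggle.
rewrite pair_big /=; case: ifP => i_lt; last first.
  rewrite big1 // => -[u v] _ /=; case: (eqVneq u v) => uv; first by rewrite mulr0.
  case: eqP => [e|]; last by rewrite mulr0.
  by have := edge_index_lt uv; rewrite e i_lt.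
case: i i_lt => x y /= xy; have xny : x != y by rewrite neq_ltn xy.
have index_eq u v : u != v ->
    (edge_index u v == (x, y)) = ((u, v) == (x, y)) || ((u, v) == (y, x)).
  by move=> uv; rewrite -edge_index_eq // /edge_index xy.
rewrite (bigD1 (x, y)) //= (bigD1 (y, x)) /=; last by rewrite xpair_eqE negb_and eq_sym xny.
rewrite xny index_eq // eqxx mulr1 eq_sym xny index_eq 1?eq_sym // eqxx orbT mulr1.
rewrite big1 ?addr0 // => -[u v] /andP[not_xy not_yx] /=.
case: (eqVneq u v) => uv; first by rewrite mulr0.
by rewrite index_eq // (negbTE not_xy) (negbTE not_yx) mulr0.
Qed.

Lemma sum_degree_toggle_le i w :
  \sum_v ((degree (i |: w) v)%:R - (degree (w :\ i) v)%:R) <= 2 :> R.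
Proof.
have := linear_stat_toggle (fun _ _ => 1) i w; rewrite /linear_stat -sumrB => toggle.
rewrite (_ : \sum_v _ = if (i.1 < i.2)%N then 1 + 1 else 0).
  by case: ifP => _; lra.
rewrite -toggle; apply: eq_bigr => v _; rewrite -!mulr_sumr !mul1r.
by rewrite -!/(centered_degree _ _) !centered_degreeE; ring.
Qed.

Lemma expect_expR_linear_stat_le c : (forall u v, `|c u v + c v u| <= 1 / 3) ->
  expect edge_prob (fun w => expR (linear_stat c w))
    <= expR (2 * (p * (1 - p)) * \sum_u \sum_v c u v ^+ 2).
Proof.
move=> c_le; have /andP[p_ge0 p_le1] := p01.
pose b i : R := if (i.1 < i.2)%N then `|c i.1 i.2 + c i.2 i.1| else 0.
apply: le_trans (@expect_expR_bounded_diff R _ edge_prob (edge_prob01 p01) (linear_stat c) b _ _) _.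
- by move=> i w; rewrite linear_stat_toggle /b; case: ifP => // _; rewrite normr0.
- by move=> i; rewrite /b; case: ifP => // _; rewrite divr_ge0.
have pq_ge0 : 0 <= p * (1 - p) by rewrite mulr_ge0 // subr_ge0.
rewrite expect_linear_stat add0r ler_expR.
pose squares : R := \sum_(i : coord | (i.1 < i.2)%N) (c i.1 i.2 ^+ 2 + c i.2 i.1 ^+ 2).
apply: (@le_trans _ _ (2 * (p * (1 - p)) * squares)).
  rewrite mulr_sumr [leRHS]big_mkcond; apply: ler_sum => i _.
  rewrite /b /edge_prob; case: ifP => _; last by rewrite !mul0r.
  rewrite real_normK ?num_real //.
  have := mulr_ge0 pq_ge0 (sqr_ge0 (c i.1 i.2 - c i.2 i.1)); lra.
apply: ler_wpM2l; first by rewrite mulr_ge0.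
rewrite /squares pair_big big_split /=.
have swap_inj : injective (fun i : coord => (i.2, i.1)) by case=> ? ? [? ?] [-> ->].
rewrite [X in _ + X](reindex_inj swap_inj) /=.
rewrite [leRHS](bigID (fun i : coord => (i.1 < i.2)%N)) /= lerD2l.
rewrite [leRHS](bigID (fun i : coord => (i.2 < i.1)%N)) /=.
rewrite [X in _ <= X + _](eq_bigl (fun i : coord => (i.2 < i.1)%N)) => [|i]; last first.
  by case: ltngtP.
by rewrite lerDl sumr_ge0 // => i _; exact: sqr_ge0.
Qed.

End LinearStatistics.

(** * Switchings *)

Section Toggles.
Variables (R : realType) (I : finType) (p : I -> R).

Lemma addb_pair_tperm (f : I -> bool) (x y i : I) : f x != f y ->
  f i (+) ((i == x) || (i == y)) = f (tperm x y i).
Proof.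
move=> fxy; case: tpermP => [->|->|/eqP/negbTE -> /eqP/negbTE ->]; last exact: addbF.
  by rewrite eqxx addbT; move: fxy; case: (f x); case: (f y).
by rewrite eqxx orbT addbT; move: fxy; case: (f x); case: (f y).
Qed.

Lemma bernoulli_weight_toggle_pair (w : {set I}) x y : p x = p y -> (x \in w) != (y \in w) ->
  bernoulli_weight p [set i | (i \in w) (+) ((i == x) || (i == y))] = bernoulli_weight p w.
Proof.
move=> pxy wxy; rewrite /bernoulli_weight [RHS](reindex_inj (@perm_inj _ (tperm x y))) /=.
apply: eq_bigr => i _; rewrite inE (addb_pair_tperm (f := fun i => i \in w)) //.
by case: tpermP => // ->; rewrite pxy.
Qed.

Lemma sum_toggle_pair (f : I -> bool) x y : f x != f y ->
  (\sum_i (f i (+) ((i == x) || (i == y))) = \sum_i f i)%N.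
Proof.
move=> fxy; rewrite [RHS](reindex_inj (@perm_inj _ (tperm x y))) /=.
by apply: eq_bigr => i _; rewrite addb_pair_tperm.
Qed.

End Toggles.

(* If the pairs are matched by the sum of their keys modulo [m], two of them that meet
   coincide. *)
Lemma matched_pair_eq n (D : {set 'I_n}) (key : 'I_n -> nat) m s (a b a' b' : 'I_n) :
    {in D &, injective key} -> {in D, forall x, (key x < m)%N} ->
    a \in D -> b \in D -> a' \in D -> b' \in D -> (a < b)%N -> (a' < b')%N ->
    (key a + key b = s %[mod m])%N -> (key a' + key b' = s %[mod m])%N ->
  (a' \in [set a; b]) || (b' \in [set a; b]) -> a' = a /\ b' = b.
Proof.
move=> key_inj key_lt aD bD a'D b'D ab ab' sum_ab sum_ab'.
have partner x y z : x \in D -> y \in D -> z \in D ->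
    (key x + key y = s %[mod m])%N -> (key x + key z = s %[mod m])%N -> y = z.
  move=> xD yD zD <- /eqP; rewrite eqn_modDl !modn_small ?key_lt // => /eqP key_eq.
  by apply: key_inj.
have sum_ba : (key b + key a = s %[mod m])%N by rewrite addnC.
have sum_ba' : (key b' + key a' = s %[mod m])%N by rewrite addnC.
rewrite !inE -orbA => /or4P[]/eqP e; subst.
- by rewrite (partner a b' b).
- by rewrite (partner b b' a) // ltnNge ltnW in ab'.
- by rewrite (partner a a' b) // ltnNge ltnW in ab'.
- by rewrite (partner b a' a).
Qed.

Lemma matched_pair_mem n (D : {set 'I_n}) (key : 'I_n -> nat) m s (a b a' b' : 'I_n) :
    {in D &, injective key} -> {in D, forall x, (key x < m)%N} ->
    a \in D -> b \in D -> a' \in D -> b' \in D -> (a < b)%N -> (a' < b')%N ->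
    (key a + key b = s %[mod m])%N -> (key a' + key b' = s %[mod m])%N ->
  (a' \in [set a; b]) = (b' \in [set a; b]).
Proof.
move=> key_inj key_lt aD bD a'D b'D ab ab' sum_ab sum_ab'.
have meet := matched_pair_eq key_inj key_lt aD bD a'D b'D ab ab' sum_ab sum_ab'.
apply/idP/idP => mem.
  by have [|_ ->] := meet; rewrite ?mem // !inE eqxx orbT.
by have [|-> _] := meet; rewrite ?mem ?orbT // !inE eqxx.
Qed.

Section Switchings.
Variables (R : realType) (n : nat) (p : R).
Hypothesis p01 : 0 <= p <= 1.
Local Notation coord := ('I_n * 'I_n)%type.
Local Notation edge_prob := (@edge_prob R n p).
Implicit Types (w : {set coord}) (u v a b c d : 'I_n).

Definition degree_seq w : {ffun 'I_n -> nat} := [ffun v => degree w v].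

(* A switching is a pair of rows [a < b] and a pair of columns [c < d]; it exchanges
   the edges [ac, bd] with the edges [ad, bc]. *)
Definition switching := (coord * coord)%type.

Definition switching_edges (x : switching) : {set coord} :=
  [set i | [|| i == edge_index x.1.1 x.2.1, i == edge_index x.1.2 x.2.1,
               i == edge_index x.1.1 x.2.2 | i == edge_index x.1.2 x.2.2]].

(* The switchings of a scheme have their rows in [chi], matched by [a + b = h] modulo [n],
   and their columns outside [chi], where the two rows disagree, matched by the condition
   that their ranks sum to [g] modulo [M].  None of this is changed by a switching of the
   scheme, so that its switchings commute. *)
Section Scheme.
Variables (chi : {set 'I_n}) (h M g : nat).
Implicit Types (x y : switching).

Definition disagreement w a b : {set 'I_n} :=
  [set c | (c \notin chi) && (adj w a c != adj w b c)].

Definition disagreement_rank w a b c : nat :=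
  #|[set c' in disagreement w a b | (c' < c)%N]|.

Definition eligible (x : switching) : bool :=
  [&& (x.1.1 < x.1.2)%N, x.1.1 \in chi, x.1.2 \in chi, (x.2.1 < x.2.2)%N
    & x.1.1 + x.1.2 == h %[mod n]].

Definition active w (x : switching) : bool :=
  let: ((a, b), (c, d)) := x in
  [&& eligible x, c \in disagreement w a b, d \in disagreement w a b,
      (#|disagreement w a b| <= M)%N,
      disagreement_rank w a b c + disagreement_rank w a b d == g %[mod M]
    & adj w a c != adj w a d].

Definition switching_sign w (x : switching) : R :=
  if active w x then (if adj w x.1.1 x.2.1 then 1 else -1) else 0.

Definition switch (x : switching) w : {set coord} :=
  [set i | (i \in w) (+) (active w x && (i \in switching_edges x))].

Lemma disagreement_rank_lt w a b c : c \in disagreement w a b ->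
  (disagreement_rank w a b c < #|disagreement w a b|)%N.
Proof.
move=> cD; apply: proper_card; apply/properP; split.
  by apply/subsetP => y; rewrite inE => /andP[].
by exists c => //; rewrite inE ltnn andbF.
Qed.

Lemma disagreement_rank_mono w a b c d : c \in disagreement w a b -> (c < d)%N ->
  (disagreement_rank w a b c < disagreement_rank w a b d)%N.
Proof.
move=> cD cd; apply: proper_card; apply/properP; split.
  apply/subsetP => y; rewrite !(inE, in_setI) => /andP[-> yc] /=; exact: ltn_trans yc cd.
by exists c; rewrite !inE ?ltnn ?andbF //; move: cD; rewrite inE => ->.
Qed.

Lemma disagreement_rank_inj w a b :
  {in disagreement w a b &, injective (disagreement_rank w a b)}.
Proof.
move=> c d cD dD rank_eq; apply: val_inj; case: (ltngtP c d) => // lt.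
  by have := disagreement_rank_mono cD lt; rewrite rank_eq ltnn.
by have := disagreement_rank_mono dD lt; rewrite rank_eq ltnn.
Qed.

Section ActiveSwitching.
Variables (w : {set coord}) (a b c d : 'I_n).
Let x : switching := ((a, b), (c, d)).
Hypothesis active_x : active w x.

Let eligible_x : eligible x. Proof. by case/and5P: active_x. Qed.
Let ab : (a < b)%N. Proof. by case/and5P: eligible_x. Qed.
Let aX : a \in chi. Proof. by case/and5P: eligible_x. Qed.
Let bX : b \in chi. Proof. by case/and5P: eligible_x. Qed.
Let cd : (c < d)%N. Proof. by case/and5P: eligible_x. Qed.
Let rows_sum : (a + b = h %[mod n])%N. Proof. by case/and5P: eligible_x => _ _ _ _ /eqP. Qed.
Let cD : c \in disagreement w a b. Proof. by case/and5P: active_x. Qed.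
Let dD : d \in disagreement w a b. Proof. by case/and5P: active_x. Qed.
Let card_le : (#|disagreement w a b| <= M)%N. Proof. by case/and5P: active_x. Qed.
Let ranks_sum : (disagreement_rank w a b c + disagreement_rank w a b d = g %[mod M])%N.
Proof. by case/and5P: active_x => _ _ _ _ /andP[/eqP]. Qed.
Let acd : adj w a c != adj w a d.
Proof. by case/and5P: active_x => _ _ _ _ /andP[]. Qed.
Let cX : c \notin chi. Proof. by move: cD; rewrite inE => /andP[]. Qed.
Let dX : d \notin chi. Proof. by move: dD; rewrite inE => /andP[]. Qed.
Let abc : adj w a c != adj w b c. Proof. by move: cD; rewrite inE => /andP[]. Qed.
Let abd : adj w a d != adj w b d. Proof. by move: dD; rewrite inE => /andP[]. Qed.

Let val_injT : {in [set: 'I_n] &, injective val}. Proof. by move=> y z _ _; exact: val_inj. Qed.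
Let val_ltT : {in [set: 'I_n], forall v, (val v < n)%N}. Proof. by move=> v _; exact: ltn_ord. Qed.
Let row_neq_col u v : u \in chi -> v \notin chi -> (u == v) = false.
Proof. by move=> uX; apply: contraNF => /eqP <-. Qed.

Let rank_lt : {in disagreement w a b, forall v, (disagreement_rank w a b v < M)%N}.
Proof. by move=> v vD; apply: leq_trans card_le; exact: disagreement_rank_lt. Qed.

Definition crosses u v :=
  ((u \in [set a; b]) && (v \in [set c; d])) || ((v \in [set a; b]) && (u \in [set c; d])).

Lemma switching_edges_crosses u v : u != v -> (edge_index u v \in switching_edges x) = crosses u v.
Proof.
move=> uv; rewrite inE /= !edge_index_eq ?(row_neq_col aX) ?(row_neq_col bX) //.
rewrite !xpair_eqE /crosses !inE.
case: (u == a); case: (u == b); case: (u == c); case: (u == d);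
by case: (v == a); case: (v == b); case: (v == c); case: (v == d).
Qed.

Lemma adj_switch u v : adj (switch x w) u v = adj w u v (+) crosses u v.
Proof.
rewrite /adj; case: (eqVneq u v) => [<-|uv] /=.
  rewrite /crosses andbC orbb; apply/esym/negbTE; rewrite !inE.
  by apply/negP => /andP[/orP[]/eqP -> /orP[]]; rewrite eq_sym row_neq_col.
by rewrite inE active_x switching_edges_crosses.
Qed.

Lemma adj_switch_row u v : u \in chi -> v \notin chi ->
  adj (switch x w) u v = adj w u v (+) ((u \in [set a; b]) && (v \in [set c; d])).
Proof.
move=> uX vX; rewrite adj_switch /crosses; congr (_ (+) _).
rewrite [v \in [set a; b]](_ : _ = false) ?orbF // !inE.
by apply/norP; rewrite eq_sym (row_neq_col aX) // eq_sym (row_neq_col bX).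
Qed.

Lemma bernoulli_weight_switch :
  bernoulli_weight edge_prob (switch x w) = bernoulli_weight edge_prob w.
Proof.
have prob_row_col u v : u \in chi -> v \notin chi -> edge_prob (edge_index u v) = p.
  by move=> uX vX; rewrite /edge_prob edge_index_lt // row_neq_col.
have mem_row_col u v : u \in chi -> v \notin chi -> (edge_index u v \in w) = adj w u v.
  by move=> uX vX; rewrite /adj row_neq_col.
have index_neq u u' v v' : u \in chi -> u' \in chi -> v \notin chi -> v' \notin chi ->
    (edge_index u v == edge_index u' v') = (u == u') && (v == v').
  move=> uX u'X vX v'X; rewrite edge_index_eq ?(row_neq_col uX vX) ?(row_neq_col u'X v'X) //.
  rewrite !xpair_eqE.
  by rewrite (row_neq_col uX v'X) orbF.
have neq_cd : (c == d) = false by apply/negbTE; rewrite neq_ltn cd.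
pose half := [set i | (i \in w) (+) ((i == edge_index a c) || (i == edge_index b c))].
have -> : switch x w
    = [set i | (i \in half) (+) ((i == edge_index a d) || (i == edge_index b d))].
  apply/setP => i; rewrite !inE active_x /= -addbA; congr (_ (+) _).
  case: (eqVneq i (edge_index a c)) => [->|_] /=.
    by rewrite !index_neq // neq_cd !andbF.
  by case: (eqVneq i (edge_index b c)) => [->|_] //=; rewrite !index_neq // neq_cd !andbF.
rewrite !bernoulli_weight_toggle_pair ?prob_row_col // ?inE ?mem_row_col //.
by rewrite !index_neq // (eq_sym d c) neq_cd !andbF !addbF.
Qed.

Lemma degree_switch v : degree (switch x w) v = degree w v.
Proof.
rewrite /degree; under eq_bigr => u _ do rewrite adj_switch.
have [v_row|v_row] := boolP (v \in [set a; b]).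
  have vX : v \in chi by move: v_row; rewrite !inE => /orP[] /eqP ->.
  have v_col : v \in [set c; d] = false.
    by rewrite !inE; apply/norP; rewrite !row_neq_col.
  under eq_bigr => u _ do rewrite /crosses v_row v_col andbF orbF /= !inE.
  apply: sum_toggle_pair; move: v_row; rewrite !inE => /orP[] /eqP -> //.
  by move: acd abc abd; do 4 case: (adj _ _ _).
have [v_col|v_col] := boolP (v \in [set c; d]); last first.
  by apply: eq_bigr => u _; rewrite /crosses (negbTE v_row) (negbTE v_col) andbF addbF.
under eq_bigr => u _ do rewrite /crosses (negbTE v_row) v_col andbT /= !inE.
by apply: sum_toggle_pair; move: v_col; rewrite !inE => /orP[] /eqP ->;
  rewrite !(adjC _ _ a) !(adjC _ _ b).
Qed.

Section OtherSwitching.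
Variables (a' b' : 'I_n).
Hypotheses (ab' : (a' < b')%N) (a'X : a' \in chi) (b'X : b' \in chi)
  (rows_sum' : (a' + b' = h %[mod n])%N).

Lemma matched_rows_mem : (a' \in [set a; b]) = (b' \in [set a; b]).
Proof.
exact: (matched_pair_mem val_injT val_ltT (in_setT a) (in_setT b) (in_setT a') (in_setT b')
  ab ab' rows_sum rows_sum').
Qed.

Lemma matched_rows_eq : a' \in [set a; b] -> a' = a /\ b' = b.
Proof.
move=> meet; apply: (matched_pair_eq val_injT val_ltT (in_setT a) (in_setT b) (in_setT a')
  (in_setT b') ab ab' rows_sum rows_sum').
by rewrite meet.
Qed.

Lemma disagreement_switch : disagreement (switch x w) a' b' = disagreement w a' b'.
Proof.
apply/setP => y; rewrite !inE; case: (boolP (y \in chi)) => //= yX.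
rewrite !adj_switch_row // matched_rows_mem.
by case: (_ && _); case: (adj w a' y); case: (adj w b' y).
Qed.

Variables c' d' : 'I_n.
Hypotheses (cd' : (c' < d')%N) (c'D : c' \in disagreement w a' b')
  (d'D : d' \in disagreement w a' b')
  (ranks_sum' : (disagreement_rank w a' b' c' + disagreement_rank w a' b' d' = g %[mod M])%N).

Lemma matched_columns_mem : a' \in [set a; b] -> (c' \in [set c; d]) = (d' \in [set c; d]).
Proof.
move=> /matched_rows_eq[a'E b'E]; move: c'D d'D ranks_sum'; rewrite a'E b'E => c'D' d'D' sum'.
exact: (matched_pair_mem (@disagreement_rank_inj w a b) rank_lt cD dD c'D' d'D' cd cd'
  ranks_sum sum').
Qed.

Lemma matched_columns_eq : a' \in [set a; b] -> c' \in [set c; d] ->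
  ((a', b'), (c', d')) = x.
Proof.
move=> a'_mem c'_mem; have [a'E b'E] := matched_rows_eq a'_mem.
move: c'D d'D ranks_sum'; rewrite a'E b'E => c'D' d'D' sum'.
by have [|-> ->] := matched_pair_eq (@disagreement_rank_inj w a b) rank_lt cD dD c'D' d'D' cd cd'
  ranks_sum sum'; rewrite ?c'_mem.
Qed.

End OtherSwitching.

Lemma active_switch y : active (switch x w) y = active w y.
Proof.
case: y => [[a' b'] [c' d']]; rewrite /active.
case: (boolP (eligible _)) => //= /and5P[/= ab' a'X b'X cd' /eqP rows_sum'].
rewrite /disagreement_rank (disagreement_switch ab' a'X b'X rows_sum').
case: (boolP (c' \in _)) => //= c'D; case: (boolP (d' \in _)) => //= d'D.
case: (boolP (_ <= M)%N) => //= _; case: eqP => //= ranks_sum'.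
have [c'X d'X] : c' \notin chi /\ d' \notin chi.
  by move: c'D d'D; rewrite !inE => /andP[-> _] /andP[-> _].
rewrite !adj_switch_row //; case: (boolP (a' \in [set a; b])) => [a'_mem|_].
  rewrite (matched_columns_mem ab' rows_sum' cd' c'D d'D ranks_sum' a'_mem).
  by case: (d' \in _); case: (adj w a' c'); case: (adj w a' d').
by rewrite /= !addbF.
Qed.

Lemma switching_sign_switch y :
  switching_sign (switch x w) y = if y == x then - switching_sign w x else switching_sign w y.
Proof.
rewrite /switching_sign active_switch active_x; case: (boolP (active w y)) => active_y; last first.
  by case: eqP active_y => // ->; rewrite active_x.
have [->|neq_yx] := eqVneq y x.
  by rewrite /= adj_switch_row // !inE !eqxx /= addbT; case: (adj w a c); rewrite /= ?opprK.
case: y active_y neq_yx => [[a' b'] [c' d']] /= /and5P[/and5P[/= ab' a'X b'X cd' /eqP rows_sum']].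
move=> c'D d'D _ /andP[/eqP ranks_sum' _] neq_yx.
have c'X : c' \notin chi by move: c'D; rewrite inE => /andP[].
rewrite adj_switch_row //; case: andP => [[a'_mem c'_mem]|_]; last by rewrite addbF.
by rewrite (matched_columns_eq ab' rows_sum' cd' c'D d'D ranks_sum' a'_mem c'_mem) eqxx in neq_yx.
Qed.

End ActiveSwitching.

Lemma switch_inactive x w : ~~ active w x -> switch x w = w.
Proof. by move=> /negbTE inactive; apply/setP => i; rewrite inE inactive addbF. Qed.

Lemma switchK x : involutive (switch x).
Proof.
move=> w; case: (boolP (active w x)) => active_x; last by rewrite !switch_inactive.
apply/setP => i; rewrite !inE; case: x active_x => [[a b] [c d]] active_x.
by rewrite active_switch // active_x /= -addbA addbb addbF.
Qed.

Lemma expect_switch x (F : {set coord} -> R) :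
  expect edge_prob (fun w => F (switch x w)) = expect edge_prob F.
Proof.
rewrite /expect [RHS](reindex_inj (inv_inj (switchK x))) /=; apply: eq_bigr => w _.
congr (_ * _); case: (boolP (active w x)) => active_x; last by rewrite switch_inactive.
by case: x active_x => [[a b] [c d]] active_x; rewrite bernoulli_weight_switch.
Qed.

Lemma degree_seq_switch x w : degree_seq (switch x w) = degree_seq w.
Proof.
apply/ffunP => v; rewrite !ffunE.
case: (boolP (active w x)) => active_x; last by rewrite switch_inactive.
by case: x active_x => [[a b] [c d]] active_x; rewrite degree_switch.
Qed.

Lemma switching_sign_switch_neq x y w : y != x ->
  switching_sign (switch x w) y = switching_sign w y.
Proof.
move=> yx; case: (boolP (active w x)) => active_x; last by rewrite switch_inactive.
by case: x active_x yx => [[a b] [c d]] active_x yx; rewrite switching_sign_switch // (negbTE yx).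
Qed.

Lemma switching_sign_switch_self x w : switching_sign (switch x w) x = - switching_sign w x.
Proof.
case: (boolP (active w x)) => active_x.
  by case: x active_x => [[a b] [c d]] active_x; rewrite switching_sign_switch // eqxx.
by rewrite switch_inactive // /switching_sign (negbTE active_x) oppr0.
Qed.

Lemma switching_sign_norm_le w x : `|switching_sign w x| <= 1.
Proof.
rewrite /switching_sign; case: ifP => _; last by rewrite normr0.
by case: ifP => _; rewrite ?normrN normr1.
Qed.

(* Each switching preserves the law and the degrees and flips its own sign only, so that
   conditionally on the rest its sign is a fair coin. *)
Lemma expect_expR_switching_signs (s : seq switching) (H : {ffun 'I_n -> nat} -> R)
    (t : switching -> {ffun 'I_n -> nat} -> R) : uniq s ->
    (forall f, 0 <= H f) -> (forall x f, `|t x f| <= 1 / 3) ->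
  expect edge_prob (fun w => H (degree_seq w) * expR (\sum_(x <- s)
     (t x (degree_seq w) * switching_sign w x - (t x (degree_seq w) * switching_sign w x) ^+ 2)))
  <= expect edge_prob (fun w => H (degree_seq w)).
Proof.
move=> uniq_s H_ge0 t_le; elim: s uniq_s => [|x s IH] /=.
  by move=> _; apply: expect_le => [|w]; [exact: edge_prob01|rewrite big_nil expR0 mulr1].
move=> /andP[xs uniq_s]; apply: le_trans (IH uniq_s).
pose term w y := t y (degree_seq w) * switching_sign w y - (t y (degree_seq w) * switching_sign w y) ^+ 2.
pose F w := H (degree_seq w) * expR (\sum_(y <- s) term w y).
pose z w := t x (degree_seq w) * switching_sign w x.
have F_ge0 w : 0 <= F w by rewrite mulr_ge0 ?expR_ge0.
have F_switch w : F (switch x w) = F w.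
  rewrite /F degree_seq_switch; congr (_ * expR _); apply: eq_big_seq => y ys.
  by rewrite /term degree_seq_switch switching_sign_switch_neq //; apply: contraNneq xs => <-.
have z_switch w : z (switch x w) = - z w.
  by rewrite /z degree_seq_switch switching_sign_switch_self mulrN.
pose G sign w := F w * expR (sign * z w - z w ^+ 2).
rewrite (@eq_expect _ _ _ _ (G 1)) => [|w]; last first.
  by rewrite big_cons addrC expRD mulrA /G mul1r.
have flip_sign : expect edge_prob (G 1) = expect edge_prob (G (-1)).
  by rewrite -(expect_switch x); apply: eq_expect => w; rewrite /G F_switch z_switch sqrrN mulrN mulNr.
have -> : expect edge_prob (G 1) = 2^-1 * (expect edge_prob (G 1) + expect edge_prob (G (-1))).
  by rewrite -flip_sign; lra.
rewrite -expectD -expectZl; apply: expect_le => [|w]; first exact: edge_prob01.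
rewrite /G -mulrDr mulrCA -[leRHS]mulr1 ler_wpM2l // mul1r mulN1r !expRD -mulrDl expRN.
have z_le : `|z w| <= 1 / 3.
  by rewrite normrM; apply: le_trans (t_le x (degree_seq w)); rewrite ler_piMr ?switching_sign_norm_le.
by have := expRD_expRN_le z_le; rewrite -ler_pdivrMr ?expR_gt0 //; lra.
Qed.

End Scheme.
End Switchings.

Section Indicators.
Variables (R : realType) (n : nat).
Implicit Types (X Y S B : {set 'I_n}) (f : 'I_n -> R) (a : 'I_n).

Definition indicator S a : R := (a \in S)%:R.

Lemma indicator01 S a : 0 <= indicator S a <= 1.
Proof. by rewrite /indicator; case: (a \in S); rewrite ?lexx ?ler01. Qed.

Lemma indicator_norm_le S a : `|indicator S a| <= 1.
Proof. by have /andP[? ?] := indicator01 S a; rewrite ger0_norm. Qed.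

Lemma indicator_sqr S a : indicator S a ^+ 2 = indicator S a.
Proof. by rewrite /indicator; case: (a \in S); rewrite ?expr1n ?expr0n. Qed.

Lemma indicator_diff_norm_le S a b : `|indicator S a - indicator S b| <= 1.
Proof.
have /andP[? ?] := indicator01 S a; have /andP[? ?] := indicator01 S b.
by rewrite ler_norml; apply/andP; split; lra.
Qed.

Lemma indicatorU X S : [disjoint X & S] ->
  indicator (X :|: S) = (fun a => indicator X a + indicator S a).
Proof.
move=> dXS; apply: funext => a; rewrite /indicator inE.
case: (boolP (a \in X)) => aX; last by rewrite /= add0r.
by rewrite (disjointFr dXS aX) /= addr0.
Qed.

Lemma sum_indicator_mul S f : \sum_a indicator S a * f a = \sum_(a in S) f a.
Proof.
rewrite [RHS]big_mkcond; apply: eq_bigr => a _; rewrite /indicator.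
by case: (a \in S); rewrite ?mul1r ?mul0r.
Qed.

Lemma sum_indicator S : \sum_a indicator S a = #|S|%:R.
Proof.
under eq_bigr => a _ do rewrite -[indicator S a]mulr1.
by rewrite sum_indicator_mul sumr_const.
Qed.

Lemma sumr_ord_const (x : R) : \sum_(i < n) x = n%:R * x.
Proof. by rewrite sumr_const card_ord mulr_natl. Qed.

Lemma norm_sum_card_le (f : 'I_n -> R) (S : {set 'I_n}) (c x : R) : 0 <= c -> #|S|%:R <= x ->
  (forall v, v \in S -> `|f v| <= c) -> `|\sum_(v in S) f v| <= x * c.
Proof.
move=> c_ge0 cardS f_le; apply: le_trans (ler_norm_sum _ _ _) _.
apply: (@le_trans _ _ (\sum_(v in S) c)); first exact: ler_sum.
by rewrite sumr_const -(mulr_natl c) ler_wpM2r.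
Qed.

End Indicators.

Section BilinearForms.
Variables (R : realType) (n : nat) (w : 'I_n -> 'I_n -> R).
Hypothesis wC : forall u v, w u v = w v u.
Implicit Types (f g h : 'I_n -> R) (X Y U B : {set 'I_n}) (a c : 'I_n).
Local Notation indicator := (@indicator R n).

Definition kernel_apply f a : R := \sum_c w a c * f c.

Definition row_sum a : R := \sum_c w a c.

Definition bilin f g : R := \sum_a \sum_c f a * g c * w a c.

Definition center f a : R := f a - (\sum_c f c) / n%:R.

Definition centered_bilin f g : R := bilin (center f) (center g).

Lemma bilinE f g : bilin f g = \sum_a f a * kernel_apply g a.
Proof. by apply: eq_bigr => a _; rewrite mulr_sumr; apply: eq_bigr => c _; rewrite mulrAC mulrA. Qed.

Lemma bilinC f g : bilin f g = bilin g f.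
Proof.
rewrite /bilin exchange_big; apply: eq_bigr => a _; apply: eq_bigr => c _.
by rewrite wC (mulrC (f c)).
Qed.

Lemma bilinDl f h g : bilin (fun a => f a + h a) g = bilin f g + bilin h g.
Proof. by rewrite !bilinE -big_split; apply: eq_bigr => a _; rewrite mulrDl. Qed.

Lemma bilinDr f g h : bilin f (fun a => g a + h a) = bilin f g + bilin f h.
Proof. by rewrite bilinC bilinDl !(bilinC f). Qed.

Lemma bilin_cstr f (k : R) : bilin f (fun=> k) = k * \sum_a f a * row_sum a.
Proof.
rewrite bilinE mulr_sumr; apply: eq_bigr => a _.
by rewrite /kernel_apply -mulr_suml mulrA mulrC.
Qed.

Lemma centered_bilinE f g : centered_bilin f g = bilin f g
  - (\sum_c g c) / n%:R * (\sum_a f a * row_sum a)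
  - (\sum_c f c) / n%:R * (\sum_a g a * row_sum a)
  + (\sum_c f c) * (\sum_c g c) / n%:R ^+ 2 * \sum_a row_sum a.
Proof.
rewrite /centered_bilin /center bilinDl bilinDr (bilinC (fun=> - _)) bilinDl.
rewrite !bilin_cstr -mulr_sumr -exprVn; move: (n%:R^-1) (bilin f g) => N F.
by rewrite expr2; ring.
Qed.

Lemma centered_bilinD f h : centered_bilin (fun a => f a + h a) (fun a => f a + h a)
  = centered_bilin f f + 2 * centered_bilin h f + centered_bilin h h.
Proof.
have centerD : center (fun a => f a + h a) = (fun a => center f a + center h a).
  by apply: funext => a; rewrite /center big_split mulrDl /=; ring.
rewrite /centered_bilin centerD bilinDl (bilinDr (center f)) (bilinDr (center h)).
by rewrite (bilinC (center f) (center h)); ring.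
Qed.

Lemma bilin_indicator X Y : bilin (indicator X) (indicator Y) = \sum_(a in X) \sum_(c in Y) w a c.
Proof.
rewrite bilinE sum_indicator_mul; apply: eq_bigr => a _.
by rewrite -sum_indicator_mul; apply: eq_bigr => c _; rewrite mulrC.
Qed.

Lemma bilin_indicator_diff_le U Y B (k : R) : (forall u v, `|w u v| <= 1) ->
    (forall a, a \notin B -> (a \in U) = (a \in Y)) -> #|U :|: Y|%:R <= k ->
  `|bilin (indicator U) (indicator U) - bilin (indicator Y) (indicator Y)| <= 2 * #|B|%:R * k.
Proof.
move=> w_le UY card_le; set V := U :|: Y.
apply: (@le_trans _ _ (\sum_a \sum_c (indicator B a * indicator V c + indicator V a * indicator B c))).
  rewrite /bilin -sumrB; apply: le_trans (ler_norm_sum _ _ _) _; apply: ler_sum => a _.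
  rewrite -sumrB; apply: le_trans (ler_norm_sum _ _ _) _; apply: ler_sum => c _.
  rewrite -mulrBl normrM; apply: le_trans (ler_piMr (normr_ge0 _) (w_le a c)) _.
  rewrite /indicator !inE -!natrM -natrD.
  have [aB|/UY ->] := boolP (a \in B); have [cB|/UY ->] := boolP (c \in B); last first.
  - by rewrite subrr normr0.
  - by case: (a \in Y); case: (c \in U); case: (c \in Y);
      rewrite ?subrr ?subr0 ?sub0r ?normrN ?normr0 ?normr1.
  - by case: (c \in Y); case: (a \in U); case: (a \in Y);
      rewrite ?subrr ?subr0 ?sub0r ?normrN ?normr0 ?normr1.
  - by case: (a \in U); case: (a \in Y); case: (c \in U); case: (c \in Y);
      rewrite ?subrr ?subr0 ?sub0r ?normrN ?normr0 ?normr1 // ler1n.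
under eq_bigr => a _ do rewrite big_split /= -!mulr_sumr !sum_indicator.
rewrite big_split /= -!mulr_suml !sum_indicator.
rewrite [leLHS](_ : _ = 2 * #|B|%:R * #|V|%:R); last by ring.
by rewrite ler_wpM2l ?mulr_ge0.
Qed.

Variable Lam : R.
Hypotheses (w_le : forall u v, `|w u v| <= 1).

Lemma kernel_apply_norm_le f a : \sum_c `|f c| <= Lam -> `|kernel_apply f a| <= Lam.
Proof.
move=> f_le; apply: le_trans (ler_norm_sum _ _ _) _; apply: le_trans f_le.
by apply: ler_sum => c _; rewrite normrM ler_piMl.
Qed.

End BilinearForms.

Section FourfoldSums.
Variables (R : realType) (n : nat).
Implicit Types (F G : 'I_n -> 'I_n -> 'I_n -> 'I_n -> R).

Definition sum4 F : R := \sum_(x : switching n) F x.1.1 x.1.2 x.2.1 x.2.2.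

Lemma sum4E F : sum4 F = \sum_a \sum_b \sum_c \sum_d F a b c d.
Proof.
rewrite pair_bigA /=; under [RHS]eq_bigr => x _ do rewrite pair_bigA /=.
by rewrite pair_bigA.
Qed.

Lemma eq_sum4 F G : (forall a b c d, F a b c d = G a b c d) -> sum4 F = sum4 G.
Proof. by move=> FG; apply: eq_bigr => x _. Qed.

Lemma sum4D F G : sum4 (fun a b c d => F a b c d + G a b c d) = sum4 F + sum4 G.
Proof. by rewrite /sum4 -big_split. Qed.

Lemma sum4Z (k : R) F : sum4 (fun a b c d => k * F a b c d) = k * sum4 F.
Proof. by rewrite /sum4 mulr_sumr. Qed.

Lemma ler_sum4 F G : (forall a b c d, F a b c d <= G a b c d) -> sum4 F <= sum4 G.
Proof. by move=> FG; apply: ler_sum => x _. Qed.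

Lemma sum4_norm_le F : `|sum4 F| <= sum4 (fun a b c d => `|F a b c d|).
Proof. exact: ler_norm_sum. Qed.

Lemma sum4_swap_rows F : sum4 (fun a b c d => F b a c d) = sum4 F.
Proof. by rewrite !sum4E exchange_big. Qed.

Lemma sum4_swap_cols F : sum4 (fun a b c d => F a b d c) = sum4 F.
Proof.
rewrite !sum4E; apply: eq_bigr => a _; apply: eq_bigr => b _.
by rewrite exchange_big.
Qed.

End FourfoldSums.

Section SwitchingPolynomial.
Variables (R : realType) (n : nat) (p : R) (w : 'I_n -> 'I_n -> R).
Hypotheses (p01 : 0 <= p <= 1) (wC : forall u v, w u v = w v u).
Implicit Types (f g : 'I_n -> R) (a b c d : 'I_n).
Local Notation apply := (kernel_apply w).
Local Notation rows := (row_sum w).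

(* For [w] the centred adjacency matrix, [+1] if exactly the edges [ac, bd] of the
   quadrilateral are present and [-1] if exactly [ad, bc] are. *)
Definition switching_poly a b c d : R :=
  (p + w a c) * (p + w b d) * (1 - p - w a d) * (1 - p - w b c)
  - (p + w a d) * (p + w b c) * (1 - p - w a c) * (1 - p - w b d).

Definition switching_poly_linear a b c d : R := w a c + w b d - w a d - w b c.

Definition switching_poly_quadratic a b c d : R := w a c * w b d - w a d * w b c.

Definition switching_poly_cubic a b c d : R :=
  w a d * w b c * w a c + w a d * w b c * w b d
  - (w a c * w b d * w a d + w a c * w b d * w b c).

Lemma switching_poly_expand a b c d : switching_poly a b c d =
  p * (1 - p) * switching_poly_linear a b c d
  + ((1 - 2 * p) * switching_poly_quadratic a b c d + switching_poly_cubic a b c d).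
Proof.
rewrite /switching_poly /switching_poly_linear /switching_poly_quadratic /switching_poly_cubic.
by ring.
Qed.

Lemma switching_poly_swap_rows a b c d : switching_poly b a c d = - switching_poly a b c d.
Proof. by rewrite /switching_poly; ring. Qed.

Lemma switching_poly_swap_cols a b c d : switching_poly a b d c = - switching_poly a b c d.
Proof. by rewrite /switching_poly; ring. Qed.

Lemma sum4_linear f g : sum4 (fun a b c d => f a * g c * switching_poly_linear a b c d)
  = n%:R ^+ 2 * centered_bilin w f g.
Proof.
have sum_ac : sum4 (fun a b c d => f a * g c * w a c) = n%:R ^+ 2 * bilin w f g.
  rewrite sum4E /bilin mulr_sumr; apply: eq_bigr => a _.
  under eq_bigr => b _ do under eq_bigr => c _ do rewrite sumr_ord_const.
  by rewrite sumr_ord_const -mulr_sumr; ring.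
have sum_bd : sum4 (fun a b c d => f a * g c * w b d)
    = (\sum_c f c) * (\sum_c g c) * \sum_b rows b.
  rewrite sum4E -mulrA mulr_suml; apply: eq_bigr => a _.
  rewrite !mulr_sumr; apply: eq_bigr => b _.
  rewrite mulr_suml mulr_sumr; apply: eq_bigr => c _.
  by rewrite /row_sum !mulr_sumr; apply: eq_bigr => d _; rewrite mulrA.
have sum_ad : sum4 (fun a b c d => f a * g c * w a d)
    = n%:R * (\sum_c g c) * \sum_a f a * rows a.
  rewrite sum4E mulr_sumr; apply: eq_bigr => a _.
  rewrite sumr_ord_const -mulrA; congr (_ * _).
  rewrite mulr_suml; apply: eq_bigr => c _.
  by rewrite /row_sum !mulr_sumr; apply: eq_bigr => d _; ring.
have sum_bc : sum4 (fun a b c d => f a * g c * w b c)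
    = n%:R * (\sum_c f c) * \sum_c g c * rows c.
  rewrite sum4E -mulrA mulr_suml mulr_sumr; apply: eq_bigr => a _.
  rewrite exchange_big /= !mulr_sumr; apply: eq_bigr => c _.
  rewrite /row_sum !mulr_sumr; apply: eq_bigr => b _.
  by rewrite sumr_ord_const (wC b c); ring.
have [n0|n_gt0] := posnP n.
  have -> : n%:R = 0 :> R by rewrite n0.
  by rewrite expr0n mul0r sum4E big1 // => a; have := ltn_ord a; rewrite {2}n0.
have n_neq0 : n%:R != 0 :> R by rewrite pnatr_eq0 -lt0n.
rewrite centered_bilinE //; set S := \sum_c f c in sum_bd sum_bc *.
set T := \sum_c g c in sum_bd sum_ad *.
rewrite (@eq_sum4 _ _ _ (fun a b c d => (f a * g c * w a c + f a * g c * w b d)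
   + (-1 * (f a * g c * w a d) + -1 * (f a * g c * w b c)))) => [|a b c d]; last first.
  by rewrite /switching_poly_linear; ring.
rewrite !sum4D !sum4Z sum_ac sum_bd sum_ad sum_bc.
by field.
Qed.

Lemma sum4_ac_bd f g : sum4 (fun a b c d => f a * g c * (w a c * w b d))
  = bilin w f g * \sum_b rows b.
Proof.
rewrite sum4E mulr_suml; apply: eq_bigr => a _.
rewrite exchange_big mulr_suml; apply: eq_bigr => c _.
rewrite mulr_sumr; apply: eq_bigr => b _.
by rewrite mulr_sumr; apply: eq_bigr => d _; rewrite mulrA.
Qed.

Lemma sum4_ad_bc f g : sum4 (fun a b c d => f a * g c * (w a d * w b c))
  = (\sum_a f a * rows a) * \sum_c g c * rows c.
Proof.
rewrite sum4E mulr_suml; apply: eq_bigr => a _.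
rewrite exchange_big /= mulr_sumr; apply: eq_bigr => c _.
rewrite /row_sum !mulr_sumr; apply: eq_bigr => b _.
rewrite mulr_suml; apply: eq_bigr => d _.
by rewrite (wC b c); ring.
Qed.

Lemma sum4_ac_bd_ad f g : sum4 (fun a b c d => f a * g c * (w a c * w b d * w a d))
  = \sum_a apply g a * (f a * apply rows a).
Proof.
rewrite sum4E; apply: eq_bigr => a _; rewrite exchange_big /= /kernel_apply mulr_suml.
apply: eq_bigr => c _; rewrite exchange_big /= !mulr_sumr; apply: eq_bigr => d _.
rewrite /row_sum !mulr_sumr; apply: eq_bigr => b _.
by rewrite (wC b d); ring.
Qed.

Lemma sum4_ac_bd_bc f g : sum4 (fun a b c d => f a * g c * (w a c * w b d * w b c))
  = \sum_c apply f c * (g c * apply rows c).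
Proof.
rewrite sum4E; under eq_bigr => a _ do rewrite exchange_big /=.
rewrite exchange_big /=; apply: eq_bigr => c _; rewrite /kernel_apply mulr_suml.
apply: eq_bigr => a _; rewrite !mulr_sumr; apply: eq_bigr => b _.
rewrite /row_sum !mulr_sumr; apply: eq_bigr => d _.
by rewrite (wC b c) (wC a c); ring.
Qed.

Lemma sum4_ad_bc_ac f g : sum4 (fun a b c d => f a * g c * (w a d * w b c * w a c))
  = \sum_a rows a * (f a * apply (fun c => g c * rows c) a).
Proof.
rewrite sum4E; apply: eq_bigr => a _; rewrite exchange_big /= /kernel_apply !mulr_sumr.
apply: eq_bigr => c _; rewrite {2}/row_sum !mulr_sumr; apply: eq_bigr => b _.
rewrite /row_sum mulr_suml; apply: eq_bigr => d _.
by rewrite (wC b c); ring.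
Qed.

Lemma sum4_ad_bc_bd f g : sum4 (fun a b c d => f a * g c * (w a d * w b c * w b d))
  = \sum_b apply g b * apply (apply f) b.
Proof.
rewrite sum4E exchange_big /=; apply: eq_bigr => b _.
rewrite exchange_big /= /kernel_apply mulr_suml; apply: eq_bigr => c _.
rewrite mulr_sumr exchange_big /=; apply: eq_bigr => d _.
by rewrite !mulr_sumr; apply: eq_bigr => a _; rewrite (wC a d); ring.
Qed.

Section Bounds.
Variable Lam : R.
Hypotheses (w_le : forall u v, `|w u v| <= 1) (Lam_ge0 : 0 <= Lam)
  (rows_le : \sum_a `|rows a| <= Lam).

Let sum_mul_le f g : \sum_a `|f a| <= Lam -> (forall a, `|g a| <= Lam) ->
  `|\sum_a f a * g a| <= Lam ^+ 2.
Proof.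
move=> f_le g_le; apply: le_trans (ler_norm_sum _ _ _) _.
apply: (@le_trans _ _ (\sum_a `|f a| * Lam)).
  by apply: ler_sum => a _; rewrite normrM ler_wpM2l.
by rewrite -mulr_suml expr2 ler_wpM2r.
Qed.

Let mul_le f g a : `|f a| <= 1 -> `|g a| <= Lam -> `|f a * g a| <= Lam.
Proof. by move=> f_le g_le; rewrite normrM -[leRHS]mul1r ler_pM. Qed.

Let weighted_le f : (forall a, `|f a| <= 1) -> forall g, \sum_a `|g a| <= Lam ->
  `|\sum_a f a * g a| <= Lam.
Proof.
move=> f_le g g_le; apply: le_trans (ler_norm_sum _ _ _) _; apply: le_trans g_le.
by apply: ler_sum => a _; rewrite normrM ler_piMl.
Qed.

Section TwoFunctions.
Variables f g : 'I_n -> R.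
Hypotheses (f_le : forall a, `|f a| <= 1) (g_le : forall a, `|g a| <= 1)
  (image_f_le : \sum_a `|apply f a| <= Lam) (image_g_le : \sum_a `|apply g a| <= Lam).

Lemma sum4_quadratic_le :
  `|sum4 (fun a b c d => f a * g c * switching_poly_quadratic a b c d)| <= 2 * Lam ^+ 2.
Proof.
rewrite (@eq_sum4 _ _ _ (fun a b c d => f a * g c * (w a c * w b d)
   + -1 * (f a * g c * (w a d * w b c)))) => [|a b c d]; last first.
  by rewrite /switching_poly_quadratic; ring.
rewrite sum4D sum4Z mulN1r sum4_ac_bd sum4_ad_bc; apply: le_trans (ler_normB _ _) _.
have total_le : `|\sum_b rows b| <= Lam by apply: le_trans (ler_norm_sum _ _ _) _.
rewrite mulrDl mul1r expr2 !normrM lerD // ler_pM ?weighted_le //.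
by rewrite bilinE weighted_le.
Qed.

Lemma sum4_cubic_le :
  `|sum4 (fun a b c d => f a * g c * switching_poly_cubic a b c d)| <= 4 * Lam ^+ 2.
Proof.
rewrite (@eq_sum4 _ _ _ (fun a b c d => (f a * g c * (w a d * w b c * w a c)
    + f a * g c * (w a d * w b c * w b d))
   + -1 * (f a * g c * (w a c * w b d * w a d) + f a * g c * (w a c * w b d * w b c))))
  => [|a b c d]; last by rewrite /switching_poly_cubic; ring.
rewrite sum4D sum4Z !sum4D sum4_ad_bc_ac sum4_ad_bc_bd sum4_ac_bd_ad sum4_ac_bd_bc mulN1r.
have apply_rows_le a : `|apply rows a| <= Lam by apply: kernel_apply_norm_le.
have ad_bc_ac : `|\sum_a rows a * (f a * apply (fun c => g c * rows c) a)| <= Lam ^+ 2.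
  apply: sum_mul_le => // a; apply: mul_le => //; apply: kernel_apply_norm_le => //.
  by apply: le_trans rows_le; apply: ler_sum => c _; rewrite normrM ler_piMl.
have ad_bc_bd : `|\sum_b apply g b * apply (apply f) b| <= Lam ^+ 2.
  by apply: sum_mul_le => // a; apply: kernel_apply_norm_le.
have ac_bd_ad : `|\sum_a apply g a * (f a * apply rows a)| <= Lam ^+ 2.
  by apply: sum_mul_le => // a; apply: mul_le.
have ac_bd_bc : `|\sum_c apply f c * (g c * apply rows c)| <= Lam ^+ 2.
  by apply: sum_mul_le => // a; apply: mul_le.
rewrite (_ : 4 * Lam ^+ 2 = (Lam ^+ 2 + Lam ^+ 2) + (Lam ^+ 2 + Lam ^+ 2)); last by ring.
by do 2 (apply: le_trans (ler_normD _ _) _; rewrite ?normrN; apply: lerD => //);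
  apply: le_trans (ler_normD _ _) _; apply: lerD.
Qed.

Lemma sum4_switching_poly_le :
  `|sum4 (fun a b c d => f a * g c * switching_poly a b c d)
    - p * (1 - p) * n%:R ^+ 2 * centered_bilin w f g| <= 6 * Lam ^+ 2.
Proof.
rewrite -mulrA -sum4_linear -sum4Z.
rewrite (@eq_sum4 _ _ _ (fun a b c d =>
   p * (1 - p) * (f a * g c * switching_poly_linear a b c d)
   + ((1 - 2 * p) * (f a * g c * switching_poly_quadratic a b c d)
      + f a * g c * switching_poly_cubic a b c d))) => [|a b c d]; last first.
  by rewrite switching_poly_expand; ring.
rewrite sum4D addrC addKr sum4D sum4Z; apply: le_trans (ler_normD _ _) _.
have coef_le : `|1 - 2 * p| <= 1.
  by case/andP: p01 => ? ?; rewrite ler_norml; apply/andP; lra.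
rewrite (_ : 6 * Lam ^+ 2 = 2 * Lam ^+ 2 + 4 * Lam ^+ 2); last by ring.
apply: lerD; last exact: sum4_cubic_le.
by rewrite normrM; apply: le_trans sum4_quadratic_le; rewrite ler_piMl.
Qed.

End TwoFunctions.

Hypothesis shift01 : forall u v, 0 <= p + w u v <= 1.

Let A u v := p + w u v.
Let B u v := 1 - p - w u v.
Let A01 u v : 0 <= A u v <= 1. Proof. exact: shift01. Qed.
Let B01 u v : 0 <= B u v <= 1.
Proof. by rewrite /B; have /andP[? ?] := shift01 u v; apply/andP; split; lra. Qed.
Let A_ge0 u v : 0 <= A u v. Proof. by case/andP: (A01 u v). Qed.
Let B_ge0 u v : 0 <= B u v. Proof. by case/andP: (B01 u v). Qed.

Lemma sum_paths_le : \sum_d (\sum_b A b d) * (\sum_a B a d)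
  <= n%:R ^+ 3 * (p * (1 - p)) + n%:R * Lam.
Proof.
have path d : (\sum_b A b d) * (\sum_a B a d)
    <= n%:R ^+ 2 * (p * (1 - p)) + n%:R * `|rows d|.
  have -> : \sum_b A b d = n%:R * p + rows d.
    by rewrite big_split /= sumr_ord_const; congr (_ + _); apply: eq_bigr => b _.
  have -> : \sum_a B a d = n%:R * (1 - p) - rows d.
    by rewrite sumrB sumr_ord_const; congr (_ - _); apply: eq_bigr => a _.
  have cross : n%:R * (1 - 2 * p) * rows d <= n%:R * `|rows d|.
    rewrite -mulrA ler_wpM2l //; apply: le_trans (ler_norm _) _; rewrite normrM.
    by rewrite ler_piMl //; case/andP: p01 => ? ?; rewrite ler_norml; apply/andP; lra.
  have := sqr_ge0 (rows d); lra.
apply: le_trans (ler_sum _ (fun d _ => path d)) _.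
rewrite big_split /= sumr_ord_const -mulr_sumr.
rewrite (_ : n%:R * (_ * _) = n%:R ^+ 3 * (p * (1 - p))); last by ring.
by rewrite lerD2l ler_wpM2l.
Qed.

Lemma sum_path_entries :
  \sum_a \sum_b \sum_d A b d * B a d = \sum_d (\sum_b A b d) * (\sum_a B a d).
Proof.
rewrite exchange_big /=; under eq_bigr => b _ do rewrite exchange_big /=.
rewrite exchange_big /=; apply: eq_bigr => d _; rewrite mulr_suml; apply: eq_bigr => b _.
by rewrite mulr_sumr.
Qed.

Lemma switching_poly_norm_le a b d : `|switching_poly a b a d| <= A b d * B a d + A a d * B b d.
Proof.
have mid_le (x y z t : R) : 0 <= x <= 1 -> 0 <= y -> 0 <= z -> 0 <= t <= 1 ->
    x * y * z * t <= y * z.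
  move=> /andP[x_ge0 x_le1] y_ge0 z_ge0 /andP[t_ge0 t_le1].
  apply: (@le_trans _ _ (x * y * z)); first by rewrite ler_piMr // !mulr_ge0.
  by rewrite -mulrA ler_piMl // mulr_ge0.
rewrite /switching_poly -!/(A _ _) -!/(B _ _).
apply: le_trans (ler_normB _ _) _; rewrite !ger0_norm ?mulr_ge0 //.
apply: lerD; first exact: mid_le.
by rewrite [leLHS](_ : _ = A b a * A a d * B b d * B a a); [exact: mid_le|ring].
Qed.

Definition coincident (a b c d : 'I_n) := [|| a == c, a == d, b == c | b == d].

Lemma sum4_coincident_le :
  sum4 (fun a b c d => (coincident a b c d)%:R * `|switching_poly a b c d|)
  <= 8 * (n%:R ^+ 3 * (p * (1 - p)) + n%:R * Lam).
Proof.
pose E a b c d : R := (a == c)%:R * `|switching_poly a b c d|.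
have E_le : sum4 E <= 2 * (n%:R ^+ 3 * (p * (1 - p)) + n%:R * Lam).
  have -> : sum4 E = \sum_a \sum_b \sum_d `|switching_poly a b a d|.
    rewrite sum4E; apply: eq_bigr => a _; apply: eq_bigr => b _.
    rewrite exchange_big; apply: eq_bigr => d _; rewrite (bigD1 a) //= /E eqxx mul1r.
    by rewrite big1 ?addr0 // => c ca; rewrite eq_sym (negbTE ca) mul0r.
  apply: (@le_trans _ _ (\sum_a \sum_b \sum_d (A b d * B a d + A a d * B b d))).
    do 3 apply: ler_sum => ? _; exact: switching_poly_norm_le.
  under eq_bigr => a _ do under eq_bigr => b _ do rewrite big_split /=.
  under eq_bigr => a _ do rewrite big_split /=.
  rewrite big_split /= [X in _ + X]exchange_big /= sum_path_entries.
  by have := sum_paths_le; lra.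
pose E_bc a b c d : R := (b == c)%:R * `|switching_poly a b c d|.
pose E_ad a b c d : R := (a == d)%:R * `|switching_poly a b c d|.
pose E_bd a b c d : R := (b == d)%:R * `|switching_poly a b c d|.
have bc_eq : sum4 E_bc = sum4 E.
  rewrite -sum4_swap_rows; apply: eq_sum4 => a b c d.
  by rewrite /E_bc switching_poly_swap_rows normrN.
have ad_eq : sum4 E_ad = sum4 E.
  rewrite -sum4_swap_cols; apply: eq_sum4 => a b c d.
  by rewrite /E_ad switching_poly_swap_cols normrN.
have bd_eq : sum4 E_bd = sum4 E.
  rewrite -bc_eq -sum4_swap_cols; apply: eq_sum4 => a b c d.
  by rewrite /E_bd switching_poly_swap_cols normrN.
apply: (@le_trans _ _ ((sum4 E + sum4 E_ad) + (sum4 E_bc + sum4 E_bd))); last first.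
  by rewrite ad_eq bc_eq bd_eq; lra.
rewrite -!sum4D; apply: ler_sum4 => a b c d.
rewrite /E /E_ad /E_bc /E_bd -!mulrDl ler_wpM2r // -!natrD ler_nat /coincident.
by do 4 case: (_ == _).
Qed.

Lemma sum4_not_coincident_le f g : (forall a, `|f a| <= 1) -> (forall a, `|g a| <= 1) ->
    \sum_a `|apply f a| <= Lam -> \sum_a `|apply g a| <= Lam ->
  `|sum4 (fun a b c d => (~~ coincident a b c d)%:R * (f a * g c * switching_poly a b c d))
    - p * (1 - p) * n%:R ^+ 2 * centered_bilin w f g|
  <= 6 * Lam ^+ 2 + 8 * (n%:R ^+ 3 * (p * (1 - p)) + n%:R * Lam).
Proof.
move=> f_le g_le image_f_le image_g_le; pose F a b c d := f a * g c * switching_poly a b c d.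
rewrite (@eq_sum4 _ _ _ (fun a b c d => F a b c d + -1 * ((coincident a b c d)%:R * F a b c d)))
  => [|a b c d]; last by case: (coincident a b c d); rewrite /F /=; ring.
rewrite sum4D sum4Z addrAC mulN1r; apply: le_trans (ler_normB _ _) _; apply: lerD.
  exact: sum4_switching_poly_le.
apply: le_trans (sum4_norm_le _) _; apply: le_trans sum4_coincident_le.
apply: ler_sum4 => a b c d; rewrite normrM ger0_norm // ler_wpM2l // /F !normrM.
by rewrite ler_piMl // mulr_ile1.
Qed.

End Bounds.
End SwitchingPolynomial.

Section OrderedSums.
Variables (R : realType) (n : nat).
Implicit Types (x : 'I_n -> R) (H : 'I_n -> 'I_n -> 'I_n -> 'I_n -> R) (a b c d : 'I_n).

Lemma sum4_lt_rows_antisym x H : (forall a b c d, H b a c d = - H a b c d) ->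
  sum4 (fun a b c d => (a < b)%N%:R * ((x a - x b) * H a b c d))
  = sum4 (fun a b c d => x a * H a b c d).
Proof.
move=> H_swap; have H_diag a c d : H a a c d = 0 by have := H_swap a a c d; lra.
rewrite (@eq_sum4 _ _ _ (fun a b c d => (a < b)%N%:R * (x a * H a b c d)
   + (a < b)%N%:R * (x b * H b a c d))) => [|a b c d]; last by rewrite (H_swap a b); ring.
rewrite sum4D -(sum4_swap_rows (fun a b c d => (a < b)%N%:R * (x b * H b a c d))) -sum4D.
apply: eq_sum4 => a b c d; rewrite -mulrDl.
by case: (ltngtP a b) => [_|_|/val_inj ->]; rewrite ?H_diag ?mulr0 // ?addr0 ?add0r mul1r.
Qed.

Lemma sum4_lt_cols_antisym x H : (forall a b c d, H a b d c = - H a b c d) ->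
  sum4 (fun a b c d => (c < d)%N%:R * ((x c - x d) * H a b c d))
  = sum4 (fun a b c d => x c * H a b c d).
Proof.
move=> H_swap; have H_diag a b c : H a b c c = 0 by have := H_swap a b c c; lra.
rewrite (@eq_sum4 _ _ _ (fun a b c d => (c < d)%N%:R * (x c * H a b c d)
   + (c < d)%N%:R * (x d * H a b d c))) => [|a b c d]; last by rewrite (H_swap a b c); ring.
rewrite sum4D -(sum4_swap_cols (fun a b c d => (c < d)%N%:R * (x d * H a b d c))) -sum4D.
apply: eq_sum4 => a b c d; rewrite -mulrDl.
by case: (ltngtP c d) => [_|_|/val_inj ->]; rewrite ?H_diag ?mulr0 // ?addr0 ?add0r mul1r.
Qed.

Lemma sum4_lt_rows_sqr_le x H : (forall a, 0 <= x a <= 1) ->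
    (forall a b c d, H b a c d = H a b c d) -> (forall a b c d, 0 <= H a b c d) ->
  sum4 (fun a b c d => (a < b)%N%:R * ((x a - x b) ^+ 2 * H a b c d))
  <= sum4 (fun a b c d => x a * H a b c d).
Proof.
move=> x01 H_swap H_ge0.
apply: (@le_trans _ _ (sum4 (fun a b c d => (a < b)%N%:R * (x a * H a b c d)
   + (a < b)%N%:R * (x b * H b a c d)))).
  apply: ler_sum4 => a b c d; rewrite (H_swap a b) -mulrDr -mulrDl; apply: ler_wpM2l => //.
  by apply: ler_wpM2r => //; have := x01 a; have := x01 b; nra.
rewrite sum4D -(sum4_swap_rows (fun a b c d => (a < b)%N%:R * (x b * H b a c d))) -sum4D.
apply: ler_sum4 => a b c d; rewrite -mulrDl ler_piMl //.
  by rewrite mulr_ge0 //; case/andP: (x01 a).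
by case: ltngtP => _; rewrite /= ?addr0 ?add0r.
Qed.

Lemma sum4_lt_cols_sqr_le x H : (forall c, 0 <= x c <= 1) ->
    (forall a b c d, H a b d c = H a b c d) -> (forall a b c d, 0 <= H a b c d) ->
  sum4 (fun a b c d => (c < d)%N%:R * ((x c - x d) ^+ 2 * H a b c d))
  <= sum4 (fun a b c d => x c * H a b c d).
Proof.
move=> x01 H_swap H_ge0.
have transpose (F : 'I_n -> 'I_n -> 'I_n -> 'I_n -> R) : sum4 F = sum4 (fun c d a b => F a b c d).
  rewrite !sum4E pair_bigA exchange_big /=; apply: eq_bigr => c _.
  by rewrite exchange_big; apply: eq_bigr => d _; rewrite pair_bigA.
rewrite transpose (transpose (fun a b c d => x c * _)).
by apply: (sum4_lt_rows_sqr_le (H := fun c d a b => H a b c d)).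
Qed.

End OrderedSums.

Section RandomSets.
Variables (R : realType) (n : nat).
Implicit Types (chi : {set 'I_n}) (a b c d : 'I_n).

Lemma sum_sets_expect_half (f : {set 'I_n} -> R) :
  \sum_chi f chi = 2 ^+ n * expect (fun=> 2^-1) f.
Proof.
rewrite /expect mulr_sumr; apply: eq_bigr => chi _; rewrite mulrA /bernoulli_weight.
rewrite (eq_bigr (fun=> 2^-1)) => [|i _]; last by case: ifP => _; lra.
by rewrite prodr_const card_ord exprVn divff ?mul1r // expf_neq0 // pnatr_eq0.
Qed.

Lemma expect_mem_mul (p : 'I_n -> R) a (g : {set 'I_n} -> R) : insensitive g a ->
  expect p (fun chi => (a \in chi)%:R * g chi) = p a * expect p g.
Proof.
move=> g_ins; rewrite -(expect_resample p a) -expectZl; apply: eq_expect => chi.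
by rewrite /resample setU11 setD11 mul1r mul0r mulr0 addr0 (insensitive_toggle chi g_ins).1.
Qed.

Lemma expect_notin_mul (p : 'I_n -> R) a (g : {set 'I_n} -> R) : insensitive g a ->
  expect p (fun chi => (a \notin chi)%:R * g chi) = (1 - p a) * expect p g.
Proof.
move=> g_ins; rewrite -(expect_resample p a) -expectZl; apply: eq_expect => chi.
by rewrite /resample setU11 setD11 mul1r mul0r mulr0 add0r (insensitive_toggle chi g_ins).2.
Qed.

Lemma sum_separating_sets a b c d : a != b -> c != d ->
  \sum_(chi : {set 'I_n}) ([&& a \in chi, b \in chi, c \notin chi & d \notin chi])%:R
  = (~~ coincident a b c d)%:R * (2 ^+ n / 16) :> R.
Proof.
move=> ab cd; case: (boolP (coincident a b c d)) => [meet|].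
  rewrite mul0r big1 // => chi _; move: meet; rewrite /coincident.
  by move=> /or4P[] /eqP ->; case: (c \in chi); case: (d \in chi); rewrite /= ?andbF.
rewrite /coincident !negb_or => /and4P[/negbTE ac /negbTE ad /negbTE bc /negbTE bd].
pose p : 'I_n -> R := fun=> 2^-1.
rewrite mul1r sum_sets_expect_half -/p; congr (_ * _).
rewrite (@eq_expect _ _ _ _ (fun chi => (a \in chi)%:R * ((b \in chi)%:R
  * ((c \notin chi)%:R * ((d \notin chi)%:R * 1))))) => [|chi]; last first.
  by do 4 case: (_ \in chi); rewrite /= !(mulr1, mulr0, mul0r).
rewrite expect_mem_mul => [|chi]; last by rewrite !inE (eq_sym b) (eq_sym c) (eq_sym d) (negbTE ab) ac ad.
rewrite expect_mem_mul => [|chi]; last by rewrite !inE (eq_sym c) (eq_sym d) bc bd.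
rewrite expect_notin_mul => [|chi]; last by rewrite !inE (eq_sym d) (negbTE cd).
rewrite expect_notin_mul => [|chi //]; rewrite expect_cst /p; lra.
Qed.

End RandomSets.

Section SwitchingStatistics.
Variables (R : realType) (n : nat) (w : {set ('I_n * 'I_n)}).
Implicit Types (X Y : {set 'I_n}) (a b c d : 'I_n).

Definition switching_value a b c d : R :=
  if [&& adj w a c, adj w b d, ~~ adj w a d & ~~ adj w b c] then 1
  else if [&& adj w a d, adj w b c, ~~ adj w a c & ~~ adj w b d] then -1 else 0.

Definition switching_stat X Y : R := sum4 (fun a b c d =>
  indicator R X a * (indicator R Y c * ((~~ coincident a b c d)%:R * switching_value a b c d))).

Definition switching_energy X Y : R := sum4 (fun a b c d =>
  indicator R X a * (indicator R Y c * ((~~ coincident a b c d)%:R * switching_value a b c d ^+ 2))).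

Lemma coincident_swap_rows a b c d : coincident b a c d = coincident a b c d.
Proof. by rewrite /coincident; do 4 case: (_ == _). Qed.

Lemma coincident_swap_cols a b c d : coincident a b d c = coincident a b c d.
Proof. by rewrite /coincident; do 4 case: (_ == _). Qed.

Lemma switching_value_swap_rows a b c d : switching_value b a c d = - switching_value a b c d.
Proof.
by rewrite /switching_value; do 4 case: (adj w _ _); rewrite /= ?opprK ?oppr0.
Qed.

Lemma switching_value_swap_cols a b c d : switching_value a b d c = - switching_value a b c d.
Proof.
by rewrite /switching_value; do 4 case: (adj w _ _); rewrite /= ?opprK ?oppr0.
Qed.

Lemma switching_value_poly p a b c d : ~~ coincident a b c d ->
  switching_value a b c d = switching_poly p (centered_adj p w) a b c d.
Proof.
rewrite /coincident !negb_or => /and4P[/negbTE ac /negbTE ad /negbTE bc /negbTE bd].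
rewrite /switching_poly /centered_adj ac ad bc bd !subrKC /switching_value.
by case: (adj w a c); case: (adj w b d); case: (adj w a d); case: (adj w b c);
  rewrite /= ?subrKC ?subr0 ?subrr; ring.
Qed.

End SwitchingStatistics.

Section SwitchingAverage.
Variables (R : realType) (n : nat) (p : R) (M : nat).
Hypotheses (p01 : 0 <= p <= 1) (n_gt0 : (0 < n)%N) (M_gt0 : (0 < M)%N).
Local Notation coord := ('I_n * 'I_n)%type.
Local Notation edge_prob := (@edge_prob R n p).
Local Notation scheme := ({set 'I_n} * 'I_n * 'I_M)%type.
Variables (lam : R) (X Y : {ffun 'I_n -> nat} -> {set 'I_n}).
Hypothesis lam_le : `|lam| <= 1 / 3.
Implicit Types (w : {set coord}) (k : scheme) (x : switching n) (f : {ffun 'I_n -> nat})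
  (a b c d : 'I_n).

Definition switching_coef x f : R :=
  lam * (indicator R (X f) x.1.1 - indicator R (X f) x.1.2)
      * (indicator R (Y f) x.2.1 - indicator R (Y f) x.2.2).

Lemma switching_coef_le x f : `|switching_coef x f| <= 1 / 3.
Proof.
apply: le_trans lam_le; rewrite /switching_coef -mulrA !normrM ler_piMr //.
by rewrite mulr_ile1 // indicator_diff_norm_le.
Qed.

Definition scheme_sign k w x : R := switching_sign R k.1.1 k.1.2 M k.2 w x.

Definition scheme_sum k w : R := \sum_x switching_coef x (degree_seq w) * scheme_sign k w x.

Definition scheme_energy k w : R :=
  \sum_x (switching_coef x (degree_seq w) * scheme_sign k w x) ^+ 2.

Definition switching_exponent w : R :=
  (\sum_k (scheme_sum k w - scheme_energy k w)) / #|{: scheme}|%:R.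

Lemma card_schemes : #|{: scheme}|%:R = 2 ^+ n * n%:R * M%:R :> R.
Proof.
have card_sets : #|{set 'I_n}| = (2 ^ n)%N.
  by rewrite -cardsT -powersetT card_powerset cardsT card_ord.
by rewrite !card_prod !card_ord card_sets !natrM natrX.
Qed.

Lemma expect_expR_switching_exponent (H : {ffun 'I_n -> nat} -> R) : (forall f, 0 <= H f) ->
  expect edge_prob (fun w => H (degree_seq w) * expR (switching_exponent w))
  <= expect edge_prob (fun w => H (degree_seq w)).
Proof.
move=> H_ge0; have card_gt0 : (0 < #|{: scheme}|)%N.
  by rewrite -(ltr_nat R) card_schemes !mulr_gt0 ?exprn_gt0 // ltr0n.
have card_gt0' : 0 < #|{: scheme}|%:R :> R by rewrite ltr0n.
apply: (@le_trans _ _ (expect edge_prob (fun w => \sum_(k : scheme)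
    #|{: scheme}|%:R^-1 * (H (degree_seq w) * expR (scheme_sum k w - scheme_energy k w))))).
  apply: expect_le => [|w]; first exact: edge_prob01.
  rewrite -mulr_sumr -mulr_sumr mulrCA; apply: ler_wpM2l => //.
  by rewrite mulrC; exact: expR_mean_le.
rewrite expect_sum.
apply: (@le_trans _ _ (\sum_(k : scheme)
    #|{: scheme}|%:R^-1 * expect edge_prob (fun w => H (degree_seq w)))); last first.
  by rewrite sumr_const -[X in X <= _]mulr_natl mulrA divff ?gt_eqF // mul1r.
apply: ler_sum => k _; rewrite expectZl ler_wpM2l ?invr_ge0 ?(ltW card_gt0') //.
have := expect_expR_switching_signs p01 k.1.1 k.1.2 M k.2 (index_enum_uniq _) H_ge0 switching_coef_le.
by under eq_expect => w do rewrite sumrB.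
Qed.

Section FewDisagreements.
Variable w : {set coord}.
Hypothesis disagreements_le : forall a b, (#|[set c | adj w a c != adj w b c]| <= M)%N.

Definition scheme_selects k a b c d : bool :=
  [&& (a < b)%N, (c < d)%N, [&& a \in k.1.1, b \in k.1.1, c \notin k.1.1 & d \notin k.1.1],
      a + b == k.1.2 %[mod n]
    & disagreement_rank k.1.1 w a b c + disagreement_rank k.1.1 w a b d == k.2 %[mod M]].

Lemma scheme_signE k a b c d : scheme_sign k w ((a, b), (c, d))
  = (scheme_selects k a b c d)%:R * switching_value R w a b c d.
Proof.
have card_le : (#|disagreement k.1.1 w a b| <= M)%N.
  apply: leq_trans (disagreements_le a b); apply: subset_leq_card; apply/subsetP => c'.
  by rewrite !inE => /andP[].
rewrite /scheme_sign /switching_sign /active /scheme_selects /eligible card_le /= !inE.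
case: (a < b)%N; rewrite /= ?mul0r //.
case: (a \in _); rewrite /= ?andbF ?mul0r //.
case: (b \in _); rewrite /= ?andbF ?mul0r //.
case: (c < d)%N; rewrite /= ?andbF ?mul0r //.
case: (c \in _); rewrite /= ?andbF ?mul0r //.
case: (d \in _); rewrite /= ?andbF ?mul0r //.
case: (_ == _ %[mod n]); rewrite /= ?andbF ?mul0r //.
case: (_ == _ %[mod M]); rewrite /= ?andbF ?mul0r // mul1r /switching_value.
by case: (adj w a c); case: (adj w b c); case: (adj w a d); case: (adj w b d).
Qed.

Lemma sum_scheme_selects a b c d : \sum_(k : scheme) (scheme_selects k a b c d)%:R
  = (a < b)%N%:R * ((c < d)%N%:R * ((~~ coincident a b c d)%:R * (2 ^+ n / 16))) :> R.
Proof.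
case: (boolP (a < b)%N) => ab; last first.
  by rewrite mul0r big1 // => k _; rewrite /scheme_selects (negbTE ab).
case: (boolP (c < d)%N) => cd; last first.
  by rewrite mul0r mulr0 big1 // => k _; rewrite /scheme_selects (negbTE cd) andbF.
rewrite !mul1r -sum_separating_sets ?neq_ltn ?ab ?cd //.
have modn_unique m (t : 'I_m) (s : nat) : (0 < m)%N -> (s == t %[mod m])%N = (t == s %% m :> nat)%N.
  by move=> m_gt0; rewrite (modn_small (ltn_ord t)) eq_sym.
pose F chi (h : 'I_n) (g : 'I_M) : R := (scheme_selects (chi, h, g) a b c d)%:R.
transitivity (\sum_chi \sum_h \sum_g F chi h g).
  rewrite pair_bigA /= pair_bigA; apply: eq_bigr => -[[chi h] g] _ //.
apply: eq_bigr => chi _; rewrite /F /scheme_selects /= ab cd /=.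
case: [&& _, _, _ & _]; last by rewrite big1 // => h _; rewrite big1.
pose s := (disagreement_rank chi w a b c + disagreement_rank chi w a b d)%N.
rewrite (bigD1 (Ordinal (ltn_pmod (a + b) n_gt0))) //= modn_mod eqxx.
rewrite (bigD1 (Ordinal (ltn_pmod s M_gt0))) //= modn_mod eqxx.
rewrite big1 ?addr0 => [|g]; last first.
  by rewrite -val_eqE modn_unique //= => /negbTE ->.
rewrite big1 ?addr0 // => h; rewrite -val_eqE /= => /negbTE h_neq.
by rewrite big1 // => g _; rewrite modn_unique // h_neq.
Qed.

Lemma sum_scheme_sum : \sum_k scheme_sum k w
  = lam * switching_stat R w (X (degree_seq w)) (Y (degree_seq w)) * (2 ^+ n / 16).
Proof.
rewrite /scheme_sum exchange_big /=.
pose x := indicator R (X (degree_seq w)); pose y := indicator R (Y (degree_seq w)).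
pose T a b c d : R := (~~ coincident a b c d)%:R * switching_value R w a b c d.
have T_rows a b c d : T b a c d = - T a b c d.
  by rewrite /T coincident_swap_rows switching_value_swap_rows mulrN.
have T_cols a b c d : T a b d c = - T a b c d.
  by rewrite /T coincident_swap_cols switching_value_swap_cols mulrN.
transitivity (\sum_(z : switching n) lam * (2 ^+ n / 16)
   * ((z.1.1 < z.1.2)%N%:R * ((x z.1.1 - x z.1.2) * ((z.2.1 < z.2.2)%N%:R
      * ((y z.2.1 - y z.2.2) * T z.1.1 z.1.2 z.2.1 z.2.2))))).
  apply: eq_bigr => -[[a b] [c d]] _ /=.
  under eq_bigr => k _ do rewrite scheme_signE mulrCA.
  by rewrite -mulr_suml sum_scheme_selects /switching_coef /= -/x -/y /T; ring.
rewrite -mulr_sumr -/(sum4 (fun a b c d => (a < b)%N%:R * ((x a - x b)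
  * ((c < d)%N%:R * ((y c - y d) * T a b c d))))).
rewrite sum4_lt_rows_antisym => [|a b c d]; last by rewrite T_rows !mulrN.
rewrite (@eq_sum4 _ _ _ (fun a b c d => (c < d)%N%:R * ((y c - y d) * (x a * T a b c d))))
  => [|a b c d]; last by ring.
rewrite sum4_lt_cols_antisym => [|a b c d]; last by rewrite T_cols mulrN.
rewrite mulrAC; congr (_ * _ * _); apply: eq_sum4 => a b c d.
by rewrite mulrCA.
Qed.

Lemma sum_scheme_energy : \sum_k scheme_energy k w
  <= lam ^+ 2 * switching_energy R w (X (degree_seq w)) (Y (degree_seq w)) * (2 ^+ n / 16).
Proof.
rewrite /scheme_energy exchange_big /=.
pose x := indicator R (X (degree_seq w)); pose y := indicator R (Y (degree_seq w)).
pose T a b c d : R := (~~ coincident a b c d)%:R * switching_value R w a b c d ^+ 2.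
have T_ge0 a b c d : 0 <= T a b c d by rewrite mulr_ge0 ?sqr_ge0.
have T_rows a b c d : T b a c d = T a b c d.
  by rewrite /T coincident_swap_rows switching_value_swap_rows sqrrN.
have T_cols a b c d : T a b d c = T a b c d.
  by rewrite /T coincident_swap_cols switching_value_swap_cols sqrrN.
rewrite (_ : \sum_(z : switching n) _ = \sum_(z : switching n) lam ^+ 2 * (2 ^+ n / 16)
   * ((z.1.1 < z.1.2)%N%:R * ((x z.1.1 - x z.1.2) ^+ 2 * ((z.2.1 < z.2.2)%N%:R
      * ((y z.2.1 - y z.2.2) ^+ 2 * T z.1.1 z.1.2 z.2.1 z.2.2))))); last first.
  apply: eq_bigr => -[[a b] [c d]] _ /=.
  have sqr_select (e : bool) (s t : R) : (s * (e%:R * t)) ^+ 2 = e%:R * (s ^+ 2 * t ^+ 2).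
    by case: e; rewrite /=; ring.
  under eq_bigr => k _ do rewrite scheme_signE sqr_select.
  by rewrite -mulr_suml sum_scheme_selects /switching_coef /= -/x -/y /T; ring.
rewrite -mulr_sumr -/(sum4 (fun a b c d => (a < b)%N%:R * ((x a - x b) ^+ 2
  * ((c < d)%N%:R * ((y c - y d) ^+ 2 * T a b c d))))).
have weight_ge0 : 0 <= lam ^+ 2 * (2 ^+ n / 16).
  by apply: mulr_ge0; [exact: sqr_ge0|rewrite divr_ge0 ?exprn_ge0].
rewrite [leRHS]mulrAC ler_wpM2l //.
have x01 : forall a, 0 <= x a <= 1 by exact: indicator01.
have y01 : forall c, 0 <= y c <= 1 by exact: indicator01.
apply: le_trans (sum4_lt_rows_sqr_le (H := fun a b c d =>
  (c < d)%N%:R * ((y c - y d) ^+ 2 * T a b c d)) x01 _ _) _ => [a b c d|a b c d|].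
- by rewrite T_rows.
- by rewrite mulr_ge0 // mulr_ge0 ?sqr_ge0.
rewrite (@eq_sum4 _ _ _ (fun a b c d => (c < d)%N%:R * ((y c - y d) ^+ 2 * (x a * T a b c d))))
  => [|a b c d]; last by ring.
apply: le_trans (sum4_lt_cols_sqr_le (H := fun a b c d => x a * T a b c d) y01 _ _) _
  => [a b c d|a b c d|].
- by rewrite T_cols.
- by rewrite mulr_ge0 //; case/andP: (x01 a).
by rewrite le_eqVlt; apply/orP; left; apply/eqP/eq_sum4 => a b c d; rewrite mulrCA.
Qed.

Lemma switching_exponent_ge :
  (lam * switching_stat R w (X (degree_seq w)) (Y (degree_seq w))
   - lam ^+ 2 * switching_energy R w (X (degree_seq w)) (Y (degree_seq w)))
    / (16 * n%:R * M%:R) <= switching_exponent w.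
Proof.
rewrite /switching_exponent sumrB sum_scheme_sum card_schemes.
have n_gt0' : 0 < n%:R :> R by rewrite ltr0n.
have M_gt0' : 0 < M%:R :> R by rewrite ltr0n.
have pow_gt0 : 0 < 2 ^+ n :> R by rewrite exprn_gt0.
have := sum_scheme_energy; move: (\sum_k _) (switching_energy _ _ _ _) => V E V_le.
rewrite -mulrA ler_pdivrMr ?mulr_gt0 //.
move: (switching_stat _ _ _ _) (2 ^+ n) pow_gt0 V_le => Z t t_gt0 V_le.
rewrite [leRHS](_ : _ = lam * Z - V * 16 / t); last by field; rewrite !gt_eqF.
by rewrite lerD2l lerN2 ler_pdivrMr // -ler_pdivlMr // -mulrA.
Qed.

End FewDisagreements.
End SwitchingAverage.

(** * Concentration *)

Section RowResampling.
Variables (R : realType) (n : nat) (p : R).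
Hypothesis p01 : 0 <= p <= 1.
Local Notation coord := ('I_n * 'I_n)%type.
Local Notation edge_prob := (@edge_prob R n p).
Implicit Types (w : {set coord}) (u v x y : 'I_n) (s : seq 'I_n) (S V : {set 'I_n}).

Lemma edge_index_neq x y v u : x != y -> v != u -> (x, y) != (v, u) -> (x, y) != (u, v) ->
  edge_index x y != edge_index v u.
Proof. by move=> xy vu neq neq'; rewrite edge_index_eq // negb_or neq. Qed.

Lemma insensitive_adj (e : coord) u v : (u != v -> edge_index u v != e) ->
  insensitive (fun w => adj w u v) e.
Proof.
move=> index_neq w; rewrite adjU adjD; case: (eqVneq u v) index_neq => [<-|uv] index_neq.
  by rewrite adj_irrefl.
by rewrite (negbTE (index_neq isT)) andbT.
Qed.

Lemma resample_row (A : Type) v (m : {set coord} -> A) (Phi : A -> nat -> R) s w :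
    v \notin s -> uniq s -> (forall u, u \in s -> insensitive m (edge_index v u)) ->
  resample_all edge_prob [seq edge_index v u | u <- s]
    (fun w => Phi (m w) (\sum_(u <- s) adj w v u)%N) w
  = binomial_mean (size s) p (Phi (m w)).
Proof.
elim: s A m Phi w => [|u s IH] A m Phi w /=; first by rewrite big_nil.
rewrite inE negb_or => /andP[vu vs] /andP[us uniq_s] m_ins.
have tail w' : resample_all edge_prob [seq edge_index v x | x <- s]
     (fun w => Phi (m w) (\sum_(x <- u :: s) adj w v x)%N) w'
   = binomial_mean (size s) p (fun i => Phi (m w') (adj w' v u + i)%N).
  rewrite -(IH (A * bool)%type (fun w => (m w, adj w v u))
    (fun mb i => Phi mb.1 (mb.2 + i)%N) w' vs uniq_s) => [|x xs w2].
    by congr (resample_all _ _ _ _); apply: funext => w2; rewrite big_cons.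
  rewrite (m_ins x) ?inE ?xs ?orbT // insensitive_adj // => _.
  have xu : u != x by apply: contraNneq us => ->.
  have vx : v != x by apply: contraNneq vs => ->.
  by rewrite edge_index_neq // xpair_eqE ?(negbTE vx) // negb_and xu orbT.
rewrite /resample !tail.
have [-> ->] := insensitive_toggle w (m_ins u (mem_head _ _)).
by rewrite adjU adjD eqxx vu /= andbF /edge_prob edge_index_lt.
Qed.

Lemma expect_degree (phi : nat -> R) v :
  expect edge_prob (fun w => phi (degree w v)) = binomial_mean n.-1 p phi.
Proof.
pose s := enum (predC1 v).
rewrite -(expect_resample_all edge_prob [seq edge_index v u | u <- s]).
rewrite -[RHS](expect_cst edge_prob); apply: eq_expect => w.
rewrite (_ : (fun w => phi (degree w v))
   = (fun w => (fun (_ : unit) i => phi i) tt (\sum_(u <- s) adj w v u)%N)); last first.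
  apply: funext => w'; congr phi; rewrite /degree (bigD1 v) //= adj_irrefl add0n.
  by rewrite /s big_enum.
rewrite (@resample_row unit v (fun=> tt) (fun _ i => phi i)) ?enum_uniq ?mem_enum ?inE ?eqxx //.
by rewrite -cardE cardC1 card_ord.
Qed.

Definition partial_degree S w v : nat := \sum_(u in S) adj w v u.

Lemma degree_partial S w v : degree w v = (partial_degree S w v + partial_degree (~: S) w v)%N.
Proof.
rewrite /degree (bigID (mem S)) /=; congr (_ + _)%N.
by apply: eq_bigl => u; rewrite inE.
Qed.

Lemma insensitive_partial_degree S (e : coord) v :
    {in S, forall u, v != u -> edge_index v u != e} -> insensitive (partial_degree S ^~ v) e.
Proof.
by move=> index_neq w; apply: eq_bigr => u uS; rewrite (insensitive_adj (index_neq u uS)).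
Qed.

(* The rows of [V] are resampled one after the other, outside [V]. *)
Lemma expect_expR_rows V (phi : nat -> nat -> R) :
    (forall m, binomial_mean #|~: V| p (fun l => expR (phi m l)) <= 1) ->
  expect edge_prob (fun w =>
    expR (\sum_(v in V) phi (partial_degree V w v) (partial_degree (~: V) w v))) <= 1.
Proof.
move=> mgf_le; pose row w v := phi (partial_degree V w v) (partial_degree (~: V) w v).
suff rows s : uniq s -> {subset s <= V} ->
    expect edge_prob (fun w => expR (\sum_(v <- s) row w v)) <= 1.
  have := rows (enum V) (enum_uniq _) (fun x => _); under eq_expect do rewrite big_enum.
  by apply=> x; rewrite mem_enum.
elim: s => [_ _|v s IH /= /andP[vs uniq_s] sV].
  by under eq_expect do rewrite big_nil expR0; rewrite expect_cst.
have vV : v \in V by apply: sV; exact: mem_head.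
have {}sV : {subset s <= V} by move=> x xs; apply: sV; rewrite inE xs orbT.
apply: le_trans (IH uniq_s sV); pose G w := expR (\sum_(x <- s) row w x).
rewrite -(expect_resample_all edge_prob [seq edge_index v u | u <- enum (~: V)]).
apply: expect_le => [|w]; first exact: edge_prob01.
rewrite (_ : (fun w => expR _) = (fun w => (fun mG i => expR (phi mG.1 i) * mG.2)
   (partial_degree V w v, G w) (\sum_(u <- enum (~: V)) adj w v u)%N)); last first.
  by apply: funext => w'; rewrite big_cons expRD /row /partial_degree big_enum.
rewrite (@resample_row (nat * R)%type v (fun w => (partial_degree V w v, G w))
  (fun mG i => expR (phi mG.1 i) * mG.2)) ?enum_uniq ?mem_enum ?inE ?vV //=.
  rewrite -cardE (@eq_binomial_mean _ _ _ _ (fun i => G w * expR (phi (partial_degree V w v) i)))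
    => [|i _]; last by rewrite mulrC.
  by rewrite binomial_meanZ ler_piMr ?expR_ge0 ?mgf_le.
move=> u; rewrite mem_enum inE => uV w'.
have vu : v != u by apply: contraNneq uV => <-.
have row_v : insensitive (partial_degree V ^~ v) (edge_index v u).
  apply: insensitive_partial_degree => y yV vy; rewrite edge_index_neq // xpair_eqE.
    by rewrite negb_and (_ : y != u) ?orbT //; apply: contraNneq uV => <-.
  by rewrite (negbTE vu).
have row_x S x : x \in s -> insensitive (partial_degree S ^~ x) (edge_index v u).
  move=> xs; have xv : x != v by apply: contraNneq vs => <-.
  have xu : x != u by apply: contraNneq uV => <-; exact: sV.
  apply: insensitive_partial_degree => y _ xy.
  by rewrite edge_index_neq // xpair_eqE negb_and ?xv ?xu.
rewrite row_v; congr (_, expR _); apply: eq_big_seq => x xs.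
by rewrite /row !row_x.
Qed.

End RowResampling.

Section Discrepancy.
Variables (R : realType) (n : nat) (p : R).
Hypothesis p01 : 0 <= p <= 1.
Local Notation coord := ('I_n * 'I_n)%type.
Local Notation edge_prob := (@edge_prob R n p).
Implicit Types (w : {set coord}) (u v : 'I_n) (X Y : {set 'I_n}) (t b : R).

Definition edge_variance : R := p * (1 - p).

Lemma edge_variance_ge0 : 0 <= edge_variance.
Proof. by case/andP: p01 => *; rewrite mulr_ge0 // subr_ge0. Qed.

Lemma edge_variance_le : edge_variance <= 1 / 4.
Proof. by have := sqr_ge0 (p - 1 / 2); rewrite /edge_variance; lra. Qed.

Definition discrepancy w X Y : R := \sum_(u in X) \sum_(v in Y) centered_adj p w u v.

Lemma discrepancyE w X Y :
  discrepancy w X Y = bilin (centered_adj p w) (indicator R X) (indicator R Y).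
Proof. by rewrite bilin_indicator. Qed.

Lemma discrepancy_row w X : discrepancy w X setT = \sum_(v in X) centered_degree p w v.
Proof. by apply: eq_bigr => v _; apply: eq_bigl => u; rewrite inE. Qed.

Lemma linear_stat_indicator X Y l w :
  linear_stat p (fun u v => l * (indicator R X u * indicator R Y v)) w = l * discrepancy w X Y.
Proof. by rewrite linear_statZ discrepancyE. Qed.

Lemma failure_prob_linear_stat (J : finType) (c : J -> 'I_n -> 'I_n -> R) (V : J -> R) t b :
    (forall j u v, `|c j u v + c j v u| <= 1 / 3) ->
    (forall j, 2 * edge_variance * \sum_u \sum_v c j u v ^+ 2 <= V j) ->
    2 * #|J|%:R <= expR b ->
  failure_prob edge_prob (fun w => forall j, `|linear_stat p (c j) w| <= V j + (t + b))
  <= expR (- t).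
Proof.
move=> c_le V_ge cardJ; pose centered (sign : R) j w := sign * linear_stat p (c j) w - V j.
have mgf_le (sign : R) j : sign ^+ 2 = 1 -> expect edge_prob (fun w => expR (centered sign j w)) <= 1.
  move=> sign_sqr; have sign_norm : `|sign| = 1.
    by apply/eqP; rewrite -(@eqrXn2 _ 2) // real_normK ?num_real // expr1n sign_sqr.
  have signed_le u v : `|sign * c j u v + sign * c j v u| <= 1 / 3.
    by rewrite -mulrDr normrM sign_norm (mul1r `|_|).
  apply: (@le_trans _ _ (expR (- V j)
      * expect edge_prob (fun w => expR (linear_stat p (fun u v => sign * c j u v) w)))).
    rewrite -expectZl; apply: expect_le => [|w]; first exact: edge_prob01.
    by rewrite /centered addrC expRD linear_statZ.
  apply: le_trans (ler_wpM2l (expR_ge0 _) (expect_expR_linear_stat_le p01 signed_le)) _.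
  rewrite -expRD -[leRHS]expR0 ler_expR addrC subr_le0; apply: le_trans (V_ge j).
  under eq_bigr => u _ do under eq_bigr => v _ do rewrite exprMn sign_sqr mul1r.
  exact: lexx.
apply: le_trans (failure_prob_mono (edge_prob01 p01) _)
  (@failure_prob_chernoff2 _ _ _ (edge_prob01 p01) _ (centered 1) (centered (-1)) t b cardJ _ _).
- move=> w centered_le j; have [] := centered_le j; rewrite /centered ler_norml => ? ?.
  by apply/andP; lra.
- by move=> j; apply: mgf_le; rewrite expr1n.
- by move=> j; apply: mgf_le; rewrite sqrrN expr1n.
Qed.

Lemma sum_sqr_indicator X Y l :
  \sum_u \sum_v (l * (indicator R X u * indicator R Y v)) ^+ 2 = l ^+ 2 * (#|X|%:R * #|Y|%:R).
Proof.
rewrite -!(sum_indicator R) mulr_suml mulr_sumr; apply: eq_bigr => u _.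
rewrite !mulr_sumr; apply: eq_bigr => v _.
by rewrite !exprMn !indicator_sqr.
Qed.

Lemma failure_prob_discrepancy (J : finType) (X Y : J -> {set 'I_n}) (x t b : R) :
    6 <= x -> 2 * #|J|%:R <= expR b ->
  failure_prob edge_prob (fun w => forall j, `|discrepancy w (X j) (Y j)|
      <= 2 * edge_variance * (#|X j|%:R * #|Y j|%:R) / x + x * (t + b))
  <= expR (- t).
Proof.
move=> x_ge6 cardJ; pose l := x^-1; have x_gt0 : 0 < x by lra.
have l_gt0 : 0 < l by rewrite invr_gt0.
have l_le : l <= 1 / 6 by rewrite div1r lef_pV2 ?posrE //; lra.
pose c j u v := l * (indicator R (X j) u * indicator R (Y j) v).
pose V j := l * (2 * edge_variance * (#|X j|%:R * #|Y j|%:R) / x).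
apply: le_trans (failure_prob_mono (edge_prob01 p01) _)
  (@failure_prob_linear_stat J c V t b _ _ cardJ).
- move=> w lin_le j; have := lin_le j; rewrite linear_stat_indicator normrM gtr0_norm //.
  by rewrite -[X in _ -> is_true X](ler_pM2l l_gt0) mulrDr mulKf ?gt_eqF.
- move=> j u v; rewrite /c -mulrDr normrM (gtr0_norm l_gt0).
  apply: (@le_trans _ _ (1 / 6 * (1 + 1))); last by lra.
  apply: ler_pM => //; first exact: ltW.
  apply: le_trans (ler_normD _ _) _.
  by apply: lerD; rewrite normrM mulr_ile1 // indicator_norm_le.
by move=> j; rewrite sum_sqr_indicator /V /l le_eqVlt; apply/orP; left; apply/eqP; field; rewrite gt_eqF.
Qed.

End Discrepancy.

Section DegreeStatistics.
Variables (R : realType) (n : nat) (p : R).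
Hypothesis p01 : 0 <= p <= 1.
Local Notation coord := ('I_n * 'I_n)%type.
Local Notation edge_prob := (@edge_prob R n p).
Implicit Types (w : {set coord}) (v : 'I_n).

Lemma failure_prob_bounded_diff (J : finType) (F : J -> {set coord} -> R) (t b : R) :
    (0 < n)%N -> (forall j e w, `|F j (e |: w) - F j (w :\ e)| <= 2) -> 2 * #|J|%:R <= expR b ->
  failure_prob edge_prob (fun w => forall j,
    `|F j w - expect edge_prob (F j)| <= 6 * n%:R * (1 + (t + b)))
  <= expR (- t).
Proof.
move=> n_gt0 F_diff cardJ; have n_ge1 : 1 <= n%:R :> R by rewrite ler1n.
pose l : R := (6 * n%:R)^-1; have l_gt0 : 0 < l by rewrite invr_gt0; lra.
have l_le : l <= 1 / 6 by rewrite div1r lef_pV2 ?posrE; lra.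
pose centered (sign : R) j w := sign * (F j w - expect edge_prob (F j)) - 1.
have mgf_le sign j : `|sign| = l -> expect edge_prob (fun w => expR (centered sign j w)) <= 1.
  move=> sign_norm; have centered_diff e w :
      `|centered sign j (e |: w) - centered sign j (w :\ e)| <= 2 * l.
    rewrite (_ : _ - _ = sign * (F j (e |: w) - F j (w :\ e))); last by rewrite /centered; ring.
    by rewrite normrM sign_norm mulrC ler_wpM2r ?(ltW l_gt0).
  have two_l_le : 2 * l <= 1 / 3 by lra.
  have := expect_expR_bounded_diff (edge_prob01 p01) centered_diff (fun=> two_l_le).
  move/le_trans; apply; rewrite (_ : expect edge_prob (centered sign j) = -1); last first.
    transitivity (expect edge_prob (fun w => sign * F j w + (- (sign * expect edge_prob (F j)) - 1))).
      by apply: eq_expect => w; rewrite /centered; ring.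
    by rewrite expectD expectZl expect_cst; ring.
  rewrite -[leRHS]expR0 ler_expR addrC subr_le0.
  apply: (@le_trans _ _ (\sum_(e : coord) 1 / 4 * (2 * l) ^+ 2)).
    by apply: ler_sum => e _; rewrite ler_wpM2r ?sqr_ge0 ?edge_variance_le.
  rewrite sumr_const card_prod card_ord -[_ *+ _]mulr_natl natrM.
  suff -> : n%:R * n%:R * (1 / 4 * (2 * l) ^+ 2) = 1 / 36 :> R by lra.
  by rewrite /l; field; rewrite gt_eqF //; lra.
apply: le_trans (failure_prob_mono (edge_prob01 p01) _)
  (@failure_prob_chernoff2 _ _ _ (edge_prob01 p01) _ (centered l) (centered (- l)) t b cardJ _ _).
- move=> w centered_le j; have [upper lower] := centered_le j; rewrite /centered in upper lower.
  rewrite mulrC -ler_pdivrMr; last by lra.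
  rewrite -[_^-1]/l -[X in _ * X](ger0_norm (ltW l_gt0)) -normrM mulrC ler_norml.
  by apply/andP; lra.
- by move=> j; rewrite mgf_le // ger0_norm // ltW.
- by move=> j; rewrite mgf_le // normrN ger0_norm // ltW.
Qed.

Lemma failure_prob_soft_threshold (m : nat) (t b : R) : (0 < n)%N ->
    m%:R <= n.-1%:R * p -> n.-1%:R * p < m%:R + 1 -> 2 * n.+1%:R <= expR b ->
  failure_prob edge_prob (fun w => forall i : 'I_n.+1,
    `|\sum_v soft_threshold i%:R ((degree w v)%:R - m%:R)|
      <= 4 * n%:R + 6 * n%:R * (1 + (t + b)))
  <= expR (- t).
Proof.
move=> n_gt0 m_le m_gt cardJ.
pose F (i : 'I_n.+1) w : R := \sum_v soft_threshold i%:R ((degree w v)%:R - m%:R).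
have expect_F i : `|expect edge_prob (F i)| <= 4 * n%:R.
  rewrite /F expect_sum (eq_bigr (fun=> binomial_mean n.-1 p
    (fun d => soft_threshold i%:R (d%:R - m%:R)))) => [|v _].
    by rewrite sumr_ord_const normrM ger0_norm // mulrC ler_wpM2r // binomial_mean_soft_le.
  exact: (expect_degree p (fun d => soft_threshold i%:R (d%:R - m%:R))).
have F_diff i e w : `|F i (e |: w) - F i (w :\ e)| <= 2.
  rewrite /F -sumrB; apply: le_trans (ler_norm_sum _ _ _) _.
  apply: le_trans (sum_degree_toggle_le p e w); apply: ler_sum => v _.
  apply: le_trans (soft_threshold_lipschitz _ _ (ler0n R i)) _.
  by rewrite opprB addrA subrK ger0_norm // subr_ge0 ler_nat degree_toggle_le.
apply: le_trans (failure_prob_mono (edge_prob01 p01) _)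
  (failure_prob_bounded_diff (b := b) t n_gt0 F_diff _); last by rewrite card_ord.
move=> w dev_le i; rewrite -[X in `|X|](subrKC (expect edge_prob (F i))).
by apply: le_trans (ler_normD _ _) _; apply: lerD; [exact: expect_F|exact: dev_le].
Qed.

Lemma failure_prob_degree_count (V : {set 'I_n}) (K r s k k' t b : R) : 16 * 12 ^+ 4 <= K ->
    0 < p < 1 -> 1 <= s -> s ^+ 2 = #|~: V|%:R * p * (1 - p) -> 1 <= r ->
    k = 6 * K * r / s -> k' = 3 * K * (r ^+ 3)^-1 / s -> k <= 1 / 3 ->
    2 * n%:R <= expR b ->
  failure_prob edge_prob (fun w => forall j : 'I_n,
    \sum_(v in V) ((degree w v == j)%:R - k * (j <= degree w v)%N%:R - k') <= t + b /\
    \sum_(v in V) ((degree w v == j)%:R - k * (degree w v <= j)%N%:R - k') <= t + b)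
  <= expR (- t).
Proof.
move=> K_ge p01' s_ge1 s_sqr r_ge1 k_eq k'_eq k_le cardJ.
apply: failure_prob_chernoff2; rewrite ?card_ord //; first exact: edge_prob01.
  move=> j; under eq_expect do under eq_bigr do rewrite (degree_partial V).
  apply: (expect_expR_rows p01 (phi := fun m l =>
    (m + l == j)%N%:R - k * (j <= m + l)%N%:R - k')) => m.
  exact: (binomial_mgf_point_above K_ge p01' s_ge1 s_sqr r_ge1 k_eq k'_eq k_le).
move=> j; under eq_expect do under eq_bigr do rewrite (degree_partial V).
apply: (expect_expR_rows p01 (phi := fun m l =>
  (m + l == j)%N%:R - k * (m + l <= j)%N%:R - k')) => m.
exact: (binomial_mgf_point_below K_ge p01' s_ge1 s_sqr r_ge1 k_eq k'_eq k_le).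
Qed.

End DegreeStatistics.

Section SwitchingEvents.
Variables (R : realType) (n : nat) (p : R).
Hypothesis p01 : 0 <= p <= 1.
Local Notation coord := ('I_n * 'I_n)%type.
Local Notation edge_prob := (@edge_prob R n p).
Implicit Types (w : {set coord}) (a b : 'I_n).

Definition few_disagreements (M : nat) w :=
  forall a b, (#|[set c | adj w a c != adj w b c]| <= M)%N.

Lemma expect_switching_average_le (J : finType) (M : nat) (H : J -> {ffun 'I_n -> nat} -> R)
    (lam : R) (X Y : J -> {ffun 'I_n -> nat} -> {set 'I_n}) :
    (0 < n)%N -> (0 < M)%N -> (forall j f, 0 <= H j f) ->
    (forall f, \sum_j H j f <= 1) -> `|lam| <= 1 / 3 ->
  expect edge_prob (fun w => \sum_j
    (H j (degree_seq w) / 2 * expR (switching_exponent M lam (X j) (Y j) w)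
     + H j (degree_seq w) / 2 * expR (switching_exponent M (- lam) (X j) (Y j) w))) <= 1.
Proof.
move=> n_gt0 M_gt0 H_ge0 H_le1 lam_le.
rewrite expect_sum; apply: (@le_trans _ _ (\sum_j expect edge_prob (fun w => H j (degree_seq w)))).
  apply: ler_sum => j _; rewrite expectD.
  have half_ge0 f : 0 <= H j f / 2 by rewrite divr_ge0.
  have half_le (l : R) : `|l| <= 1 / 3 ->
      expect edge_prob (fun w => H j (degree_seq w) / 2 * expR (switching_exponent M l (X j) (Y j) w))
      <= 2^-1 * expect edge_prob (fun w => H j (degree_seq w)).
    move=> l_le; rewrite -expectZl; under [leRHS]eq_expect do rewrite mulrC.
    exact: (expect_expR_switching_exponent p01 n_gt0 M_gt0 (X j) (Y j) l_le half_ge0).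
  by have := half_le lam; have := half_le (- lam); rewrite normrN; lra.
rewrite -expect_sum -[leRHS](expect_cst edge_prob).
by apply: expect_le => [|w]; [exact: edge_prob01|exact: H_le1].
Qed.

Lemma failure_prob_switching (J : finType) (M : nat) (H : J -> {ffun 'I_n -> nat} -> R)
    (lam : R) (X Y : J -> {ffun 'I_n -> nat} -> {set 'I_n}) (t : R) :
    (0 < n)%N -> (0 < M)%N -> (forall j f, 0 <= H j f) ->
    (forall f, \sum_j H j f <= 1) -> 0 <= lam <= 1 / 3 ->
  failure_prob edge_prob (fun w => few_disagreements M w ->
    forall j (e : R), expR (- e) <= H j (degree_seq w) / 2 ->
    lam * `|switching_stat R w (X j (degree_seq w)) (Y j (degree_seq w))|
    - lam ^+ 2 * switching_energy R w (X j (degree_seq w)) (Y j (degree_seq w))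
      <= 16 * n%:R * M%:R * (t + e))
  <= expR (- t).
Proof.
move=> n_gt0 M_gt0 H_ge0 H_le1 /andP[lam_ge0 lam_le].
pose Phi (s : R) j := switching_exponent M s (X j) (Y j).
pose h w : R := \sum_j (H j (degree_seq w) / 2 * expR (Phi lam j w)
  + H j (degree_seq w) / 2 * expR (Phi (- lam) j w)).
apply: (failure_prob_markov (edge_prob01 p01) (h := h)).
- by move=> w; apply: sumr_ge0 => j _; rewrite addr_ge0 // mulr_ge0 ?divr_ge0 ?expR_ge0.
- by apply: expect_switching_average_le => //; rewrite ger0_norm.
move=> w sum_le few j e weight_ge.
have nM_gt0 : 0 < 16 * n%:R * M%:R :> R by rewrite !mulr_gt0 // ltr0n.
have exponent_le s : H j (degree_seq w) / 2 * expR (Phi s j w) <= expR t ->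
    Phi s j w <= t + e.
  move=> le_t; rewrite -ler_expR expRD.
  have := le_trans (ler_wpM2r (expR_ge0 (Phi s j w)) weight_ge) le_t.
  by rewrite expRN mulrC ler_pdivrMr ?expR_gt0.
have term_ge0 s i : 0 <= H i (degree_seq w) / 2 * expR (Phi s i w).
  by rewrite mulr_ge0 ?divr_ge0 ?expR_ge0.
have both_le : H j (degree_seq w) / 2 * expR (Phi lam j w)
    + H j (degree_seq w) / 2 * expR (Phi (- lam) j w) <= expR t.
  apply: le_trans sum_le; rewrite /h (bigD1 j) //= lerDl; apply: sumr_ge0 => i _.
  by rewrite addr_ge0.
have bound s : H j (degree_seq w) / 2 * expR (Phi s j w) <= expR t ->
    s * switching_stat R w (X j (degree_seq w)) (Y j (degree_seq w))
    - s ^+ 2 * switching_energy R w (X j (degree_seq w)) (Y j (degree_seq w))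
    <= 16 * n%:R * M%:R * (t + e).
  move=> /exponent_le; have := switching_exponent_ge n_gt0 M_gt0 s (X j) (Y j) few.
  by move=> exponent_ge /(le_trans exponent_ge); rewrite ler_pdivrMr // (mulrC (t + e)).
have := term_ge0 lam j; have := term_ge0 (- lam) j => minus_ge0 plus_ge0.
have [stat_ge0|stat_lt0] := leP 0 (switching_stat R w (X j (degree_seq w)) (Y j (degree_seq w))).
  by rewrite ger0_norm // bound //; lra.
by rewrite ltr0_norm // mulrN -mulNr -(sqrrN lam) bound //; lra.
Qed.

End SwitchingEvents.

(** * Trimmed sums *)

Section LargestElements.
Variables (R : realFieldType) (V : finType).
Implicit Types (f x : V -> R) (T U B : {set V}) (u v : V).

Definition is_top f T := forall u v, u \in T -> v \notin T -> f v <= f u.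

Lemma ex_notin T : (#|T| < #|V|)%N -> exists v, v \notin T.
Proof.
rewrite -(cardsC T) -[X in (X < _)%N]addn0 ltn_add2l => /card_gt0P[v].
by rewrite inE; exists v.
Qed.

Lemma top_threshold f T : (#|T| < #|V|)%N -> is_top f T -> exists2 v, v \notin T &
  {in ~: T, forall u, f u <= f v} /\ {in T, forall u, f v <= f u}.
Proof.
move=> /ex_notin[v1 v1T] topT; exists [arg max_(v > v1 | v \notin T) f v]%O; first by case: arg_maxP.
case: arg_maxP => // v vT v_max.
by split=> u; rewrite ?inE => uT; [exact: v_max|exact: topT].
Qed.

Lemma card_setD_sym T U : #|T| = #|U| -> #|T :\: U| = #|U :\: T|.
Proof. by move=> cardTU; apply/eqP; rewrite -(eqn_add2l #|T :&: U|) cardsID setIC cardsID cardTU. Qed.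

Lemma sum_sub_setD f T U : \sum_(v in T) f v - \sum_(v in U) f v
  = \sum_(v in T :\: U) f v - \sum_(v in U :\: T) f v.
Proof. by rewrite (big_setID U) [X in _ - X](big_setID T) /= setIC; ring. Qed.

Lemma sum_le_top f T U : #|T| = #|U| -> (#|T| < #|V|)%N -> is_top f T ->
  \sum_(v in U) f v <= \sum_(v in T) f v.
Proof.
move=> cardTU cardT topT; have [v0 _ [v0_max v0_min]] := top_threshold cardT topT.
rewrite -subr_ge0 sum_sub_setD subr_ge0.
apply: (@le_trans _ _ (\sum_(v in U :\: T) f v0)).
  by apply: ler_sum => v; rewrite inE => /andP[vT _]; apply: v0_max; rewrite inE.
rewrite sumr_const -card_setD_sym // -sumr_const.
by apply: ler_sum => v; rewrite inE => /andP[_ vT]; exact: v0_min.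
Qed.

Lemma sum_card_le T B f (c k w e : R) :
    0 <= w -> 0 <= e -> #|T|%:R <= k -> #|B|%:R <= w ->
    {in T :\: B, forall v, f v <= c + w} -> {in T :&: B, forall v, f v <= c + w + e} ->
  \sum_(v in T) f v <= #|T|%:R * c + k * w + w * e.
Proof.
move=> w_ge0 e_ge0 cardT cardB f_outside f_inside.
rewrite (big_setID B) /=.
apply: le_trans (lerD (ler_sum _ f_inside) (ler_sum _ f_outside)) _; rewrite !sumr_const.
have -> : (c + w + e) *+ #|T :&: B| + (c + w) *+ #|T :\: B|
    = #|T|%:R * c + #|T|%:R * w + #|T :&: B|%:R * e.
  by rewrite -(cardsID B T) natrD -[(c + w + e) *+ _]mulr_natl -[(c + w) *+ _]mulr_natl; ring.
have cardI : #|T :&: B|%:R <= w by apply: le_trans cardB; rewrite ler_nat subset_leq_card ?subsetIr.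
by rewrite lerD ?ler_wpM2r // lerD2l ler_wpM2r.
Qed.

End LargestElements.

Section Exchange.
Variables (R : realFieldType) (V : finType) (f g : V -> R) (B T U : {set V}) (mu eta w : R).
Hypotheses (w_ge0 : 0 <= w) (eta_ge0 : 0 <= eta) (cardB : #|B|%:R <= w)
  (cardT_ge : w <= #|T|%:R) (cardT_lt : #|T|%:R + w < #|V|%:R)
  (f_near : forall v, `|f v - mu| <= eta) (gf_near : forall v, v \notin B -> `|g v - f v| <= w)
  (topT : is_top g T).

Let cardT : (#|T| < #|V|)%N.
Proof. by rewrite -(ltr_nat R); apply: le_lt_trans cardT_lt; rewrite lerDl. Qed.

Let g_near v : v \notin B -> `|g v - mu| <= eta + w.
Proof.
move=> vB; have := gf_near vB; have := f_near v; rewrite !ler_norml => /andP[? ?] /andP[? ?].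
by apply/andP; lra.
Qed.

Lemma threshold_near v0 : v0 \notin T -> {in ~: T, forall v, g v <= g v0} ->
    {in T, forall u, g v0 <= g u} ->
  `|g v0 - mu| <= eta + w.
Proof.
move=> v0T v0_max v0_min.
have [v vT vB] : exists2 v, v \notin T & v \notin B.
  have /ex_notin[v] : (#|T :|: B| < #|V|)%N.
    rewrite -(ltr_nat R); apply: le_lt_trans cardT_lt; apply: (@le_trans _ _ (#|T| + #|B|)%:R).
      by rewrite ler_nat leq_card_setU.
    by rewrite natrD lerD2l.
  by rewrite inE negb_or => /andP[? ?]; exists v.
have v_le : g v <= g v0 by rewrite v0_max ?inE.
have lower : mu - (eta + w) <= g v0.
  by apply: le_trans v_le; have := g_near vB; rewrite ler_norml => /andP[? ?]; lra.
have upper : g v0 <= mu + (eta + w).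
  have [TB|/subsetPn[u uT uB]] := boolP (T \subset B).
    have TB_eq : T = B.
      by apply/eqP; rewrite eqEcard TB -(ler_nat R) (le_trans cardB).
    by have := g_near (_ : v0 \notin B); rewrite -TB_eq ler_norml => /(_ v0T) /andP[? ?]; lra.
  by apply: le_trans (v0_min u uT) _; have := g_near uB; rewrite ler_norml => /andP[? ?]; lra.
by rewrite ler_norml; apply/andP; split; lra.
Qed.

Lemma top_exchange : #|U| = #|T| -> is_top f U ->
  `|\sum_(v in T) f v - \sum_(v in U) f v| <= 2 * #|T|%:R * w + 4 * w * (eta + w).
Proof.
move=> cardUT topU; have [v0 v0T [v0_max v0_min]] := top_threshold cardT topT.
have := threshold_near v0T v0_max v0_min; set b := g v0 in v0_max v0_min * => b_near.
rewrite distrC ger0_norm ?subr_ge0 ?sum_le_top ?cardUT //.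
have e_ge0 : 0 <= 2 * (eta + w) by rewrite mulr_ge0 // addr_ge0.
have f_le_b v : f v <= b + w + 2 * (eta + w) /\ - f v <= - b + w + 2 * (eta + w).
  have := f_near v; move: b_near w_ge0; rewrite !ler_norml => /andP[? ?] ? /andP[? ?].
  by split; lra.
have U_le : \sum_(v in U :\: T) f v <= #|U :\: T|%:R * b + #|T|%:R * w + w * (2 * (eta + w)).
  apply: (sum_card_le (B := B)) => //.
  - by rewrite ler_nat -cardUT subset_leq_card ?subsetDl.
  - move=> v; rewrite !inE => /and3P[vB vT _]; have := gf_near vB; rewrite ler_norml => /andP[? ?].
    by have := v0_max v; rewrite inE => /(_ vT); lra.
  - by move=> v _; have [] := f_le_b v.
have T_ge : \sum_(v in T :\: U) (- f v) <= #|T :\: U|%:R * - b + #|T|%:R * w + w * (2 * (eta + w)).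
  apply: (sum_card_le (B := B)) => //.
  - by rewrite ler_nat subset_leq_card ?subsetDl.
  - move=> v; rewrite !inE => /and3P[vB _ vT]; have := gf_near vB; rewrite ler_norml => /andP[? ?].
    by have := v0_min v vT; lra.
  - by move=> v _; have [] := f_le_b v.
rewrite sumrN (card_setD_sym (esym cardUT)) in T_ge.
by rewrite sum_sub_setD; lra.
Qed.

End Exchange.

Section TrimmedSums.
Variables (R : realFieldType) (V : finType).
Implicit Types (x : V -> R) (T L : {set V}).

Lemma sum_le_excess x T (t : R) :
  \sum_(v in T) x v <= #|T|%:R * t + \sum_v Num.max (x v - t) 0.
Proof.
apply: (@le_trans _ _ (\sum_(v in T) (t + Num.max (x v - t) 0))).
  by apply: ler_sum => v _; rewrite -lerBlDl le_max lexx.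
rewrite big_split /= sumr_const mulr_natl lerD2l big_mkcond /=.
by apply: ler_sum => v _; case: ifP => // _; rewrite le_max lexx orbT.
Qed.

Lemma sum_top_excess x T v0 : {in ~: T, forall v, x v <= x v0} -> {in T, forall u, x v0 <= x u} ->
  \sum_(v in T) x v = #|T|%:R * x v0 + \sum_v Num.max (x v - x v0) 0.
Proof.
move=> v0_max v0_min.
rewrite [X in _ = _ + X](bigID (mem T)) /= [X in _ = _ + (_ + X)]big1 ?addr0; last first.
  by move=> v vT; rewrite max_r // subr_le0 v0_max ?inE.
rewrite mulr_natl -sumr_const -big_split /=.
by apply: eq_bigr => v vT; rewrite max_l ?subr_ge0 ?v0_min // addrC subrK.
Qed.

(* Both sums are written with the threshold of one of them; the excesses then
   combine into a sum of soft thresholds. *)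
Lemma trimmed_sum_le x T L (F : R) : #|T| = #|L| -> (#|T| < #|V|)%N ->
    is_top x T -> is_top (fun v => - x v) L ->
    (forall v, `|\sum_u soft_threshold `|x v| (x u)| <= F) -> `|\sum_v x v| <= F ->
  `|\sum_(v in T) x v + \sum_(v in L) x v| <= 3 * F.
Proof.
move=> cardTL cardT topT topL soft_le sum_le.
have F_ge0 : 0 <= F by apply: le_trans sum_le.
have signed_le t v : `|t| = `|x v| -> `|\sum_u soft_threshold t (x u)| <= 3 * F.
  move=> t_norm; have := soft_le v; rewrite -t_norm; have [t_ge0|t_lt0] := leP 0 t.
    by rewrite (ger0_norm t_ge0); lra.
  rewrite (ltr0_norm t_lt0) -{2}(opprK t) => soft_t_le.
  under eq_bigr => u _ do rewrite soft_threshold_neg.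
  rewrite sumrB -mulr_sumr; apply: le_trans (ler_normB _ _) _.
  by rewrite normrM ger0_norm //; lra.
have [v0 v0T [v0_max v0_min]] := top_threshold cardT topT.
have cardL : (#|L| < #|V|)%N by rewrite -cardTL.
have [v1 v1L [v1_max v1_min]] := top_threshold cardL topL.
have T_eq := sum_top_excess v0_max v0_min; have L_eq := sum_top_excess v1_max v1_min.
have L_le := sum_le_excess (fun v => - x v) L (x v0); have T_le := sum_le_excess x T (- x v1).
have := signed_le (x v0) v0 erefl; have := signed_le (- x v1) v1 (normrN _).
rewrite /soft_threshold !sumrB !ler_norml => /andP[_ upper] /andP[lower _].
rewrite !sumrN in L_eq L_le; rewrite cardTL in T_eq T_le.
by apply/andP; split; lra.
Qed.

End TrimmedSums.

Section SwitchingControl.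
Variables (R : realType) (n : nat) (p : R) (w : {set ('I_n * 'I_n)}).
Hypothesis p01 : 0 <= p <= 1.
Implicit Types (X Y S : {set 'I_n}) (a b c d u v : 'I_n).
Local Notation W := (centered_adj p w).
Local Notation indicator := (@indicator R n).

Lemma sum_kernel_apply_norm_le (k : 'I_n -> 'I_n -> R) (c : R) S :
    (forall X Y, `|bilin k (indicator X) (indicator Y)| <= c) ->
  \sum_a `|kernel_apply k (indicator S) a| <= 2 * c.
Proof.
move=> cut_le; pose P := [set a | 0 <= kernel_apply k (indicator S) a].
have -> : \sum_a `|kernel_apply k (indicator S) a|
    = bilin k (indicator P) (indicator S) - bilin k (indicator (~: P)) (indicator S).
  rewrite !bilinE -sumrB; apply: eq_bigr => a _; rewrite /P.
  rewrite [in X in X * _ - _]/indicator [in X in _ - X * _]/indicator !inE.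
  by have [ge0|lt0] := leP 0 (kernel_apply k _ a); 
    [rewrite ger0_norm|rewrite ltr0_norm] => //; rewrite /= ?mulr1n ?mulr0n; ring.
have := cut_le P S; have := cut_le (~: P) S.
by rewrite !ler_norml => /andP[? ?] /andP[? ?]; lra.
Qed.

Lemma switching_stat_centered_bilin X Y (Lam : R) :
    (forall S, \sum_a `|kernel_apply W (indicator S) a| <= Lam) ->
  `|switching_stat R w X Y
    - edge_variance p * n%:R ^+ 2 * centered_bilin W (indicator X) (indicator Y)|
  <= 6 * Lam ^+ 2 + 8 * (n%:R ^+ 3 * edge_variance p + n%:R * Lam).
Proof.
move=> image_le; have Lam_ge0 : 0 <= Lam by apply: le_trans (image_le set0); exact: sumr_ge0.
have rows_le : \sum_a `|row_sum W a| <= Lam.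
  apply: le_trans (image_le setT); apply: ler_sum => a _; rewrite /kernel_apply.
  by under eq_bigr => c _ do rewrite /indicator inE mulr1.
have := sum4_not_coincident_le p01 (centered_adjC p w) (centered_adj_norm_le p01 w)
  Lam_ge0 rows_le (centered_adj_shift01 p01 w) (indicator_norm_le R X) (indicator_norm_le R Y)
  (image_le X) (image_le Y).
congr (`|_ - _| <= _); apply: eq_sum4 => a b c d.
have [|nc] := boolP (coincident a b c d); first by rewrite /= !(mul0r, mulr0).
by rewrite (@switching_value_poly R n w p) //=; ring.
Qed.

Lemma switching_energy_le (k : 'I_n -> 'I_n -> R) (D : R) X Y :
    (forall u v, k u v = k v u) -> (forall u v, 0 <= k u v) -> (forall u, row_sum k u <= D) ->
    (forall a b c d, switching_value R w a b c d ^+ 2 <= k a c * k b d + k a d * k b c) ->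
  switching_energy R w X Y <= bilin k (indicator X) (indicator Y) * (n%:R * D)
                              + #|X|%:R * #|Y|%:R * D ^+ 2.
Proof.
move=> kC k_ge0 rows_le value_le.
have rows_ge0 u : 0 <= row_sum k u by exact: sumr_ge0.
have ind_ge0 S a : 0 <= indicator S a by have /andP[] := indicator01 R S a.
apply: (@le_trans _ _ (sum4 (fun a b c d => indicator X a * indicator Y c * (k a c * k b d)
    + indicator X a * indicator Y c * (k a d * k b c)))).
  apply: ler_sum4 => a b c d; rewrite -mulrDr -mulrA; do 2! apply: ler_wpM2l => //.
  by apply: le_trans (value_le a b c d); rewrite ler_piMl ?sqr_ge0 // lern1 leq_b1.
rewrite sum4D sum4_ac_bd // sum4_ad_bc //; apply: lerD.
  apply: ler_wpM2l.
    by rewrite bilinE; apply: sumr_ge0 => a _; rewrite mulr_ge0 // sumr_ge0 // => c _; rewrite mulr_ge0.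
  by rewrite -sumr_ord_const; apply: ler_sum => b _.
have weighted_rows S : 0 <= \sum_a indicator S a * row_sum k a <= #|S|%:R * D.
  rewrite sumr_ge0 => [|a _]; last by rewrite mulr_ge0.
  by rewrite -(sum_indicator R) mulr_suml; apply: ler_sum => a _; rewrite ler_wpM2l.
have /andP[X_ge0 X_le] := weighted_rows X; have /andP[Y_ge0 Y_le] := weighted_rows Y.
by rewrite expr2 mulrACA ler_pM.
Qed.

(* Switchings need two edges and two non-edges, so that their number is controlled by
   the sparser of the graph and its complement. *)
Definition sparse_adj u v : R := (if p <= 1 / 2 then adj w u v else ~~ adj w u v)%:R.

Lemma sparse_adjC u v : sparse_adj u v = sparse_adj v u.
Proof. by rewrite /sparse_adj adjC. Qed.

Lemma sparse_adj_ge0 u v : 0 <= sparse_adj u v.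
Proof. exact: ler0n. Qed.

Lemma switching_value_sqr_le a b c d : switching_value R w a b c d ^+ 2
  <= sparse_adj a c * sparse_adj b d + sparse_adj a d * sparse_adj b c.
Proof.
rewrite /sparse_adj /switching_value; case: (p <= 1 / 2);
  case: (adj w a c); case: (adj w b d); case: (adj w a d); case: (adj w b c);
  by rewrite /= ?sqrrN ?expr1n ?expr0n /= ?mulr1n ?mulr0n; lra.
Qed.

Lemma sparse_adj_le : exists2 sign : R, `|sign| = 1 &
  forall u v, sparse_adj u v <= 2 * edge_variance p + sign * W u v + (u == v)%:R.
Proof.
have /andP[p_ge0 p_le1] := p01; have v_ge0 := edge_variance_ge0 p01.
rewrite /sparse_adj /centered_adj /adj; have [p_le|p_gt] := leP p (1 / 2).
  exists 1 => [|u v]; first exact: normr1.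
  have : 0 <= p * (1 - 2 * p) by rewrite mulr_ge0 //; lra.
  by rewrite /edge_variance in v_ge0 *; case: eqVneq => _ /=; case: (edge_index u v \in w);
    rewrite /= ?mulr1n ?mulr0n; lra.
exists (-1) => [|u v]; first by rewrite normrN1.
have : 0 <= (1 - p) * (2 * p - 1) by rewrite mulr_ge0 //; lra.
by rewrite /edge_variance in v_ge0 *; case: eqVneq => _ /=; case: (edge_index u v \in w);
    rewrite /= ?mulr1n ?mulr0n; lra.
Qed.

Lemma bilin_sparse_adj_le X Y : bilin sparse_adj (indicator X) (indicator Y)
  <= 2 * edge_variance p * (#|X|%:R * #|Y|%:R) + `|discrepancy p w X Y| + n%:R.
Proof.
have [sign sign_norm sparse_le] := sparse_adj_le.
apply: (@le_trans _ _ (\sum_(a in X) \sum_(c in Y)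
    (2 * edge_variance p + sign * W a c + (a == c)%:R))).
  by rewrite bilin_indicator; apply: ler_sum => a _; apply: ler_sum.
under eq_bigr => a _ do rewrite !big_split /= sumr_const -mulr_sumr.
rewrite !big_split /= sumr_const -mulr_sumr -/(discrepancy p w X Y).
apply: lerD; first apply: lerD.
- by rewrite -[_ *+ _ *+ _]mulr_natl -[_ *+ #|Y|]mulr_natl; lra.
- by rewrite -[X in _ <= X]mul1r -sign_norm -normrM ler_norm.
rewrite -[X in _ <= X%:R]card_ord -sumr_const big_mkcond; apply: ler_sum => a _ /=.
case: ifP => // _; apply: (@le_trans _ _ (\sum_c (a == c)%:R)).
  by rewrite big_mkcond; apply: ler_sum => c _; case: ifP.
by rewrite (bigD1 a) //= eqxx big1 ?addr0 // => c /negbTE ca; rewrite eq_sym ca.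
Qed.

Variable sigma : R.
Hypotheses (n_gt0 : (0 < n)%N) (sigma_ge1 : 1 <= sigma)
  (sigma_sqr : sigma ^+ 2 = n%:R * edge_variance p)
  (cut_le : forall X Y, `|discrepancy p w X Y| <= 55 * n%:R * sigma)
  (degree_le : forall v, `|centered_degree p w v| <= sigma ^+ 2).

Let sigma_sqr_ge1 : 1 <= sigma ^+ 2.
Proof. by rewrite expr_ge1 // (le_trans ler01). Qed.

Lemma row_sum_sparse_adj_le u : row_sum sparse_adj u <= 4 * sigma ^+ 2.
Proof.
have [sign sign_norm sparse_le] := sparse_adj_le.
apply: le_trans (ler_sum _ (fun v _ => sparse_le u v)) _.
rewrite !big_split /= sumr_ord_const -mulr_sumr -/(centered_degree p w u).
rewrite (bigD1 u) //= eqxx big1 ?addr0 => [|v /negbTE vu]; last by rewrite eq_sym vu.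
have : sign * centered_degree p w u <= sigma ^+ 2.
  by apply: le_trans (ler_norm _) _; rewrite normrM sign_norm mul1r.
by have := sigma_sqr_ge1; rewrite mulrCA -sigma_sqr /=; lra.
Qed.

Definition switch_span : nat := (Num.truncn (8 * sigma ^+ 2)).+1.

Lemma switch_span_le : switch_span%:R <= 9 * sigma ^+ 2.
Proof.
have ? := sigma_sqr_ge1; have := truncn_le (8 * sigma ^+ 2).
rewrite (_ : 0 <= 8 * _); last by lra.
by rewrite /switch_span -natr1; lra.
Qed.

Lemma few_disagreements_switch_span : few_disagreements switch_span w.
Proof.
move=> a b; apply: leqW; rewrite truncn_ge_nat; last by have := sigma_sqr_ge1; lra.
apply: (@le_trans _ _ (row_sum sparse_adj a + row_sum sparse_adj b)); last first.
  by have := row_sum_sparse_adj_le a; have := row_sum_sparse_adj_le b; lra.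
rewrite -big_split -sum1_card natr_sum big_mkcond; apply: ler_sum => c _ /=.
rewrite inE /sparse_adj -natrD.
by case: (p <= 1 / 2); case: (adj w a c); case: (adj w b c).
Qed.

Lemma switching_stat_bias_le X Y : n%:R * sigma ^+ 2 * `|centered_bilin W (indicator X) (indicator Y)|
  <= `|switching_stat R w X Y| + 300 * 300 * n%:R * (n%:R * sigma ^+ 2).
Proof.
have n_ge1 : 1 <= n%:R :> R by rewrite ler1n.
have image_le S : \sum_a `|kernel_apply W (indicator S) a| <= 2 * (55 * n%:R * sigma).
  by apply: sum_kernel_apply_norm_le => X' Y'; rewrite -discrepancyE.
set Z := switching_stat R w X Y; set cb := centered_bilin _ _ _.
have -> : n%:R * sigma ^+ 2 * `|cb| = `|edge_variance p * n%:R ^+ 2 * cb|.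
  have -> : edge_variance p * n%:R ^+ 2 = n%:R * sigma ^+ 2 by rewrite sigma_sqr; ring.
  by rewrite normrM [`|_ * sigma ^+ 2|]ger0_norm // mulr_ge0 // sqr_ge0.
rewrite (_ : _ * cb = Z - (Z - edge_variance p * n%:R ^+ 2 * cb)); last by ring.
apply: le_trans (ler_normB _ _) _; apply: lerD => //.
apply: le_trans (switching_stat_centered_bilin X Y image_le) _.
have -> : n%:R ^+ 3 * edge_variance p = n%:R * n%:R * sigma ^+ 2 by rewrite sigma_sqr; ring.
have : n%:R * n%:R * sigma <= n%:R * (n%:R * sigma ^+ 2).
  by rewrite mulrA ler_wpM2l ?mulr_ge0 // expr2 ler_peMl //;
    have := sigma_ge1; lra.
have : 0 <= n%:R * (n%:R * sigma ^+ 2) by do 2! apply: mulr_ge0 => //; exact: sqr_ge0.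
lra.
Qed.

Lemma switching_energy_sparse_le X Y : switching_energy R w X Y
  <= n%:R * sigma ^+ 2 * (24 * edge_variance p * (#|X|%:R * #|Y|%:R)
                          + 4 * `|discrepancy p w X Y| + 4 * n%:R).
Proof.
have := switching_energy_le X Y sparse_adjC sparse_adj_ge0 row_sum_sparse_adj_le switching_value_sqr_le.
move/le_trans; apply; have nD_ge0 : 0 <= n%:R * (4 * sigma ^+ 2).
  by do 2! apply: mulr_ge0 => //; exact: sqr_ge0.
apply: le_trans (lerD (ler_wpM2r nD_ge0 (bilin_sparse_adj_le X Y)) (lexx _)) _.
have -> : (4 * sigma ^+ 2) ^+ 2 = 16 * sigma ^+ 2 * (n%:R * edge_variance p).
  by rewrite -sigma_sqr; ring.
by rewrite le_eqVlt; apply/orP; left; apply/eqP; ring.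
Qed.

Lemma centered_bilin_le_switching X Y (lam t : R) : 0 < lam -> 0 <= t ->
    lam * `|switching_stat R w X Y| - lam ^+ 2 * switching_energy R w X Y
      <= 16 * n%:R * switch_span%:R * t ->
  `|centered_bilin W (indicator X) (indicator Y)| <= 300 * 300 * n%:R
    + lam * (24 * edge_variance p * (#|X|%:R * #|Y|%:R) + 4 * `|discrepancy p w X Y| + 4 * n%:R)
    + 144 * t / lam.
Proof.
move=> lam_gt0 t_ge0 stat_le.
have n_ge1 : 1 <= n%:R :> R by rewrite ler1n.
have bias_le := switching_stat_bias_le X Y; have energy_le := switching_energy_sparse_le X Y.
set E := 24 * _ * _ + _ + _ in energy_le *; set A := n%:R * sigma ^+ 2 in bias_le energy_le *.
have A_gt0 : 0 < A by have := sigma_sqr_ge1; rewrite /A => ?; apply: mulr_gt0; lra.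
have span_le : 16 * n%:R * switch_span%:R * t <= 144 * A * t.
  have -> : 144 * A * t = 16 * n%:R * (9 * sigma ^+ 2) * t by rewrite /A; ring.
  by rewrite ler_wpM2r // ler_wpM2l ?switch_span_le // mulr_ge0.
have : `|switching_stat R w X Y| <= lam * A * E + 144 * A * t / lam.
  rewrite -(ler_pM2l lam_gt0) mulrDr (_ : lam * (lam * A * E) = lam ^+ 2 * (A * E)); last by ring.
  rewrite (_ : lam * (144 * A * t / lam) = 144 * A * t); last by field; rewrite gt_eqF.
  by have := ler_wpM2l (sqr_ge0 lam) energy_le; lra.
move=> stat_bound; rewrite -(ler_pM2l A_gt0).
have -> : A * (300 * 300 * n%:R + lam * E + 144 * t / lam)
    = 300 * 300 * n%:R * A + (lam * A * E + 144 * A * t / lam) by ring.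
by lra.
Qed.

End SwitchingControl.

Section LogBounds.
Variables (R : realType) (n : nat).
Hypothesis n_ge2 : (2 <= n)%N.
Local Notation N := (@GRing.natmul R 1 n).
Local Notation L := (ln N).

Lemma natr_ge2 : 2 <= N.
Proof. by rewrite (ler_nat R 2). Qed.

Lemma ln_natr_ge : 1 / 2 <= L.
Proof.
have N_ge2 := natr_ge2; rewrite -ler_expR lnK ?posrE; last by lra.
apply: le_trans N_ge2; have := expR_ge1Dx (- (1 / 2 : R)); rewrite expRN => inv_ge.
have half_ge : 1 / 2 <= (expR (1 / 2 : R))^-1 by lra.
by rewrite -[leLHS]invrK invf_ple ?posrE ?expR_gt0 //; lra.
Qed.

Lemma ln_natr_le : L <= N.
Proof. by have := @ln_sublinear R N; have := natr_ge2; lra. Qed.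

Lemma natr_le_mul_ln : N <= 2 * (N * L).
Proof. by have := @ler_wpM2l _ N _ (1 / 2) L; have := natr_ge2; have := ln_natr_ge; lra. Qed.

Lemma expR_mul_ln (a : nat) : expR (a%:R * L) = N ^+ a.
Proof. by rewrite expRM_natl lnK // posrE; have := natr_ge2; lra. Qed.

Lemma double_natr_le_expR : 2 * N <= expR (2 * L).
Proof. by rewrite (expR_mul_ln 2) expr2 ler_wpM2r ?natr_ge2. Qed.

Lemma double_natrS_le_expR : 2 * n.+1%:R <= expR (3 * L).
Proof.
have N_ge2 := natr_ge2; rewrite (expR_mul_ln 3) -natr1.
have sqr_ge : 2 * 2 <= N * N by apply: ler_pM.
have cube_ge : 2 * 2 * N <= N * N * N by apply: ler_wpM2r.
by rewrite -[N ^+ 3]/(N * (N * N)) mulrA; lra.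
Qed.

Lemma double_natr_sqr_le_expR : N ^+ 2 * 2 <= expR (3 * L).
Proof. by rewrite (expR_mul_ln 3) [leRHS]exprSr ler_wpM2l ?natr_ge2 ?sqr_ge0. Qed.

Lemma double_exp2_le_expR : 2 * (2 ^+ n * 2 ^+ n) <= expR (3 * N).
Proof.
have pow2_le : (2 : R) ^+ n <= expR N.
  rewrite -[N]mulr1 expRM_natl; apply: lerXn2r; rewrite ?nnegrE ?expR_ge0 //.
  exact: expR_ge2.
have := ler_pM _ _ pow2_le pow2_le; rewrite -expRD !exprn_ge0 // => /(_ isT isT) sqr_le.
apply: (@le_trans _ _ (expR N * expR (N + N))).
  by apply: ler_pM; rewrite ?mulr_ge0 ?exprn_ge0 // expR_ge2 //; have := natr_ge2; lra.
by rewrite -expRD ler_expR; lra.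
Qed.

(* [C(n, m) y^(-m) <= (1 + 1/y)^n] by the binomial theorem, and [y <= exp y]. *)
Lemma bin_le_expR (m : nat) (y : R) : 1 <= y -> 'C(n, m)%:R <= expR (N / y + m%:R * y).
Proof.
move=> y_ge1; have y_gt0 : 0 < y by lra.
have inv_ge0 : 0 <= y^-1 by rewrite invr_ge0 ltW.
have term_le : 'C(n, m)%:R * y^-1 ^+ m <= (1 + y^-1) ^+ n.
  have term_ge0 (i : 'I_n.+1) : 0 <= 1 ^+ (n - i) * y^-1 ^+ i *+ 'C(n, i) :> R.
    by rewrite mulrn_wge0 // mulr_ge0 ?exprn_ge0.
  rewrite exprDn; have [m_gt|m_le] := ltnP n m; first by rewrite bin_small // mul0r sumr_ge0.
  by rewrite (bigD1 (Ordinal (m_le : m < n.+1)%N)) //= expr1n mul1r mulr_natl lerDl sumr_ge0.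
have pow_le : (1 + y^-1) ^+ n <= expR (N / y).
  rewrite expRM_natl; apply: lerXn2r; rewrite ?nnegrE ?expR_ge0 ?addr_ge0 //.
  exact: expR_ge1Dx.
have powy_le : y ^+ m <= expR (m%:R * y).
  rewrite expRM_natl; apply: lerXn2r; rewrite ?nnegrE ?expR_ge0 ?(ltW y_gt0) //.
  by have := expR_ge1Dx y; lra.
rewrite expRD; apply: (@le_trans _ _ ('C(n, m)%:R * y^-1 ^+ m * y ^+ m)).
  by rewrite -mulrA -exprMn mulVf ?gt_eqF // expr1n mulr1.
by apply: ler_pM => //; rewrite ?mulr_ge0 ?exprn_ge0 ?(ltW y_gt0) //; exact: le_trans pow_le.
Qed.

End LogBounds.

Section CutEvents.
Variables (R : realType) (n : nat) (p : R).
Hypotheses (p01 : 0 <= p <= 1) (n_ge2 : (2 <= n)%N).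
Local Notation edge_prob := (@edge_prob R n p).
Local Notation N := (@GRing.natmul R 1 n).
Local Notation L := (ln N).
Implicit Types (X Y : {set 'I_n}).

Lemma failure_prob_discrepancy_total : failure_prob edge_prob (fun w =>
    `|discrepancy p w setT setT| <= 6 * N * (1 + (6 * L + 1)))
  <= expR (- (6 * L)).
Proof.
have N_ge2 := natr_ge2 R n_ge2.
apply: le_trans (failure_prob_mono (edge_prob01 p01) _) (failure_prob_discrepancy p01
  (J := unit) (fun=> setT) (fun=> setT) (6 * L) (x := 6 * N) (b := 1) _ _).
- move=> w /(_ tt); rewrite cardsT card_ord => /le_trans; apply; rewrite [leRHS]mulrDr mulr1 lerD2r.
  rewrite ler_pdivrMr; last by lra.
  apply: (@le_trans _ _ (2 * (1 / 4) * (N * N))); last by have := sqr_ge0 N; rewrite expr2; lra.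
  by rewrite ler_wpM2r ?mulr_ge0 // ler_wpM2l // edge_variance_le.
- lra.
- by rewrite card_unit mulr1 expR_ge2.
Qed.

Lemma failure_prob_centered_degree : failure_prob edge_prob (fun w =>
    forall v, `|centered_degree p w v| <= 60 * Num.sqrt (N * L))
  <= expR (- (6 * L)).
Proof.
have N_ge2 := natr_ge2 R n_ge2; have L_ge := ln_natr_ge R n_ge2; have L_le := ln_natr_le R n_ge2.
have NL_gt0 : 0 < N * L by rewrite mulr_gt0; lra.
set s := Num.sqrt (N * L); have s_gt0 : 0 < s by rewrite sqrtr_gt0.
have s_sqr : s ^+ 2 = N * L by rewrite sqr_sqrtr // ltW.
have s_le : s <= N.
  by rewrite -(@ler_pXn2r _ 2) ?nnegrE ?(ltW s_gt0) // s_sqr expr2 ler_wpM2l //; lra.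
apply: le_trans (failure_prob_mono (edge_prob01 p01) _) (failure_prob_discrepancy p01
  (J := 'I_n) set1 (fun=> setT) (6 * L) (x := 6 * N / s) (b := 2 * L) _ _).
- move=> w row_le v; have := row_le v; rewrite discrepancy_row big_set1 cards1 cardsT card_ord mul1r.
  move/le_trans; apply.
  have -> : 6 * N / s * (6 * L + 2 * L) = 48 * s.
    transitivity (48 * (N * L) / s); first by field; rewrite gt_eqF.
    by rewrite -s_sqr; field; rewrite gt_eqF.
  rewrite (_ : _ / _ = edge_variance p * s / 3); last by field; rewrite !gt_eqF //; lra.
  by have := @ler_wpM2r _ s _ _ _ (edge_variance_le p); lra.
- by rewrite ler_pdivlMr //; lra.
- by rewrite card_ord double_natr_le_expR.
Qed.

Lemma failure_prob_cut (x : R) : 6 <= x ->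
  failure_prob edge_prob (fun w => forall X Y, `|discrepancy p w X Y|
    <= 2 * edge_variance p * (#|X|%:R * #|Y|%:R) / x + x * (6 * L + 3 * N))
  <= expR (- (6 * L)).
Proof.
move=> x_ge6; apply: le_trans (failure_prob_mono (edge_prob01 p01) _) (failure_prob_discrepancy p01
  (J := ({set 'I_n} * {set 'I_n})%type) fst snd (6 * L) (b := 3 * N) x_ge6 _).
  by move=> w cut_le X Y; exact: (cut_le (X, Y)).
rewrite card_prod natrM; apply: le_trans (double_exp2_le_expR R n_ge2).
by rewrite -cardsT -powersetT card_powerset cardsT card_ord natrX.
Qed.

Variable sigma : R.
Hypotheses (sigma_ge0 : 0 <= sigma) (sigma_sqr : sigma ^+ 2 = N * edge_variance p).

Lemma sigma_le : sigma <= N.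
Proof.
have N_ge2 := natr_ge2 R n_ge2; have := edge_variance_le p.
by move=> ?; rewrite -(@ler_pXn2r _ 2) ?nnegrE ?ler0n // sigma_sqr expr2; apply: ler_wpM2l; lra.
Qed.

Lemma failure_prob_centered_degree_variance : 144 * L <= sigma ^+ 2 ->
  failure_prob edge_prob (fun w => forall v, `|centered_degree p w v| <= sigma ^+ 2)
  <= expR (- (6 * L)).
Proof.
move=> L_le; apply: le_trans (failure_prob_mono (edge_prob01 p01) _) (failure_prob_discrepancy p01
  (J := 'I_n) set1 (fun=> setT) (6 * L) (x := 6) (b := 2 * L) _ _) => //.
- move=> w row_le v; have := row_le v; rewrite discrepancy_row big_set1 cards1 cardsT card_ord mul1r.
  rewrite (_ : 2 * _ * N = 2 * sigma ^+ 2); last by rewrite sigma_sqr; ring.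
  by have := sqr_ge0 sigma; lra.
- by rewrite card_ord double_natr_le_expR.
Qed.

Lemma failure_prob_cut_variance : 1 <= sigma ->
  failure_prob edge_prob (fun w => forall X Y, `|discrepancy p w X Y| <= 55 * N * sigma)
  <= expR (- (6 * L)).
Proof.
move=> sigma_ge1; have N_ge2 := natr_ge2 R n_ge2; have L_le := ln_natr_le R n_ge2.
apply: le_trans (failure_prob_mono (edge_prob01 p01) _) (failure_prob_cut (x := 6 * sigma) _);
  last by lra.
move=> w cut_le X Y; apply: le_trans (cut_le X Y) _.
have card_le : #|X|%:R * #|Y|%:R <= N * N :> R.
  by apply: ler_pM => //; rewrite ler_nat -[leqRHS]card_ord max_card.
have quad_le : 2 * edge_variance p * (#|X|%:R * #|Y|%:R) <= N * sigma / 3 * (6 * sigma).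
  rewrite (_ : _ / 3 * _ = 2 * (N * sigma ^+ 2)); last by field.
  rewrite sigma_sqr (_ : 2 * (N * _) = 2 * edge_variance p * (N * N)); last by ring.
  by rewrite ler_wpM2l // mulr_ge0 // edge_variance_ge0.
rewrite -ler_pdivrMr in quad_le; last by lra.
have := @ler_wpM2l _ (6 * sigma) _ (6 * L + 3 * N) (9 * N).
have : 0 <= N * sigma by rewrite mulr_ge0.
by lra.
Qed.

Lemma failure_prob_discrepancy_square (k : nat) (rho : R) : (0 < k)%N -> 0 < rho <= 1 ->
    rho ^+ 4 * N = k%:R ->
  failure_prob edge_prob (fun w => forall X, #|X| = (2 * k)%N ->
    `|discrepancy p w X X| <= 12 * k%:R * sigma * rho + 90 * N * L)
  <= expR (- (6 * L)).
Proof.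
move=> k_gt0 /andP[rho_gt0 rho_le1] rho4.
have N_ge2 := natr_ge2 R n_ge2; have L_ge := ln_natr_ge R n_ge2.
have rho2_gt0 : 0 < rho ^+ 2 by rewrite exprn_gt0.
have rho2_le1 : rho ^+ 2 <= 1 by rewrite expr_le1 // ltW.
have k_div : k%:R / rho ^+ 2 = rho ^+ 2 * N by rewrite -rho4; field; rewrite gt_eqF.
have cube_ge0 : 0 <= sigma * rho ^+ 3 by rewrite mulr_ge0 // exprn_ge0 // ltW.
have cube_le : sigma * rho ^+ 3 <= N.
  by apply: le_trans sigma_le; rewrite ler_piMr // expr_le1 // ltW.
pose b : R := 3 * (k%:R / rho ^+ 2) + 1.
apply: le_trans (failure_prob_mono (edge_prob01 p01) _) (failure_prob_discrepancy p01
  (J := {X : {set 'I_n} | #|X| == (2 * k)%N}) val val (6 * L) (x := sigma * rho ^+ 3 + 6) (b := b) _ _).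
- move=> w disc_le X cardX; have /= := disc_le (exist _ X (introT eqP cardX)); rewrite cardX.
  move/le_trans; apply.
  have quad_le : 2 * edge_variance p * ((2 * k)%:R * (2 * k)%:R) / (sigma * rho ^+ 3 + 6)
      <= 8 * (k%:R * sigma * rho).
    rewrite ler_pdivrMr; last by lra.
    have k_var : k%:R * edge_variance p = rho ^+ 4 * sigma ^+ 2 by rewrite sigma_sqr -rho4; ring.
    have -> : 2 * edge_variance p * ((2 * k)%:R * (2 * k)%:R)
        = 8 * k%:R * (k%:R * edge_variance p) by rewrite natrM; ring.
    rewrite k_var (_ : _ * (_ * _) = 8 * (k%:R * sigma * rho) * (sigma * rho ^+ 3)); last by ring.
    by rewrite ler_wpM2l ?lerDl // !mulr_ge0 // ltW.
  have lin_eq : (sigma * rho ^+ 3 + 6) * (6 * L + b)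
      = (sigma * rho ^+ 3 + 6) * (6 * L + 1) + 3 * (k%:R * sigma * rho) + 18 * (rho ^+ 2 * N).
    by rewrite /b -k_div; field; rewrite gt_eqF.
  have rest_le : (sigma * rho ^+ 3 + 6) * (6 * L + 1) <= (4 * N) * (8 * L).
    by apply: ler_pM; lra.
  have := natr_le_mul_ln R n_ge2; have := @ler_wpM2r _ N _ _ _ rho2_le1.
  have : 0 <= k%:R * sigma * rho by rewrite !mulr_ge0 // ltW.
  by rewrite lin_eq; lra.
- lra.
- rewrite card_sig (_ : #|_| = 'C(n, 2 * k)); last first.
    by have := card_draws 'I_n (2 * k); rewrite card_ord => <-; apply: eq_card => X; rewrite !inE.
  rewrite /b addrC expRD; apply: ler_pM => //; first by rewrite expR_ge2.
  rewrite (_ : 3 * _ = N / (rho ^+ 2)^-1 + (2 * k)%:R * (rho ^+ 2)^-1).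
    by apply: bin_le_expR; rewrite invf_ge1.
  by rewrite invrK natrM (mulrC N) -k_div; ring.
Qed.

End CutEvents.

(** * The hard regime *)

Section HardRegime.
Variable R : realFieldType.

(* The trivial cut bound [k sigma rho] exceeds the target error [N L + k s], where [N] is the
   number of vertices, [L] its logarithm, [k] the number of vertices pruned on each side,
   [s - 1] the largest change of an uncorrupted degree, [sigma] the standard deviation of
   a degree and [rho] the fourth root of [k / N]. *)
Record hard_regime (N L k s K q sigma rho : R) : Prop := HardRegime {
  regime_N : 2 <= N;
  regime_L : 1 / 2 <= L <= N;
  regime_k : 1 <= k;
  regime_kN : 4 * k <= N;
  regime_s : 1 <= s;
  regime_K : 300 <= K;
  regime_q : 0 <= q <= 1 / 4;
  regime_sigma : 0 <= sigma;
  regime_sigma2 : sigma ^+ 2 = N * q;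
  regime_rho : 0 < rho <= 1;
  regime_rho4 : rho ^+ 4 * N = k;
  regime_hard : 1000 * K * (N * L + k * s) < k * sigma * rho }.

Definition hazard_rate (K sigma rho : R) : R := 12 * K / (rho * sigma).

Definition level_error (L k K sigma rho : R) : R := 6 * K * k / (rho * sigma) + 16 * L.

Definition level_error_density (N k K sigma rho : R) : R := 6 * K * k / (N * (rho * sigma)).

Definition extreme_rate (sigma : R) : R := (3 * sigma ^+ 2)^-1.

Definition boundary_rate (sigma rho : R) : R := (6 * (sigma * rho ^+ 2))^-1.

Variables (N L k s K q sigma rho : R).
Hypothesis regime : hard_regime N L k s K q sigma rho.
Local Notation kappa := (hazard_rate K sigma rho).
Local Notation error := (level_error L k K sigma rho).

Lemma regime_shift_le : 1000 * K * s <= sigma * rho.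
Proof.
have [? /andP[? ?] ? ? ? ? _ _ _ _ _ hard] := regime.
have k_gt0 : 0 < k by lra.
rewrite -(ler_pM2l k_gt0) [leRHS]mulrA; apply: le_trans (ltW hard).
by rewrite mulrCA ler_wpM2l ?lerDr ?mulr_ge0 //; lra.
Qed.

Lemma regime_ln_le : 1000 * K * L <= sigma * rho ^+ 5.
Proof.
have [? /andP[? ?] ? ? ? ? _ _ _ _ rho4 hard] := regime.
have N_gt0 : 0 < N by lra.
rewrite -(ler_pM2l N_gt0); apply: (@le_trans _ _ (1000 * K * (N * L + k * s))).
  by rewrite mulrCA ler_wpM2l ?lerDl ?mulr_ge0 //; lra.
by apply: le_trans (ltW hard) _; rewrite le_eqVlt -rho4; apply/orP; left; apply/eqP; ring.
Qed.

Lemma regime_rho_exp i : 0 <= rho ^+ i <= 1.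
Proof.
have [_ _ _ _ _ _ _ _ _ /andP[rho_gt0 rho_le1] _ _] := regime.
by rewrite exprn_ge0 ?exprn_ile1 // ltW.
Qed.

Lemma regime_sigma_ge : 1000 * K <= sigma.
Proof.
have [_ _ _ _ ? ? _ sigma_ge0 _ /andP[_ rho_le1] _ _] := regime.
apply: (@le_trans _ _ (sigma * rho)); last by rewrite ler_piMr.
by apply: le_trans regime_shift_le; rewrite ler_peMr //; lra.
Qed.

Lemma regime_rho_sigma_gt0 : 0 < rho * sigma.
Proof.
have [_ _ _ _ _ ? _ _ _ /andP[rho_gt0 _] _ _] := regime.
by rewrite mulr_gt0 //; have := regime_sigma_ge; lra.
Qed.

Lemma regime_sigma_rho2_ge1 : 1 <= sigma * rho ^+ 2.
Proof.
have [_ /andP[? _] _ _ _ ? _ sigma_ge0 _ _ _ _] := regime.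
have /andP[rho2_ge0 _] := regime_rho_exp 2; have /andP[_ rho3_le1] := regime_rho_exp 3.
apply: (@le_trans _ _ (sigma * rho ^+ 5)).
  by apply: le_trans regime_ln_le; have := @ler_pM R 1 K (1 / 2) L; lra.
by apply: ler_wpM2l => //; rewrite (exprD _ 2 3) ler_piMr.
Qed.

Lemma regime_sigma_le : sigma <= N.
Proof.
have [? _ _ _ _ _ /andP[_ ?] ? sigma2 _ _ _] := regime.
have sigma2_le : sigma ^+ 2 <= N ^+ 2 by rewrite sigma2 expr2; apply: ler_wpM2l; lra.
by rewrite -(@ler_pXn2r _ 2) // nnegrE; lra.
Qed.

Lemma regime_sigma_rho2_le : sigma * rho ^+ 2 <= N.
Proof.
have [_ _ _ _ _ _ _ sigma_ge0 _ _ _ _] := regime.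
by apply: le_trans regime_sigma_le; have /andP[_ ?] := regime_rho_exp 2; rewrite ler_piMr.
Qed.

Lemma regime_ln_le_variance : 144 * L <= sigma ^+ 2.
Proof.
have [_ /andP[? _] _ _ _ ? _ sigma_ge0 _ _ _ _] := regime.
have /andP[_ rho5_le1] := regime_rho_exp 5; have sigma_ge := regime_sigma_ge.
have L_le : L <= sigma.
  apply: (@le_trans _ _ (1000 * K * L)); first by rewrite ler_peMl; lra.
  by apply: le_trans regime_ln_le _; rewrite ler_piMr.
by rewrite expr2; apply: ler_pM => //; lra.
Qed.

Lemma hazard_rate_ge0 : 0 <= kappa.
Proof.
have [_ _ _ _ _ ? _ _ _ _ _ _] := regime.
by rewrite divr_ge0 ?(ltW regime_rho_sigma_gt0) //; lra.
Qed.

Lemma hazard_rate_shift_le : 2 * s * kappa <= 1 / 4.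
Proof.
have [_ _ _ _ ? ? _ _ _ _ _ _] := regime; have rs_gt0 := regime_rho_sigma_gt0.
rewrite mulrA ler_pdivrMr // (mulrC rho).
have Ks_ge0 : 0 <= K * s by rewrite mulr_ge0; lra.
by have := regime_shift_le; lra.
Qed.

Lemma hazard_rate_le : kappa <= 1 / 3.
Proof.
have [_ _ _ _ ? _ _ _ _ _ _ _] := regime; have kappa_ge0 := hazard_rate_ge0.
have : kappa <= 2 * s * kappa by rewrite ler_peMl //; lra.
by have := hazard_rate_shift_le; lra.
Qed.

Lemma level_error_ge0 : 0 <= error.
Proof.
have [_ /andP[? _] ? _ _ ? _ _ _ _ _ _] := regime.
rewrite addr_ge0 ?mulr_ge0 ?invr_ge0 ?(ltW regime_rho_sigma_gt0) //; lra.
Qed.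

Lemma sampled_hazard_le (t : R) : 0 < t -> sigma <= 2 * t -> 6 * K * rho^-1 / t <= kappa.
Proof.
have [_ _ _ _ _ ? _ _ _ /andP[rho_gt0 _] _ _] := regime.
move=> t_gt0 t_ge; have rs_gt0 := regime_rho_sigma_gt0.
rewrite -mulrA -invfM /hazard_rate ler_pdivrMr ?mulr_gt0 // mulrAC ler_pdivlMr //.
have : K * (rho * sigma) <= K * (rho * (2 * t)).
  by apply: ler_wpM2l; [lra|apply: ler_wpM2l => //; exact: ltW].
by lra.
Qed.

Lemma sampled_level_error_le (t : R) : 0 < t -> sigma <= 2 * t ->
  3 * K * (rho^-1 ^+ 3)^-1 / t <= level_error_density N k K sigma rho.
Proof.
have [? _ _ _ _ ? _ _ _ /andP[rho_gt0 _] rho4 _] := regime.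
have sigma_ge := regime_sigma_ge; have sigma_gt0 : 0 < sigma by lra.
move=> t_gt0 t_ge; rewrite exprVn invrK /level_error_density.
have -> : 6 * K * k / (N * (rho * sigma)) = 6 * K * rho ^+ 3 / sigma.
  by rewrite -rho4; field; rewrite !gt_eqF //; lra.
rewrite ler_pdivrMr // [leRHS]mulrAC ler_pdivlMr //.
have Krho_ge0 : 0 <= K * rho ^+ 3 by have /andP[? _] := regime_rho_exp 3; rewrite mulr_ge0 //; lra.
by have := ler_wpM2l Krho_ge0 t_ge; lra.
Qed.

Lemma regime_level_sum : kappa * (2 * k) + error = 30 * K * (k / (rho * sigma)) + 16 * L.
Proof. by rewrite /hazard_rate /level_error; move: (_^-1) => x; ring. Qed.

Lemma regime_ratio_le : 1000 * (K * (s * (k / (rho * sigma)))) <= k.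
Proof.
have [_ _ ? _ _ _ _ _ _ _ _ _] := regime; have rs_gt0 := regime_rho_sigma_gt0.
rewrite (_ : 1000 * _ = 1000 * K * s / (rho * sigma) * k); last by move: (_^-1) => x; ring.
by rewrite ler_piMl ?ler_pdivrMr // ?mul1r ?(mulrC rho) ?regime_shift_le //; lra.
Qed.

Lemma regime_shift_ln_le : 1000 * 1000 * (s * L) <= k.
Proof.
have [? /andP[? _] _ _ ? ? /andP[? ?] ? sigma2 _ rho4 _] := regime.
have sL_ge0 : 0 <= s * L by rewrite mulr_ge0 //; lra.
have KK_ge1 : 1 <= K * K by rewrite mulr_ege1 //; lra.
have /andP[rho2_ge0 rho2_le1] := regime_rho_exp 2; have /andP[rho4_ge0 _] := regime_rho_exp 4.
apply: (@le_trans _ _ (1000 * K * s * (1000 * K * L))).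
  rewrite (_ : 1000 * K * s * _ = 1000 * 1000 * (s * L) * (K * K)); last by ring.
  by rewrite ler_peMr //; lra.
apply: (@le_trans _ _ (sigma * rho * (sigma * rho ^+ 5))).
  have Ks_ge0 : 0 <= K * s by rewrite mulr_ge0 //; lra.
  have KL_ge0 : 0 <= K * L by rewrite mulr_ge0 //; lra.
  by apply: ler_pM; rewrite ?regime_shift_le ?regime_ln_le //; lra.
rewrite (_ : _ * _ = (sigma ^+ 2 * rho ^+ 2) * rho ^+ 4); last by ring.
rewrite -rho4 (mulrC _ N) ler_wpM2r // sigma2 -mulrA ler_piMr; [by []|lra|].
by rewrite mulr_ile1 //; lra.
Qed.

Lemma regime_scaled_shift_ln_le : 1000 * (K * (sigma * rho ^+ 2 * (s * L))) <= N * L.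
Proof.
have [? /andP[? _] _ _ ? ? /andP[? ?] sigma_ge0 sigma2 _ _ _] := regime.
have /andP[rho2_ge0 _] := regime_rho_exp 2; have /andP[rho3_ge0 rho3_le1] := regime_rho_exp 3.
rewrite (_ : 1000 * _ = 1000 * K * s * (sigma * rho ^+ 2) * L); last by ring.
apply: ler_wpM2r; first by lra.
apply: (@le_trans _ _ (sigma * rho * (sigma * rho ^+ 2))).
  by apply: ler_wpM2r; [exact: mulr_ge0|exact: regime_shift_le].
rewrite (_ : _ * _ = sigma ^+ 2 * rho ^+ 3); last by ring.
by rewrite sigma2 -mulrA ler_piMr; [|lra|rewrite mulr_ile1 //; lra].
Qed.

Lemma regime_scaled_ratio_le : K * (s * (sigma * rho ^+ 2 * (k / (rho * sigma)))) <= K * (s * k).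
Proof.
have [_ _ ? _ ? ? _ _ _ /andP[? ?] _ _] := regime; have sigma_ge := regime_sigma_ge.
apply: ler_wpM2l; first by lra.
apply: ler_wpM2l; first by lra.
rewrite (_ : _ * (k / _) = k * rho); first by rewrite ler_piMr //; lra.
by field; rewrite !gt_eqF //; lra.
Qed.

Lemma regime_ge0 : [/\ 0 <= N * L, 0 <= k * s, 0 <= K & 0 <= s * L].
Proof. by have [? /andP[? ?] ? ? ? ? _ _ _ _ _ _] := regime; split; rewrite ?mulr_ge0 //; lra. Qed.

Lemma regime_boundary_le (z : R) : z <= 8 * (s * (kappa * (2 * k) + error)) ->
  z <= 2 * k /\ sigma * rho ^+ 2 * z <= 250 * K * (N * L + k * s).
Proof.
have ratio_le := regime_ratio_le; have shift_ln_le := regime_shift_ln_le.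
have scaled_ln_le := regime_scaled_shift_ln_le; have scaled_ratio_le := regime_scaled_ratio_le.
have [NL_ge0 ks_ge0 K_ge0 sL_ge0] := regime_ge0.
have [_ _ k_ge1 _ _ K_ge _ _ _ _ _ _] := regime; have u_ge1 := regime_sigma_rho2_ge1.
rewrite regime_level_sum; move: (k / (rho * sigma)) (sigma * rho ^+ 2) => ratio u in
  ratio_le scaled_ln_le scaled_ratio_le u_ge1 *.
move=> z_le; have {}z_le : z <= 240 * (K * (s * ratio)) + 128 * (s * L) by lra.
split; first by lra.
have u_ge0 : 0 <= u by lra.
have K_ge1 : 1 <= K by lra.
have usL_le : u * (s * L) <= K * (u * (s * L)) by rewrite ler_peMl // mulr_ge0.
have NL_le : N * L <= K * (N * L) by rewrite ler_peMl.
have Kks_ge0 : 0 <= K * (k * s) by rewrite mulr_ge0.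
by apply: le_trans (ler_wpM2l u_ge0 z_le) _; clear z_le; lra.
Qed.

Lemma extreme_rate_bounds : 0 < extreme_rate sigma <= 1 / 3.
Proof.
have [_ _ _ _ _ ? _ _ _ _ _ _] := regime; have sigma_ge := regime_sigma_ge.
have sigma2_ge1 : 1 <= sigma ^+ 2 by apply: exprn_ege1; lra.
by rewrite /extreme_rate invr_gt0 div1r lef_pV2 ?posrE; lra.
Qed.

Lemma boundary_rate_bounds : 0 < boundary_rate sigma rho <= 1 / 6.
Proof.
have u_ge1 := regime_sigma_rho2_ge1.
by rewrite /boundary_rate invr_gt0 div1r lef_pV2 ?posrE; lra.
Qed.

Lemma regime_N_le_mul_ln : N <= 2 * (N * L).
Proof.
have [? /andP[? _] _ _ _ _ _ _ _ _ _ _] := regime.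
by have := @ler_wpM2l _ N _ (1 / 2) L; lra.
Qed.

Lemma regime_extreme_le (x g : R) : 0 <= x <= 3 * k -> g <= 55 * N * sigma ->
  300 * 300 * N + extreme_rate sigma * (24 * q * (x * x) + 4 * g + 4 * N)
    + 144 * (9 * L) / extreme_rate sigma
  <= 450 * 450 * (N * L).
Proof.
move=> /andP[x_ge0 x_le] g_le.
have [N_ge2 /andP[? ?] ? ? ? ? /andP[q_ge0 q_le] ? sigma2 _ _ _] := regime.
have [N_ge0 L_ge0 x_leN sigma_gt0] : [/\ 0 <= N, 0 <= L, x <= N & 0 < sigma].
  by have := regime_sigma_ge; split; lra.
have sigma_ge := regime_sigma_ge; have /andP[rate_gt0 rate_le] := extreme_rate_bounds.
have NL_ge := regime_N_le_mul_ln; set rate := extreme_rate sigma in rate_gt0 rate_le *.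
have rate_inv : rate^-1 = 3 * (N * q) by rewrite /rate /extreme_rate invrK sigma2.
have rate_q : rate * q * (3 * N) = 1 by rewrite -[RHS](mulfV (lt0r_neq0 rate_gt0)) rate_inv; ring.
have xx_le : x * x <= N * N by exact: ler_pM.
have quad_le : rate * (q * (x * x)) <= N.
  apply: (@le_trans _ _ (rate * (q * (N * N)))).
    by rewrite ler_wpM2l ?(ltW rate_gt0) // ler_wpM2l.
  rewrite (_ : rate * _ = rate * q * (3 * N) * (N / 3)); last by field.
  by rewrite rate_q; lra.
have rate_sigma : rate * sigma <= 1.
  have -> : rate * sigma = (3 * sigma)^-1 by rewrite /rate /extreme_rate; field; rewrite gt_eqF.
  by rewrite invf_le1; lra.
have g_scaled : rate * g <= 55 * N.
  apply: le_trans (ler_wpM2l (ltW rate_gt0) g_le) _.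
  by rewrite mulrCA ler_piMr //; lra.
have N_scaled : rate * N <= N by rewrite ler_piMl // (le_trans rate_le) //; lra.
have NLq_le : N * L * q <= N * L * (1 / 4) by rewrite ler_wpM2l // mulr_ge0.
by rewrite rate_inv 2!(mulrDr rate); clear -quad_le g_scaled N_scaled NLq_le NL_ge N_ge2; lra.
Qed.

Lemma regime_subset_le (x y z g : R) : 0 <= x <= z -> 0 <= y <= 3 * k ->
    g <= 2 * q * (x * y) / (6 * (sigma * rho ^+ 2)) + 6 * (sigma * rho ^+ 2) * (6 * L + 3 * N) ->
  300 * 300 * N + boundary_rate sigma rho * (24 * q * (x * y) + 4 * g + 4 * N)
    + 144 * (9 * L + z) / boundary_rate sigma rho
  <= 450 * 450 * (N * L) + 900 * (sigma * rho ^+ 2 * z).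
Proof.
move=> /andP[x_ge0 x_le] /andP[y_ge0 y_le].
have [N_ge2 /andP[? L_le] ? ? ? ? /andP[q_ge0 q_le] ? sigma2 _ rho4 _] := regime.
have [N_ge0 L_ge0] : 0 <= N /\ 0 <= L by split; lra.
have /andP[rate_gt0 rate_le] := boundary_rate_bounds; have NL_ge := regime_N_le_mul_ln.
have qk : q * k = (sigma * rho ^+ 2) ^+ 2 by rewrite exprMn sigma2 -rho4; ring.
have u_ge1 := regime_sigma_rho2_ge1; have u_le := regime_sigma_rho2_le.
rewrite /boundary_rate in rate_gt0 rate_le *; set u := sigma * rho ^+ 2 in qk u_ge1 u_le rate_gt0 rate_le *.
have qxy_le : q * (x * y) <= 3 * z * u ^+ 2.
  rewrite -qk (_ : 3 * z * (q * k) = q * (z * (3 * k))); last by ring.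
  by apply: ler_wpM2l => //; apply: ler_pM.
move=> g_le; have quad_le : (6 * u)^-1 * (24 * q * (x * y)) <= 12 * (u * z).
  by rewrite mulrC ler_pdivrMr; lra.
have g_scaled : (6 * u)^-1 * g <= z / 6 + (6 * L + 3 * N).
  rewrite mulrC ler_pdivrMr; last by lra.
  apply: le_trans g_le _; rewrite [leRHS]mulrDl (mulrC (6 * L + _)) lerD2r.
  by rewrite ler_pdivrMr; lra.
have N_scaled : (6 * u)^-1 * N <= N by rewrite ler_piMl // (le_trans rate_le) //; lra.
have uL_le : u * L <= N * L by rewrite ler_wpM2r.
have z_ge0 : 0 <= z by exact: le_trans x_le.
have z_le : z <= u * z by rewrite ler_peMl.
rewrite invrK 2!(mulrDr (6 * u)^-1).
by clear -quad_le g_scaled N_scaled uL_le z_ge0 z_le NL_ge N_ge2 L_le; lra.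
Qed.

End HardRegime.

Section WindowCount.
Variables (R : realFieldType) (V : finType) (d : V -> nat) (b s : nat) (Z : {set V}).
Hypothesis window : {in Z, forall v, (b <= d v + s)%N && (d v <= b + s)%N}.

Lemma card_window_le (c : R) : 0 <= c -> {in Z, forall v, #|[set u | d u == d v]|%:R <= c} ->
  #|Z|%:R <= (2 * s%:R + 1) * c.
Proof.
move=> c_ge0 level_le.
have -> : #|Z|%:R = \sum_(i < (2 * s).+1) \sum_(v in Z) (d v + s == b + i)%N%:R :> R.
  rewrite exchange_big /= -sum1_card natr_sum; apply: eq_bigr => v vZ.
  have /andP[b_le d_le] := window vZ; have i_lt : (d v + s - b < (2 * s).+1)%N by lia.
  rewrite (bigD1 (Ordinal i_lt)) //= big1; first by rewrite subnKC // eqxx addr0.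
  move=> i; rewrite -val_eqE /= => i_neq; case: eqP => // i_eq.
  by move: i_neq; rewrite i_eq addKn eqxx.
have -> : (2 * s%:R + 1) * c = \sum_(i < (2 * s).+1) c.
  by rewrite sumr_const card_ord -[RHS]mulr_natl -[(2 * s).+1%:R]natr1 natrM.
apply: ler_sum => i _.
have [v /andP[vZ /eqP v_level]|no_v] := pickP (fun v => (v \in Z) && (d v + s == b + i)%N).
  apply: le_trans (level_le v vZ); rewrite -sum1_card natr_sum big_mkcond [leRHS]big_mkcond.
  apply: ler_sum => u _; rewrite inE; case: (u \in Z); last by case: ifP.
  case: eqP => u_level; last by case: ifP.
  by have -> : d u == d v by apply/eqP; lia.
by rewrite big1 // => v vZ; have := no_v v; rewrite vZ /= => ->.
Qed.

(* The bound on the level sets involves [Z] itself, with a coefficient small enough for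
   it to be absorbed. *)
Lemma card_window_le_hazard (U : {set V}) (kappa c m : R) : 0 <= kappa -> 0 <= c ->
    (2 * s%:R + 1) * kappa <= 1 / 2 -> #|U|%:R <= m ->
    {in Z, forall v, exists2 S : {set V}, S \subset U :|: Z &
       #|[set u | d u == d v]|%:R <= kappa * #|S|%:R + c} ->
  #|Z|%:R <= 2 * (2 * s%:R + 1) * (kappa * m + c).
Proof.
move=> kappa_ge0 c_ge0 kappa_le cardU level_le.
have m_ge0 : 0 <= m by apply: le_trans cardU.
have cardZ : #|Z|%:R <= (2 * s%:R + 1) * (kappa * (m + #|Z|%:R) + c).
  apply: card_window_le => [|v vZ]; first by rewrite addr_ge0 // mulr_ge0 // addr_ge0.
  have [S S_sub S_le] := level_le v vZ; apply: le_trans S_le _; rewrite lerD2r.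
  apply: ler_wpM2l => //; apply: (@le_trans _ _ (#|U| + #|Z|)%:R); last by rewrite natrD lerD2r.
  by rewrite ler_nat (leq_trans (subset_leq_card S_sub)) ?leq_card_setU.
have absorbed : (2 * s%:R + 1) * kappa * #|Z|%:R <= 1 / 2 * #|Z|%:R by apply: ler_wpM2r.
by move: (#|Z|%:R : R) (2 * s%:R + 1 : R) cardZ absorbed => z y; lra.
Qed.

End WindowCount.

Lemma exists_half_set (n : nat) : (2 <= n)%N ->
  exists V : {set 'I_n}, (n <= 4 * #|V|)%N /\ (n <= 4 * #|~: V|)%N.
Proof.
move=> n_ge2; pose V : {set 'I_n} := [set v : 'I_n | (v < n./2)%N].
have n_eq := odd_double_half n; rewrite -addnn in n_eq.
have half_le : (n./2 <= n)%N by lia.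
have cardV : #|V| = n./2.
  rewrite -sum1_card -[RHS]card_ord -sum1_card (big_ord_widen n (fun=> 1%N) half_le).
  by apply: eq_bigl => v; rewrite inE.
exists V; rewrite [#|~: V|]cardsCs setCK cardV card_ord.
by case: (odd n) n_eq => /= n_eq; lia.
Qed.

Section DegreeLevels.
Variables (R : realType) (n k s : nat) (p K sigma rho : R).
Local Notation edge_prob := (@edge_prob R n p).
Local Notation N := (@GRing.natmul R 1 n).
Local Notation L := (ln N).
Local Notation kR := (@GRing.natmul R 1 k).
Local Notation kappa := (hazard_rate K sigma rho).
Local Notation error := (level_error L kR K sigma rho).
Local Notation density := (level_error_density N kR K sigma rho).
Hypotheses (p01 : 0 <= p <= 1) (n_ge2 : (2 <= n)%N) (K_ge : 16 * 12 ^+ 4 <= K)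
  (regime : hard_regime N L kR (s%:R + 1) K (edge_variance p) sigma rho).
Implicit Types (w : {set ('I_n * 'I_n)}) (v : 'I_n).

Definition levels_controlled w := forall v,
  #|[set u | degree w u == degree w v]|%:R
    <= kappa * #|[set u | (degree w v <= degree w u)%N]|%:R + error /\
  #|[set u | degree w u == degree w v]|%:R
    <= kappa * #|[set u | (degree w u <= degree w v)%N]|%:R + error.

Lemma regime_prob_gt0 : 0 < p < 1.
Proof.
have [? _ _ _ _ ? _ _ sigma2 _ _ _] := regime; have /andP[p_ge0 p_le1] := p01.
have sigma_ge := regime_sigma_ge regime; have sigma_gt0 : 0 < sigma by lra.
have : 0 < N * edge_variance p by rewrite -sigma2 exprn_gt0.
rewrite pmulr_rgt0; last by lra.
rewrite /edge_variance !lt_neqAle p_ge0 p_le1 !andbT => /andP[var_neq0 _]; apply/andP; split.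
  by apply: contraNneq var_neq0 => <-; rewrite mul0r.
by apply: contraNneq var_neq0 => ->; rewrite subrr mulr0.
Qed.

Lemma failure_prob_levels_in (V : {set 'I_n}) : (n <= 4 * #|~: V|)%N ->
  failure_prob edge_prob (fun w => forall j : 'I_n,
    \sum_(v in V) (degree w v == j)%:R <= kappa * (\sum_(v in V) (j <= degree w v)%N%:R)
       + #|V|%:R * density + 8 * L /\
    \sum_(v in V) (degree w v == j)%:R <= kappa * (\sum_(v in V) (degree w v <= j)%N%:R)
       + #|V|%:R * density + 8 * L)
  <= expR (- (6 * L)).
Proof.
move=> cardV.
have [? _ _ _ _ ? /andP[var_ge0 _] ? sigma2 /andP[rho_gt0 rho_le1] _ _] := regime.
have sigma_ge := regime_sigma_ge regime.
set t := Num.sqrt (#|~: V|%:R * edge_variance p).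
have t_sqr : t ^+ 2 = #|~: V|%:R * edge_variance p by rewrite sqr_sqrtr // mulr_ge0.
have t_ge0 : 0 <= t by apply: sqrtr_ge0.
have t_ge : sigma <= 2 * t.
  rewrite -(@ler_pXn2r _ 2) ?nnegrE ?mulr_ge0 // exprMn t_sqr sigma2 [leRHS]mulrA ler_wpM2r //.
  by rewrite -[2 ^+ 2]/(2 * 2 : R) -!natrM ler_nat.
have t_ge1 : 1 <= t by lra.
have t_gt0 : 0 < t by lra.
have rate_le := sampled_hazard_le regime t_gt0 t_ge.
have error_le := sampled_level_error_le regime t_gt0 t_ge.
have sum_le w (P : 'I_n -> bool) (j : 'I_n) (x y : R) : x <= kappa -> y <= density ->
    \sum_(v in V) ((degree w v == j)%:R - x * (P v)%:R - y) <= 6 * L + 2 * L ->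
    \sum_(v in V) (degree w v == j)%:R
      <= kappa * (\sum_(v in V) (P v)%:R) + #|V|%:R * density + 8 * L.
  move=> x_le y_le; rewrite !sumrB -mulr_sumr sumr_const -(mulr_natl y) => excess_le.
  have P_ge0 : 0 <= \sum_(v in V) (P v)%:R :> R by apply: sumr_ge0.
  have := ler_wpM2r P_ge0 x_le; have := ler_wpM2l (ler0n R #|V|) y_le.
  by clear -excess_le; lra.
apply: le_trans (failure_prob_mono (edge_prob01 p01) _) (@failure_prob_degree_count R n p p01 V
  K rho^-1 t _ _ (6 * L) (2 * L) K_ge regime_prob_gt0 t_ge1 _ _ erefl erefl _ _).
- move=> w count_le j; have [above below] := count_le j.
  split; first exact: (sum_le w (fun v => (j <= degree w v)%N) j _ _ rate_le error_le above).
  exact: (sum_le w (fun v => (degree w v <= j)%N) j _ _ rate_le error_le below).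
- by rewrite t_sqr /edge_variance mulrA.
- by rewrite invf_ge1.
- exact: le_trans rate_le (hazard_rate_le regime).
- exact: double_natr_le_expR.
Qed.

Lemma failure_prob_levels :
  failure_prob edge_prob levels_controlled <= expR (- (6 * L)) + expR (- (6 * L)).
Proof.
have [V [cardV cardVC]] := exists_half_set n_ge2.
have inC := failure_prob_levels_in (V := ~: V); rewrite setCK in inC.
apply: le_trans (failure_prob_mono (edge_prob01 p01) _)
  (failure_prob_and (edge_prob01 p01) (failure_prob_levels_in cardVC) (inC cardV)).
move=> w [level_in level_out] v; pose j := Ordinal (degree_lt w v).
have cardE (P : 'I_n -> bool) : #|[set u | P u]|%:R
    = \sum_(u in V) (P u)%:R + \sum_(u in ~: V) (P u)%:R :> R.
  rewrite -sum1_card natr_sum big_mkcond /= (bigID (mem V)) /=; congr (_ + _).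
    by apply: eq_bigr => u _; rewrite inE; case: (P u).
  by apply: eq_big => u; rewrite !inE // => _; case: (P u).
have [above_in below_in] := level_in j; have [above_out below_out] := level_out j.
rewrite /= in above_in below_in above_out below_out.
have density_sum : (#|V|%:R + #|~: V|%:R) * density
    = 6 * K * kR / (rho * sigma).
  rewrite -natrD cardsC card_ord /level_error_density; have rs_gt0 := regime_rho_sigma_gt0 regime.
  have [? _ _ _ _ _ _ _ _ _ _ _] := regime.
  rewrite (mulrC rho) in rs_gt0 *; move: (sigma * rho) rs_gt0 => x x_gt0.
  by field; rewrite !gt_eqF //; lra.
rewrite mulrDl in density_sum.
rewrite !cardE /level_error; clear -above_in below_in above_out below_out density_sum.
by split; lra.
Qed.

(* Given the degree thresholds [b] and [a] of the pruned sets, the membership in them of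
   the vertices outside the boundary is decided by the uncorrupted degrees. *)
Definition extreme (b a : nat) (f : 'I_n -> nat) : {set 'I_n} :=
  [set v | (b + s < f v)%N || (f v + s < a)%N].

Definition boundary (b a : nat) (f : 'I_n -> nat) : {set 'I_n} :=
  [set v | ((b <= f v + s) && (f v <= b + s))%N || ((a <= f v + s) && (f v <= a + s))%N].

Lemma card_boundary_le w (b a : nat) : levels_controlled w ->
    #|[set v | (b + s < degree w v)%N]|%:R <= 2 * kR ->
    #|[set v | (degree w v + s < a)%N]|%:R <= 2 * kR ->
  #|boundary b a (degree w)|%:R <= 8 * ((s%:R + 1) * (kappa * (2 * kR) + error)).
Proof.
move=> levels above_le below_le.
have kappa_ge0 := hazard_rate_ge0 regime; have error_ge0 := level_error_ge0 regime.
have kappa_le : (2 * s%:R + 1) * kappa <= 1 / 2.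
  have := hazard_rate_shift_le regime.
  have : (2 * s%:R + 1) * kappa <= 2 * (s%:R + 1) * kappa by rewrite ler_wpM2r //; lra.
  by lra.
pose window (c : nat) := [set v | (c <= degree w v + s) && (degree w v <= c + s)]%N.
have above_window : #|window b|%:R <= 2 * (2 * s%:R + 1) * (kappa * (2 * kR) + error).
  apply: (card_window_le_hazard (d := degree w) (b := b) _ kappa_ge0 error_ge0 kappa_le above_le)
    => v; rewrite inE // => /andP[b_le d_le].
  exists [set u | (degree w v <= degree w u)%N]; last by have [] := levels v.
  apply/subsetP => u; rewrite !inE => uv; case: (leqP (degree w u) (b + s)) => //= _.
  by rewrite andbT (leq_trans b_le) // leq_add2r.
have below_window : #|window a|%:R <= 2 * (2 * s%:R + 1) * (kappa * (2 * kR) + error).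
  apply: (card_window_le_hazard (d := degree w) (b := a) _ kappa_ge0 error_ge0 kappa_le below_le)
    => v; rewrite inE // => /andP[a_le d_le].
  exists [set u | (degree w u <= degree w v)%N]; last by have [] := levels v.
  apply/subsetP => u; rewrite !inE => uv; case: (leqP a (degree w u + s)) => //= _.
  exact: leq_trans uv d_le.
have boundary_le : #|boundary b a (degree w)|%:R <= #|window b|%:R + #|window a|%:R :> R.
  rewrite -natrD ler_nat; apply: leq_trans (leq_card_setU _ _); apply: subset_leq_card.
  by apply/subsetP => v; rewrite !inE.
have unit_ge0 : 0 <= kappa * (2 * kR) + error by rewrite addr_ge0 // mulr_ge0 // mulr_ge0.
move: (kappa * (2 * kR) + error) unit_ge0 above_window below_window boundary_le.
move=> x x_ge0 above_window below_window boundary_le.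
by clear -x_ge0 above_window below_window boundary_le; lra.
Qed.

End DegreeLevels.

Lemma sum_subset_weight (R : numFieldType) (T : finType) (Z : {set T}) :
  \sum_(S : {set T}) (S \subset Z)%:R * (2 ^+ #|Z|)^-1 = 1 :> R.
Proof.
rewrite -mulr_suml (_ : \sum_(S : {set T}) _ = 2 ^+ #|Z|).
  by rewrite mulfV // expf_neq0 // pnatr_eq0.
rewrite -natrX -card_powerset -sum1_card natr_sum [RHS]big_mkcond /=.
by apply: eq_bigr => S _; rewrite powersetE; case: (S \subset Z).
Qed.

Section RegularGraphs.
Variables (R : realType) (n k s : nat) (p K sigma rho : R).
Local Notation coord := ('I_n * 'I_n)%type.
Local Notation edge_prob := (@edge_prob R n p).
Local Notation N := (@GRing.natmul R 1 n).
Local Notation L := (ln N).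
Local Notation kR := (@GRing.natmul R 1 k).
Local Notation M := (switch_span sigma).
Local Notation extreme := (@extreme n s).
Local Notation boundary := (@boundary n s).
Local Notation indicator := (@indicator R n).
Hypotheses (p01 : 0 <= p <= 1) (n_ge2 : (2 <= n)%N) (K_ge : 16 * 12 ^+ 4 <= K)
  (regime : hard_regime N L kR (s%:R + 1) K (edge_variance p) sigma rho).
Implicit Types (w : {set coord}) (a b : 'I_n) (X Y S : {set 'I_n}) (f : {ffun 'I_n -> nat}).

Definition switching_controlled w (lam t : R) X Y : Prop :=
  lam * `|switching_stat R w X Y| - lam ^+ 2 * switching_energy R w X Y
    <= 16 * N * M%:R * t.

Let n_gt0 : (0 < n)%N. Proof. exact: leq_trans n_ge2. Qed.

Let N_neq0 : N != 0. Proof. by rewrite pnatr_eq0 -lt0n. Qed.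

Let expR_ln_le : expR (- (3 * L)) <= (N ^+ 2)^-1 / 2.
Proof.
rewrite expRN -invfM lef_pV2 ?posrE ?expR_gt0 ?mulr_gt0 ?exprn_gt0 ?ltr0n //.
exact: double_natr_sqr_le_expR.
Qed.

Let sum_pair_weight : \sum_(ba : 'I_n * 'I_n) (N ^+ 2)^-1 = 1 :> R.
Proof.
rewrite sumr_const card_prod card_ord -[LHS]mulr_natl natrM -expr2 mulfV //.
exact: expf_neq0.
Qed.

Lemma failure_prob_switching_extreme : failure_prob edge_prob (fun w => few_disagreements M w ->
    forall b a, switching_controlled w (extreme_rate sigma) (9 * L)
      (extreme b a (degree_seq w)) (extreme b a (degree_seq w)))
  <= expR (- (6 * L)).
Proof.
have /andP[rate_gt0 rate_le] := extreme_rate_bounds regime.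
apply: le_trans (failure_prob_mono (edge_prob01 p01) _) (@failure_prob_switching R n p p01
  ('I_n * 'I_n)%type M (fun _ _ => (N ^+ 2)^-1) (extreme_rate sigma)
  (fun ba => extreme ba.1 ba.2) (fun ba => extreme ba.1 ba.2) (6 * L) n_gt0 isT _ _ _).
- move=> w controlled few b a; rewrite /switching_controlled.
  by rewrite (_ : 9 * L = 6 * L + 3 * L); [exact: (controlled few (b, a))|ring].
- by move=> *; rewrite invr_ge0 sqr_ge0.
- by move=> f; rewrite sum_pair_weight.
- by rewrite rate_le ltW.
Qed.

(* The sets [S] are weighted by [2^(-|Z|)], [Z] the boundary: both are functions of the
   degrees, which switchings preserve. *)
Lemma failure_prob_switching_subset (Y : 'I_n -> 'I_n -> {set 'I_n} -> {ffun 'I_n -> nat} -> {set 'I_n}) :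
  failure_prob edge_prob (fun w => few_disagreements M w ->
    forall b a S, S \subset boundary b a (degree_seq w) ->
    switching_controlled w (boundary_rate sigma rho) (9 * L + #|boundary b a (degree_seq w)|%:R)
      S (Y b a S (degree_seq w)))
  <= expR (- (6 * L)).
Proof.
have /andP[rate_gt0 rate_le] := boundary_rate_bounds regime.
pose J := ('I_n * 'I_n * {set 'I_n})%type.
pose Z (j : J) f := boundary j.1.1 j.1.2 f.
pose H (j : J) f : R := (N ^+ 2)^-1 * ((j.2 \subset Z j f)%:R * (2 ^+ #|Z j f|)^-1).
apply: le_trans (failure_prob_mono (edge_prob01 p01) _) (@failure_prob_switching R n p p01
  J M H (boundary_rate sigma rho) (fun j _ => j.2) (fun j => Y j.1.1 j.1.2 j.2)
  (6 * L) n_gt0 isT _ _ _).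
- move=> w controlled few b a S S_sub; rewrite /switching_controlled.
  set z := #|boundary b a (degree_seq w)|.
  rewrite (_ : 9 * L + z%:R = 6 * L + (3 * L + z%:R)); last by ring.
  apply: (controlled few (b, a, S)); rewrite /H /Z /= S_sub mul1r opprD expRD mulrAC.
  apply: ler_pM expR_ln_le _; rewrite ?expR_ge0 // expRN lef_pV2 ?posrE ?expR_gt0 ?exprn_gt0 //.
  by rewrite -[z%:R]mulr1 expRM_natl; apply: lerXn2r; rewrite ?nnegrE ?expR_ge0 ?expR_ge2.
- by move=> j f; rewrite !mulr_ge0 // invr_ge0 ?sqr_ge0 // exprn_ge0.
- move=> f; rewrite -(pair_bigA _ (fun ba S => H (ba, S) f)) /=.
  rewrite (eq_bigr (fun=> (N ^+ 2)^-1)) ?sum_pair_weight // => ba _.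
  by rewrite /H /Z /= -mulr_sumr sum_subset_weight mulr1.
- by apply/andP; split; [exact: ltW|lra].
Qed.

Definition regular w : Prop :=
  [/\ forall X Y, `|discrepancy p w X Y| <= 55 * N * sigma,
      forall v, `|centered_degree p w v| <= sigma ^+ 2,
      forall X Y, `|discrepancy p w X Y|
        <= 2 * edge_variance p * (#|X|%:R * #|Y|%:R) / (6 * (sigma * rho ^+ 2))
           + 6 * (sigma * rho ^+ 2) * (6 * L + 3 * N),
      levels_controlled (n := n) k K sigma rho w &
      forall b a,
        switching_controlled w (extreme_rate sigma) (9 * L)
          (extreme b a (degree_seq w)) (extreme b a (degree_seq w)) /\
        forall S, S \subset boundary b a (degree_seq w) ->
          let t := 9 * L + #|boundary b a (degree_seq w)|%:R in
          switching_controlled w (boundary_rate sigma rho) t S (extreme b a (degree_seq w)) /\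
          switching_controlled w (boundary_rate sigma rho) t S S].

Let sigma_ge1 : 1 <= sigma.
Proof.
have [_ _ _ _ _ ? _ _ _ _ _ _] := regime.
by have := regime_sigma_ge regime; lra.
Qed.

Lemma failure_prob_regular : failure_prob edge_prob regular <= 8 * expR (- (6 * L)).
Proof.
have [_ _ _ _ _ _ _ sigma_ge0 sigma2 _ _ _] := regime.
have u_ge : 6 <= 6 * (sigma * rho ^+ 2) by have := regime_sigma_rho2_ge1 regime; lra.
have p01' := @edge_prob01 R n p p01; have and_le := failure_prob_and p01'.
have cuts := and_le _ _ _ _ (failure_prob_cut_variance p01 n_ge2 sigma_ge0 sigma2 sigma_ge1)
  (failure_prob_cut p01 n_ge2 u_ge).
have degrees := and_le _ _ _ _
  (failure_prob_centered_degree_variance p01 n_ge2 sigma2 (regime_ln_le_variance regime))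
  (failure_prob_levels p01 n_ge2 K_ge regime).
have switchings := and_le _ _ _ _ failure_prob_switching_extreme (and_le _ _ _ _
  (failure_prob_switching_subset (fun b a _ => extreme b a))
  (failure_prob_switching_subset (fun _ _ S _ => S))).
apply: le_trans (failure_prob_mono p01' _)
  (le_trans (and_le _ _ _ _ (and_le _ _ _ _ cuts degrees) switchings) _); last by lra.
move=> w [[[cut_le fine_cut_le] [degree_le levels]] [extremes [to_extreme to_self]]].
have few : few_disagreements M w 
    by exact: (few_disagreements_switch_span p01 sigma_ge1 sigma2 degree_le).
split=> // b a; split; first exact: extremes.
by move=> S S_sub; split; [exact: to_extreme|exact: to_self].
Qed.

Section Bounds.
Variable w : {set coord}.
Hypothesis reg : regular w.

Let centered_le X Y (lam t : R) : 0 < lam -> 0 <= t -> switching_controlled w lam t X Y ->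
  `|centered_bilin (centered_adj p w) (indicator X) (indicator Y)| <= 300 * 300 * N
    + lam * (24 * edge_variance p * (#|X|%:R * #|Y|%:R) + 4 * `|discrepancy p w X Y| + 4 * N)
    + 144 * t / lam.
Proof.
have [cut_le degree_le _ _ _] := reg; have [_ _ _ _ _ _ _ _ sigma2 _ _ _] := regime.
exact: (centered_bilin_le_switching p01 n_gt0 sigma_ge1 sigma2 cut_le degree_le).
Qed.

Lemma centered_bilin_extreme_le b a : let X := extreme b a (degree_seq w) in
    #|X|%:R <= 3 * kR ->
  `|centered_bilin (centered_adj p w) (indicator X) (indicator X)| <= 450 * 450 * (N * L).
Proof.
move=> X cardX; have [cut_le _ _ _ switchings] := reg; have [controlled _] := switchings b a.
have [_ /andP[? _] _ _ _ _ _ _ _ _ _ _] := regime.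
have /andP[rate_gt0 _] := extreme_rate_bounds regime; have t_ge0 : 0 <= 9 * L by lra.
apply: le_trans (centered_le rate_gt0 t_ge0 controlled) (regime_extreme_le regime _ (cut_le X X)).
by rewrite ler0n.
Qed.

Lemma centered_bilin_subset_le S Y (z : R) : #|S|%:R <= z -> #|Y|%:R <= 3 * kR ->
    switching_controlled w (boundary_rate sigma rho) (9 * L + z) S Y ->
  `|centered_bilin (centered_adj p w) (indicator S) (indicator Y)|
    <= 450 * 450 * (N * L) + 900 * (sigma * rho ^+ 2 * z).
Proof.
move=> cardS cardY controlled; have [_ _ fine_cut_le _ _] := reg.
have [_ /andP[? _] _ _ _ _ _ _ _ _ _ _] := regime.
have /andP[rate_gt0 _] := boundary_rate_bounds regime.
have t_ge0 : 0 <= 9 * L + z by have := ler0n R #|S|; lra.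
apply: le_trans (centered_le rate_gt0 t_ge0 controlled)
  (regime_subset_le regime _ _ (fine_cut_le S Y)); by rewrite ler0n.
Qed.

End Bounds.
End RegularGraphs.

(** * Discrepancy of the pruned set *)

Section DiscrepancyDecomposition.
Variables (R : realType) (n : nat) (p : R) (w : {set ('I_n * 'I_n)}).
Hypotheses (p01 : 0 <= p <= 1) (n_gt0 : (0 < n)%N).
Local Notation W := (centered_adj p w).
Local Notation N := (@GRing.natmul R 1 n).
Local Notation indicator := (@indicator R n).
Implicit Types (X Y S B C U : {set 'I_n}).

Lemma discrepancy_centered X : discrepancy p w X X
  = centered_bilin W (indicator X) (indicator X)
    + 2 * (#|X|%:R / N) * \sum_(v in X) centered_degree p w v
    - (#|X|%:R / N) ^+ 2 * discrepancy p w setT setT.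
Proof.
rewrite centered_bilinE; last exact: centered_adjC.
rewrite sum_indicator_mul !sum_indicator -discrepancyE discrepancy_row.
have -> : \sum_(v in setT) centered_degree p w v = \sum_v centered_degree p w v.
  by apply: eq_bigl => v; rewrite inE.
rewrite -[\sum_(a in X) row_sum W a]/(\sum_(v in X) centered_degree p w v).
rewrite -[\sum_a row_sum W a]/(\sum_v centered_degree p w v) -exprVn.
by move: (discrepancy _ _ _ _) (\sum_(v in X) _) (\sum_v _) N^-1 => d x y z; ring.
Qed.

Lemma discrepancy_le_centered X : `|discrepancy p w X X|
  <= `|centered_bilin W (indicator X) (indicator X)|
     + 2 * `|\sum_(v in X) centered_degree p w v| + `|discrepancy p w setT setT|.
Proof.
have N_gt0 : 0 < N by rewrite ltr0n.
have ratio_ge0 : 0 <= #|X|%:R / N by rewrite divr_ge0.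
have ratio_le1 : #|X|%:R / N <= 1.
  by rewrite ler_pdivrMr // mul1r ler_nat -[leqRHS]card_ord max_card.
rewrite discrepancy_centered; apply: le_trans (ler_normB _ _) _; apply: lerD; last first.
  by rewrite normrM ger0_norm ?sqr_ge0 // ler_piMl // exprn_ile1.
apply: le_trans (ler_normD _ _) _; rewrite lerD2l -mulrA normrM ger0_norm // ler_wpM2l //.
by rewrite normrM (ger0_norm ratio_ge0) ler_piMl.
Qed.

Lemma centered_bilin_indicatorU_le C S : [disjoint C & S] ->
  `|centered_bilin W (indicator (C :|: S)) (indicator (C :|: S))|
  <= `|centered_bilin W (indicator C) (indicator C)|
     + 2 * `|centered_bilin W (indicator S) (indicator C)|
     + `|centered_bilin W (indicator S) (indicator S)|.
Proof.
move=> dCS; rewrite indicatorU // centered_bilinD; last exact: centered_adjC.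
apply: le_trans (ler_normD _ _) _; rewrite lerD2r.
by apply: le_trans (ler_normD _ _) _; rewrite lerD2l normrM ger0_norm.
Qed.

Lemma discrepancy_change_le X Y B (m : R) :
    (forall v, v \notin B -> (v \in X) = (v \in Y)) -> #|X :|: Y|%:R <= m ->
  `|discrepancy p w X X - discrepancy p w Y Y| <= 2 * #|B|%:R * m.
Proof.
by move=> XY card_le; rewrite !discrepancyE bilin_indicator_diff_le //; exact: centered_adj_norm_le.
Qed.

Lemma sum_change_le (f : 'I_n -> R) X Y B (eta : R) :
    (forall v, v \notin B -> (v \in X) = (v \in Y)) -> (forall v, `|f v| <= eta) ->
  `|\sum_(v in X) f v - \sum_(v in Y) f v| <= #|B|%:R * eta.
Proof.
move=> XY f_le; rewrite big_mkcond [X in _ - X]big_mkcond -sumrB.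
apply: (@le_trans _ _ (\sum_(v in B) eta)); last by rewrite sumr_const mulr_natl.
apply: le_trans (ler_norm_sum _ _ _) _; rewrite [leRHS]big_mkcond; apply: ler_sum => v _.
case: (boolP (v \in B)) => [vB|vB]; last by rewrite XY // subrr normr0.
have eta_ge0 : 0 <= eta by apply: le_trans (f_le v).
by case: (v \in X); case: (v \in Y); rewrite ?subrr ?subr0 ?sub0r ?normrN ?normr0.
Qed.

(* Up to [B], the set [U] is the union of [C] and of the rest [S]. *)
Lemma discrepancy_split_le U B C (m eta : R) : let S := U :\: B :\: C in
    C \subset U :|: B -> #|U :|: B|%:R <= m -> (forall v, `|centered_degree p w v| <= eta) ->
  `|discrepancy p w U U| <= `|centered_bilin W (indicator C) (indicator C)|
     + 2 * `|centered_bilin W (indicator S) (indicator C)|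
     + `|centered_bilin W (indicator S) (indicator S)|
     + 2 * (`|\sum_(v in U) centered_degree p w v| + #|B|%:R * eta)
     + `|discrepancy p w setT setT| + 2 * #|B|%:R * m.
Proof.
move=> S C_sub card_le degree_le; pose Y := C :|: S.
have dCS : [disjoint C & S].
  by rewrite -setI_eq0; apply/eqP/setP => v; rewrite !inE; case: (v \in C); rewrite ?andbF.
have UY v : v \notin B -> (v \in U) = (v \in Y).
  move=> vB; rewrite !inE vB /=; case: (boolP (v \in C)) => vC //=.
  by have := subsetP C_sub v vC; rewrite !inE (negbTE vB) orbF.
have UY_sub : U :|: Y \subset U :|: B.
  rewrite subUset subsetUl subUset C_sub; apply/subsetP => v.
  by rewrite !inE => /andP[_ /andP[_ ->]].
have UY_le : #|U :|: Y|%:R <= m by apply: le_trans card_le; rewrite ler_nat subset_leq_card.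
have disc_diff := discrepancy_change_le UY UY_le; have sum_diff := sum_change_le UY degree_le.
have := discrepancy_le_centered Y; have := centered_bilin_indicatorU_le dCS.
rewrite -/Y => bilin_le Y_le.
have sum_le : `|\sum_(v in Y) centered_degree p w v|
    <= `|\sum_(v in U) centered_degree p w v| + #|B|%:R * eta.
  rewrite -[X in `|X| <= _](subrKC (\sum_(v in U) centered_degree p w v)).
  by apply: le_trans (ler_normD _ _) _; rewrite distrC lerD2l.
rewrite -[X in `|X| <= _](subrKC (discrepancy p w Y Y)).
apply: le_trans (ler_normD _ _) _; apply: lerD disc_diff.
by apply: le_trans Y_le _; rewrite lerD2r lerD // ler_wpM2l.
Qed.

End DiscrepancyDecomposition.

Section Pruning.
Variables (R : realType) (n : nat) (p : R).
Implicit Types (w x : {set ('I_n * 'I_n)}) (f : 'I_n -> R) (B T L : {set 'I_n}) (k s : nat).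

Definition trims k f T L : Prop :=
  [/\ #|T| = k, #|L| = k, [disjoint T & L], is_top f T & is_top (fun v => - f v) L].

Definition rewires B w x : Prop := forall u v, u \notin B -> v \notin B -> adj x u v = adj w u v.

Lemma card_trims k f T L : trims k f T L -> #|T :|: L| = (2 * k)%N.
Proof.
by case=> cardT cardL dTL _ _; rewrite cardsU (disjoint_setI0 dTL) cards0 subn0 cardT cardL mul2n addnn.
Qed.

Lemma centered_degree_le w u v :
  (centered_degree p w u <= centered_degree p w v) = (degree w u <= degree w v)%N.
Proof. by rewrite !centered_degreeE lerD2r ler_nat. Qed.

Lemma rewires_degree_le B w x s v : (#|B| <= s)%N -> rewires B w x -> v \notin B ->
  (degree x v <= degree w v + s)%N && (degree w v <= degree x v + s)%N.
Proof.
move=> cardB x_eq vB.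
have one_side (y z : {set ('I_n * 'I_n)}) : {in ~: B, forall u, adj y v u = adj z v u} ->
    (degree y v <= degree z v + s)%N.
  move=> yz; apply: (@leq_trans (\sum_u (adj z v u + (u \in B)))).
    apply: leq_sum => u _; case: (boolP (u \in B)) => uB; last by rewrite yz ?inE // addn0.
    by apply: leq_trans (leq_b1 _) _; rewrite leq_addl.
  rewrite big_split leq_add2l /=; apply: leq_trans cardB.
  by rewrite -sum1_card [leqRHS]big_mkcond; apply: leq_sum => u _; case: (u \in B).
by apply/andP; split; apply: one_side => u; rewrite inE => uB; rewrite x_eq.
Qed.

Lemma trim_thresholds B w x T L k s : (k < n)%N -> (#|B| <= s)%N -> rewires B w x ->
    trims k (centered_degree p x) T L ->
  exists b a : 'I_n,
    [/\ [set v | (b + s < degree w v)%N] \subset T :|: B,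
        [set v | (degree w v + s < a)%N] \subset L :|: B &
        (T :|: L) :\: B :\: extreme s b a (degree w) \subset boundary s b a (degree w)].
Proof.
move=> k_lt cardB x_eq [cardT cardL _ topT topL].
have cardT_lt : (#|T| < #|'I_n|)%N by rewrite card_ord cardT.
have cardL_lt : (#|L| < #|'I_n|)%N by rewrite card_ord cardL.
have [vb _ [b_max b_min]] := top_threshold cardT_lt topT.
have [va _ [a_max a_min]] := top_threshold cardL_lt topL.
exists (Ordinal (degree_lt x vb)), (Ordinal (degree_lt x va)) => /=.
have near v : v \notin B -> (degree x v <= degree w v + s)%N && (degree w v <= degree x v + s)%N.
  exact: rewires_degree_le.
have T_le v : v \in T -> (degree x vb <= degree x v)%N.
  by move=> /b_min; rewrite centered_degree_le.
have L_le v : v \in L -> (degree x v <= degree x va)%N.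
  by move=> /a_min; rewrite lerN2 centered_degree_le.
split; apply/subsetP => v; rewrite !inE.
- have [vB|vB] := boolP (v \in B); rewrite ?orbT // orbF; apply: contraLR => vT.
  have := b_max v; rewrite inE centered_degree_le => /(_ vT) v_le.
  by have /andP[_ ?] := near v vB; rewrite -leqNgt; lia.
- have [vB|vB] := boolP (v \in B); rewrite ?orbT // orbF; apply: contraLR => vL.
  have := a_max v; rewrite inE lerN2 centered_degree_le => /(_ vL) v_ge.
  by have /andP[? _] := near v vB; rewrite -leqNgt; lia.
rewrite negb_or -!leqNgt => /andP[/andP[v_le v_ge] /andP[vB vTL]].
have /andP[x_le w_le] := near v vB; case/orP: vTL => [/T_le vb_le|/L_le le_va].
  by rewrite v_le andbT (leq_trans vb_le).
by rewrite v_ge /= [X in _ || X](leq_trans w_le) ?orbT // leq_add2r.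
Qed.

End Pruning.

Section PrunedDiscrepancy.
Variables (R : realType) (n k s : nat) (p K : R).
Local Notation coord := ('I_n * 'I_n)%type.
Local Notation edge_prob := (@edge_prob R n p).
Local Notation N := (@GRing.natmul R 1 n).
Local Notation L := (ln N).
Local Notation kR := (@GRing.natmul R 1 k).
Local Notation Q := (N * L + kR * (s%:R + 1)).
Hypotheses (p01 : 0 <= p <= 1) (n_ge2 : (2 <= n)%N) (k_le : (4 * k <= n)%N) (s_le : (s <= k)%N)
  (K_ge : 16 * 12 ^+ 4 <= K).
Implicit Types (w x : {set coord}) (B T Lo : {set 'I_n}).

Definition pruned_discrepancy_bounded w : Prop := forall x B T Lo (eta : R),
  (#|B| <= s)%N -> rewires B w x -> trims k (centered_degree p x) T Lo ->
  (forall v, `|centered_degree p w v| <= eta) ->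
  `|discrepancy p w (T :|: Lo) (T :|: Lo)|
    <= 900 * 900 * 2 * K * Q + 2 * `|\sum_(v in T :|: Lo) centered_degree p w v|
       + `|discrepancy p w setT setT| + s%:R * (2 * eta + 6 * kR).

Let n_gt0 : (0 < n)%N. Proof. exact: leq_trans n_ge2. Qed.

Let K_ge300 : 300 <= K. Proof. by apply: le_trans K_ge; lra. Qed.

Section Hard.
Variables sigma rho : R.
Hypothesis regime : hard_regime N L kR (s%:R + 1) K (edge_variance p) sigma rho.

Lemma regular_bilin_le w (U B : {set 'I_n}) (b a : 'I_n) :
    let C := extreme s b a (degree w) in let S := U :\: B :\: C in
    let Z := boundary s b a (degree w) in
    regular (n := n) k s p K sigma rho w -> S \subset Z ->
    #|C|%:R <= 3 * kR -> #|[set v | (b + s < degree w v)%N]|%:R <= 2 * kR ->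
    #|[set v | (degree w v + s < a)%N]|%:R <= 2 * kR ->
  `|centered_bilin (centered_adj p w) (indicator R C) (indicator R C)|
  + 2 * `|centered_bilin (centered_adj p w) (indicator R S) (indicator R C)|
  + `|centered_bilin (centered_adj p w) (indicator R S) (indicator R S)|
  <= 900 * 900 * 2 * K * Q.
Proof.
move=> C S Z reg S_sub cardC above below.
have [_ _ _ levels /(_ b a)[_ switchings]] := reg.
have extremeE : extreme s b a (degree_seq w) = C by apply/setP => v; rewrite !inE ffunE.
have boundaryE : boundary s b a (degree_seq w) = Z by apply/setP => v; rewrite !inE ffunE.
rewrite boundaryE extremeE in switchings; have [S_C S_S] := switchings S S_sub.
have [cardZ scaledZ] := regime_boundary_le regime (card_boundary_le regime levels above below).
have cardS : #|S|%:R <= #|Z|%:R :> R by rewrite ler_nat subset_leq_card.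
have cardS3 : #|S|%:R <= 3 * kR by apply: le_trans cardS _; have := ler0n R k; lra.
have C_le := centered_bilin_extreme_le p01 n_ge2 regime reg (b := b) (a := a).
rewrite /= extremeE in C_le.
have SC_le := centered_bilin_subset_le p01 n_ge2 regime reg cardS cardC S_C.
have SS_le := centered_bilin_subset_le p01 n_ge2 regime reg cardS cardS3 S_S.
have [NL_ge0 ks_ge0 K_ge0 _] := regime_ge0 regime.
have NL_le : 300 * (N * L) <= K * (N * L) by rewrite ler_wpM2r.
have Kks_ge0 : 0 <= K * (kR * (s%:R + 1)) by rewrite mulr_ge0.
have {}C_le := C_le cardC.
by clear -C_le SC_le SS_le scaledZ NL_ge0 NL_le Kks_ge0; lra.
Qed.

Lemma regular_pruned_discrepancy w : regular (n := n) k s p K sigma rho w ->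
  pruned_discrepancy_bounded w.
Proof.
move=> reg x B T Lo eta cardB x_eq trim degree_le; set U := T :|: Lo.
have k_lt : (k < n)%N by move: n_ge2 k_le; clear; lia.
have [b [a [above below rest]]] := trim_thresholds k_lt cardB x_eq trim.
have [cardT cardL _ _ _] := trim; have cardU := card_trims trim.
pose C := extreme s b a (degree w).
have C_sub : C \subset U :|: B.
  apply/subsetP => v; rewrite inE => /orP[v_high|v_low].
    by have := subsetP above v; rewrite !inE v_high => /(_ isT) /orP[->|->]; rewrite ?orbT.
  by have := subsetP below v; rewrite !inE v_low => /(_ isT) /orP[->|->]; rewrite ?orbT.
have card_le (X Y : {set 'I_n}) m : X \subset Y :|: B -> (#|Y| + s <= m)%N -> #|X|%:R <= m%:R :> R.
  move=> X_sub Y_le; rewrite ler_nat (leq_trans (subset_leq_card X_sub)) //.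
  by apply: leq_trans Y_le; apply: leq_trans (leq_card_setU _ _) _; rewrite leq_add2l.
have two_k (Y : {set 'I_n}) : #|Y| = k -> (#|Y| + s <= 2 * k)%N by move=> ->; rewrite mul2n -addnn leq_add2l.
have three_k : (#|U| + s <= 3 * k)%N by rewrite cardU mulSn addnC leq_add2r.
have := regular_bilin_le (U := U) (B := B) reg rest; rewrite -/C -!natrM => bilin_le.
have {}bilin_le := bilin_le (card_le _ _ _ C_sub three_k) (card_le _ _ _ above (two_k _ cardT))
  (card_le _ _ _ below (two_k _ cardL)).
have UB_le := card_le _ _ _ (subxx (U :|: B)) three_k.
apply: le_trans (discrepancy_split_le p01 n_gt0 C_sub UB_le degree_le) _.
have eta_ge0 : 0 <= eta by apply: le_trans (degree_le (Ordinal n_gt0)).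
have B_le : #|B|%:R <= s%:R :> R by rewrite ler_nat.
have B_eta : #|B|%:R * eta <= s%:R * eta by rewrite ler_wpM2r.
have B_k : #|B|%:R * kR <= s%:R * kR by rewrite ler_wpM2r.
by rewrite natrM; clear -bilin_le B_eta B_k; lra.
Qed.

End Hard.

Lemma target_error_ge0 : 0 <= N * L /\ 0 <= kR * (s%:R + 1).
Proof.
have N_ge2 := natr_ge2 R n_ge2; have L_ge := ln_natr_ge R n_ge2.
by split; rewrite mulr_ge0 ?addr_ge0 //; lra.
Qed.

Lemma easy_pruned_discrepancy w (sigma rho : R) : kR * sigma * rho <= 1000 * K * Q ->
    (forall X : {set 'I_n}, #|X| = (2 * k)%N ->
      `|discrepancy p w X X| <= 12 * kR * sigma * rho + 90 * N * L) ->
  pruned_discrepancy_bounded w.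
Proof.
move=> easy disc_le x B T Lo eta _ _ trim degree_le.
have eta_ge0 : 0 <= eta by apply: le_trans (degree_le (Ordinal n_gt0)).
have rest_ge0 : 0 <= s%:R * (2 * eta + 6 * kR) by rewrite mulr_ge0 // addr_ge0 // mulr_ge0.
have sum_ge0 := normr_ge0 (\sum_(v in T :|: Lo) centered_degree p w v).
have total_ge0 := normr_ge0 (discrepancy p w setT setT).
apply: le_trans (disc_le _ (card_trims trim)) _.
have [NL_ge0 ks_ge0] := target_error_ge0.
have NL_le : 300 * (N * L) <= K * (N * L) by rewrite ler_wpM2r.
have Kks_ge0 : 0 <= K * (kR * (s%:R + 1)) by rewrite mulr_ge0 // (le_trans _ K_ge300).
by clear -easy rest_ge0 sum_ge0 total_ge0 NL_ge0 NL_le Kks_ge0; lra.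
Qed.

Lemma exists_fourth_root (y : R) : 0 < y <= 1 -> exists2 rho : R, 0 < rho <= 1 & rho ^+ 4 = y.
Proof.
move=> /andP[y_gt0 y_le1]; exists (Num.sqrt (Num.sqrt y)).
  by rewrite !sqrtr_gt0 y_gt0 -sqrtr1 ler_sqrt // -sqrtr1 ler_sqrt.
by rewrite (exprM _ 2 2) !sqr_sqrtr ?sqrtr_ge0 // ltW.
Qed.

Lemma failure_prob_pruned_discrepancy :
  failure_prob edge_prob pruned_discrepancy_bounded <= 8 * expR (- (6 * L)).
Proof.
have p01' := @edge_prob01 R n p p01; have expR_pos := expR_ge0 (- (6 * L)).
have N_ge2 := natr_ge2 R n_ge2; have L_ge := ln_natr_ge R n_ge2; have L_le := ln_natr_le R n_ge2.
pose sigma := Num.sqrt (N * edge_variance p); have sigma_ge0 : 0 <= sigma by exact: sqrtr_ge0.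
have sigma2 : sigma ^+ 2 = N * edge_variance p by rewrite sqr_sqrtr // mulr_ge0 ?edge_variance_ge0.
have [NL_ge0 ks_ge0] := target_error_ge0.
have [k_eq0|k_gt0] := posnP k.
  have KQ_ge0 : 0 <= K * Q by rewrite mulr_ge0 ?addr_ge0 // (le_trans _ K_ge300).
  apply: le_trans (failure_prob_mono p01' _)
    (le_trans (failure_prob_discrepancy_total p01 n_ge2) _); last by lra.
  move=> w _; apply: (easy_pruned_discrepancy (sigma := 0) (rho := 0)) => [|X].
    by rewrite !mulr0; lra.
  rewrite k_eq0 muln0 => /eqP; rewrite cards_eq0 => /eqP ->.
  by rewrite /discrepancy big_set0 normr0 mulr0 add0r -mulrA mulr_ge0.
have kN_le : 4 * kR <= N by rewrite -(natrM R 4) ler_nat.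
have kN01 : 0 < kR / N <= 1.
  by rewrite divr_gt0 ?ltr0n // ler_pdivrMr ?mul1r; have := ler0n R k; lra.
have [rho rho01 rho4] := exists_fourth_root kN01.
have {}rho4 : rho ^+ 4 * N = kR by rewrite rho4 divfK // gt_eqF //; lra.
have [easy|hard] := leP (kR * sigma * rho) (1000 * K * Q).
  apply: le_trans (failure_prob_mono p01' _) (le_trans
    (failure_prob_discrepancy_square p01 n_ge2 sigma_ge0 sigma2 k_gt0 rho01 rho4) _); last by lra.
  by move=> w; exact: easy_pruned_discrepancy.
have regime : hard_regime N L kR (s%:R + 1) K (edge_variance p) sigma rho.
  by split=> //; rewrite ?ler1n ?lerDr ?edge_variance_ge0 ?edge_variance_le ?L_ge //; lra.
apply: le_trans (failure_prob_mono p01' _) (failure_prob_regular p01 n_ge2 K_ge regime).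
by move=> w; exact: regular_pruned_discrepancy.
Qed.

End PrunedDiscrepancy.

(** * Corruption and estimation errors *)

Section Corruption.
Variables (R : realType) (n k s m : nat) (p : R).
Local Notation coord := ('I_n * 'I_n)%type.
Local Notation N := (@GRing.natmul R 1 n).
Local Notation kR := (@GRing.natmul R 1 k).
Local Notation sR := (@GRing.natmul R 1 s).
Variables (w x : {set coord}) (B T L T0 L0 : {set 'I_n}) (eta F : R).
Local Notation U := (T :|: L).
Hypotheses (p01 : 0 <= p <= 1) (n_ge2 : (2 <= n)%N) (k_lt : (4 * k < n)%N) (s_le : (s <= k)%N)
  (m_le : m%:R <= n.-1%:R * p) (m_gt : n.-1%:R * p < m%:R + 1)
  (cardB : (#|B| <= s)%N) (x_eq : rewires B w x)
  (trim : trims k (centered_degree p x) T L) (true_trim : trims k (centered_degree p w) T0 L0)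
  (degree_le : forall v, `|centered_degree p w v| <= eta)
  (soft_le : forall i : 'I_n.+1,
     `|\sum_v soft_threshold i%:R ((degree w v)%:R - m%:R)| <= F).

Let n_gt0 : (0 < n)%N. Proof. exact: leq_trans n_ge2. Qed.

Let k_lt_n : (k < n)%N. Proof. by apply: leq_ltn_trans k_lt; rewrite leq_pmull. Qed.

Let ks_lt : kR + sR < N.
Proof.
rewrite -natrD ltr_nat; apply: leq_ltn_trans k_lt; apply: (@leq_trans (k + k)).
  by rewrite leq_add2l.
by rewrite addnn -mul2n leq_mul2r orbT.
Qed.

Let cardB_le : #|B|%:R <= sR. Proof. by rewrite ler_nat. Qed.

Let eta_ge0 : 0 <= eta. Proof. exact: le_trans (degree_le (Ordinal n_gt0)). Qed.

Let centered_degree_rewired v : v \notin B -> `|centered_degree p x v - centered_degree p w v| <= sR.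
Proof.
move=> vB; have /andP[] := rewires_degree_le cardB x_eq vB; rewrite !centered_degreeE.
by rewrite -2!(ler_nat R) !natrD => ? ?; rewrite ler_norml; apply/andP; lra.
Qed.

Let oppr_degree_rewired v :
  v \notin B -> `|- centered_degree p x v - - centered_degree p w v| <= sR.
Proof. by move=> vB; rewrite -opprD normrN; exact: centered_degree_rewired. Qed.

Let degree_near v : `|centered_degree p w v - 0| <= eta. Proof. by rewrite subr0. Qed.

Let oppr_degree_near v : `|- centered_degree p w v - 0| <= eta. Proof. by rewrite subr0 normrN. Qed.

Lemma survivor_degree_le v : v \notin U -> `|centered_degree p x v| <= eta + sR.
Proof.
have [cardT cardL _ topT topL] := trim.
rewrite inE negb_or => /andP[vT vL].
have cardT_lt : (#|T| < #|'I_n|)%N by rewrite card_ord cardT.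
have cardL_lt : (#|L| < #|'I_n|)%N by rewrite card_ord cardL.
have [b bT [b_max b_min]] := top_threshold cardT_lt topT.
have [a aL [a_max a_min]] := top_threshold cardL_lt topL.
have b_near : `|centered_degree p x b - 0| <= eta + sR.
  apply: (threshold_near (f := centered_degree p w) (B := B) (T := T)) => //;
  by rewrite ?cardT ?card_ord ?ler_nat.
have a_near : `|- centered_degree p x a - 0| <= eta + sR.
  apply: (threshold_near (f := fun u => - centered_degree p w u)
    (g := fun u => - centered_degree p x u) (B := B) (T := L)) => //;
  by rewrite ?cardL ?card_ord ?ler_nat.
have := b_max v; have := a_max v; rewrite !inE => /(_ vL) le_a /(_ vT) le_b.
move: a_near b_near; rewrite !subr0 !ler_norml => /andP[_ ?] /andP[_ ?].
by apply/andP; split; lra.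
Qed.

Lemma true_trim_le : `|\sum_(v in T0) centered_degree p w v + \sum_(v in L0) centered_degree p w v|
  <= 3 * F + 2 * kR.
Proof.
have [cardT cardL _ topT topL] := true_trim; have /andP[p_ge0 p_le1] := p01.
have pred_n : n.-1%:R = N - 1 :> R by rewrite -subn1 natrB.
pose c : R := m%:R - (N - 1) * p; pose f v := centered_degree p w v - c.
have fE v : f v = (degree w v)%:R - m%:R by rewrite /f centered_degreeE /c; ring.
have c_le1 : `|c| <= 1.
  by move: m_le m_gt; rewrite pred_n /c => ? ?; rewrite ler_norml; apply/andP; lra.
have m_le_n : (m <= n)%N.
  rewrite -(ler_nat R); apply: le_trans m_le _; rewrite (le_trans (ler_piMr _ p_le1)) //.
  by rewrite ler_nat leq_pred.
have soft_f v : `|\sum_u soft_threshold `|f v| (f u)| <= F.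
  have i_lt : (`|degree w v - m| < n.+1)%N.
    by have deg_lt := degree_lt w v; move: m_le_n deg_lt; lia.
  have := soft_le (Ordinal i_lt); rewrite /= natr_absz intr_norm rmorphB /= -[_ - _]fE.
  by under eq_bigr => u _ do rewrite -fE.
have soft_0 : `|\sum_v f v| <= F.
  have := soft_le ord0; congr (`|_| <= _); apply: eq_bigr => v _.
  by rewrite soft_threshold0 fE.
have trimmed : `|\sum_(v in T0) f v + \sum_(v in L0) f v| <= 3 * F.
  apply: trimmed_sum_le; rewrite ?cardT ?cardL ?card_ord //.
    by move=> u v uT vT; rewrite lerD2r topT.
  by move=> u v uL vL; have := topL u v uL vL; rewrite !lerN2 lerD2r.
have sum_f (X : {set 'I_n}) : \sum_(v in X) centered_degree p w v = \sum_(v in X) f v + #|X|%:R * c.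
  by rewrite sumrB sumr_const mulr_natl subrK.
rewrite !sum_f cardT cardL addrACA; apply: le_trans (ler_normD _ _) _; apply: lerD => //.
rewrite (_ : kR * c + kR * c = 2 * kR * c); last by ring.
by rewrite normrM ger0_norm ?mulr_ge0 // ler_piMr // mulr_ge0.
Qed.

Lemma sum_pruned_le : `|\sum_(v in U) centered_degree p w v|
  <= 3 * F + 2 * kR + 4 * kR * sR + 8 * sR * (eta + sR).
Proof.
have [cardT cardL dTL topT topL] := trim; have [cardT0 cardL0 _ topT0 topL0] := true_trim.
have T_le := top_exchange (ler0n R s) eta_ge0 cardB_le (U := T0) _ _ degree_near
  centered_degree_rewired topT _ topT0.
have L_le := top_exchange (ler0n R s) eta_ge0 cardB_le (U := L0) _ _ oppr_degree_near
  oppr_degree_rewired topL _ topL0.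
rewrite cardT cardT0 card_ord ler_nat in T_le; rewrite cardL cardL0 card_ord ler_nat !sumrN in L_le.
have := T_le s_le ks_lt erefl; have := L_le s_le ks_lt erefl; have := true_trim_le.
have -> : \sum_(v in U) centered_degree p w v
    = \sum_(v in T) centered_degree p w v + \sum_(v in L) centered_degree p w v.
  by rewrite -bigU //=; apply: eq_bigl => v; rewrite !inE.
rewrite !ler_norml => /andP[? ?] /andP[? ?] /andP[? ?].
by apply/andP; split; lra.
Qed.

Lemma sum_survivor_row_le (y : {set coord}) v (b : R) : `|centered_degree p y v| <= b ->
  `|\sum_(u in ~: U) centered_adj p y v u| <= b + 2 * kR.
Proof.
move=> row_le.
have -> : \sum_(u in ~: U) centered_adj p y v u
    = centered_degree p y v - \sum_(u in U) centered_adj p y v u.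
  rewrite /centered_degree [in RHS](bigID (mem U)) /= addrAC subrr add0r.
  by apply: eq_bigl => u; rewrite inE.
apply: le_trans (ler_normB _ _) _; apply: lerD => //.
rewrite -[2 * kR]mulr1; apply: norm_sum_card_le => [//||u _].
  by rewrite (card_trims trim) natrM.
exact: centered_adj_norm_le.
Qed.

Let adj_diff u v : R := centered_adj p x u v - centered_adj p w u v.

Let adj_diff_norm_le u v : `|adj_diff u v| <= 1.
Proof.
rewrite /adj_diff /centered_adj; case: eqP => _; first by rewrite subrr normr0.
by case: (adj x u v); case: (adj w u v); rewrite ?mulr1n ?mulr0n ler_norml; apply/andP; lra.
Qed.

Let row_diff_le u : u \notin U -> `|\sum_(v in ~: U) adj_diff u v| <= 2 * eta + sR + 4 * kR.
Proof.
move=> uU; rewrite sumrB; apply: le_trans (ler_normB _ _) _.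
have := sum_survivor_row_le (survivor_degree_le uU); have := sum_survivor_row_le (degree_le u).
by lra.
Qed.

Lemma discrepancy_rewired_le : `|discrepancy p x (~: U) (~: U) - discrepancy p w (~: U) (~: U)|
  <= sR * (4 * eta + 3 * sR + 8 * kR).
Proof.
set S := ~: U; have adj_diffC u v : adj_diff u v = adj_diff v u.
  by rewrite /adj_diff !(centered_adjC p _ u).
have adj_diff0 u v : u \notin B -> v \notin B -> adj_diff u v = 0.
  by move=> uB vB; rewrite /adj_diff /centered_adj x_eq // subrr.
have -> : discrepancy p x S S - discrepancy p w S S = \sum_(u in S) \sum_(v in S) adj_diff u v.
  by rewrite -sumrB; apply: eq_bigr => u _; rewrite -sumrB.
have cardSB : #|S :&: B|%:R <= sR.
  by apply: le_trans cardB_le; rewrite ler_nat subset_leq_card ?subsetIr.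
have row_inside u : `|\sum_(v in S :&: B) adj_diff u v| <= sR.
  by rewrite -[sR]mulr1; apply: norm_sum_card_le.
have row_le u : u \in S -> `|\sum_(v in S) adj_diff u v| <= 2 * eta + sR + 4 * kR.
  by rewrite inE => uU; exact: row_diff_le.
rewrite (big_setID B) /=.
have -> : \sum_(u in S :\: B) \sum_(v in S) adj_diff u v
    = \sum_(v in S :&: B) (\sum_(u in S) adj_diff v u - \sum_(u in S :&: B) adj_diff v u).
  transitivity (\sum_(u in S :\: B) \sum_(v in S :&: B) adj_diff u v).
    apply: eq_bigr => u; rewrite inE => /andP[uB _]; rewrite (big_setID B) /=.
    by rewrite [X in _ + X]big1 ?addr0 // => v; rewrite inE => /andP[vB _]; exact: adj_diff0.
  rewrite exchange_big; apply: eq_bigr => v _ /=; rewrite [X in _ = X - _](big_setID B) /=.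
  by rewrite addrAC subrr add0r; apply: eq_bigr => u _.
have row_bound_ge0 : 0 <= 2 * eta + sR + 4 * kR by rewrite !addr_ge0 // mulr_ge0.
have inside_le : `|\sum_(u in S :&: B) \sum_(v in S) adj_diff u v| <= sR * (2 * eta + sR + 4 * kR).
  by apply: norm_sum_card_le => // u; rewrite inE => /andP[uS _]; exact: row_le.
apply: le_trans (ler_normD _ _) (le_trans (lerD inside_le (norm_sum_card_le
  (c := 2 * eta + sR + 4 * kR + sR) _ cardSB _)) _); rewrite ?addr_ge0 ?mulr_ge0 //.
  move=> u; rewrite inE => /andP[uS _]; apply: le_trans (ler_normB _ _) _.
  by apply: lerD; [exact: row_le|exact: row_inside].
by lra.
Qed.

Lemma discrepancy_setC (y : {set coord}) (X : {set 'I_n}) : discrepancy p y (~: X) (~: X)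
  = discrepancy p y setT setT - 2 * (\sum_(v in X) centered_degree p y v) + discrepancy p y X X.
Proof.
have wC := centered_adjC p y.
have dX : [disjoint X & ~: X] by rewrite -setI_eq0 setICr.
have indT : indicator R setT = (fun a => indicator R X a + indicator R (~: X) a).
  by rewrite -indicatorU // setUCr.
rewrite -discrepancy_row !discrepancyE indT !bilinDl !(bilinDr wC).
by rewrite (bilinC wC (indicator R (~: X)) (indicator R X)); ring.
Qed.

Lemma survivor_discrepancy_le (total pruned_disc : R) :
    `|discrepancy p w setT setT| <= total -> `|discrepancy p w U U| <= pruned_disc ->
  `|discrepancy p x (~: U) (~: U)| <= sR * (4 * eta + 3 * sR + 8 * kR) + total
     + 2 * (3 * F + 2 * kR + 4 * kR * sR + 8 * sR * (eta + sR)) + pruned_disc.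
Proof.
have := discrepancy_rewired_le; have := sum_pruned_le; rewrite (discrepancy_setC w).
rewrite !ler_norml => /andP[? ?] /andP[? ?] /andP[? ?] /andP[? ?].
by apply/andP; split; lra.
Qed.

End Corruption.

Section Estimators.
Variables (R : realType) (n : nat) (p : R).
Implicit Types (G : sgraph n) (S : {set 'I_n}).

Lemma deg_induced G S v : v \in S ->
  deg (induced (edges G) S) v = (\sum_(u in S) adj (graph_coords G) v u)%N.
Proof.
move=> vS; rewrite deg_neighbours; last by rewrite induced_card2 ?edgesP.
rewrite -sum1_card big_mkcond [RHS]big_mkcond; apply: eq_bigr => u _.
rewrite !inE adj_graph_coords subUset !sub1set vS /= eq_sym.
by case: (u \in S); case: (v != u) => //=; case: (_ \in _); rewrite ?andbF.
Qed.

Lemma deg_induced_notin G S v : v \notin S -> deg (induced (edges G) S) v = 0%N.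
Proof.
move=> vS; apply/eqP; rewrite cards_eq0; apply/eqP/setP => e; rewrite !inE.
by apply/negP => /andP[/andP[_ eS] ve]; rewrite (subsetP eS) in vS.
Qed.

Lemma sum_centered_adj_row G S v : v \in S -> \sum_(u in S) centered_adj p (graph_coords G) v u
  = (deg (induced (edges G) S) v)%:R - (#|S|%:R - 1) * p.
Proof.
move=> vS; rewrite deg_induced // natr_sum.
have -> : (#|S|%:R - 1) * p = \sum_(u in S) (p - (u == v)%:R * p).
  rewrite sumrB sumr_const -(mulr_natl p) (bigD1 v) //= eqxx mul1r big1 ?addr0; first by ring.
  by move=> u /andP[_ /negbTE ->]; rewrite mul0r.
rewrite -sumrB; apply: eq_bigr => u uS; rewrite /centered_adj eq_sym; case: eqP => [->|_].
  by rewrite adj_irrefl /= mul1r subrr subr0.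
by rewrite mul0r subr0.
Qed.

Lemma discrepancy_induced G S : discrepancy p (graph_coords G) S S
  = 2 * #|induced (edges G) S|%:R - #|S|%:R * (#|S|%:R - 1) * p.
Proof.
have handshake : 2 * #|induced (edges G) S|%:R
    = \sum_(v in S) (deg (induced (edges G) S) v)%:R :> R.
  rewrite -natrM -sum_deg; last by rewrite induced_card2 ?edgesP.
  rewrite natr_sum (bigID (mem S)) /= [X in _ + X]big1 ?addr0 // => v vS.
  by rewrite deg_induced_notin.
rewrite handshake; transitivity (\sum_(v in S)
    ((deg (induced (edges G) S) v)%:R - (#|S|%:R - 1) * p)).
  by apply: eq_bigr => v; exact: sum_centered_adj_row.
by rewrite sumrB sumr_const -[_ *+ #|S|]mulr_natl mulrA.
Qed.

Lemma mean_estimate_error G S : (2 <= #|S|)%N -> `|mean_estimate R (edges G) S - p|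
  = `|discrepancy p (graph_coords G) S S| / (#|S|%:R * (#|S|%:R - 1)).
Proof.
move=> cardS; rewrite discrepancy_induced /mean_estimate.
have cardS_ge2 : 2 <= #|S|%:R :> R by rewrite (ler_nat R 2).
have pairs : 2 * 'C(#|S|, 2)%:R = #|S|%:R * (#|S|%:R - 1) :> R.
  by rewrite -natrM mul_bin_left /= bin1 natrM mulrC natrB 1?ltnW.
have pairs_gt0 : 0 < #|S|%:R * (#|S|%:R - 1) :> R by apply: mulr_gt0; lra.
have bin_gt0 : 0 < 'C(#|S|, 2)%:R :> R by lra.
rewrite -[X in _ = _ / X](gtr0_norm pairs_gt0) -normfV -normrM -pairs; congr `|_|.
by field; rewrite gt_eqF.
Qed.

Lemma median_bounds (ds : seq nat) (lo hi : R) : (0 < size ds)%N ->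
  {in ds, forall d, lo <= d%:R <= hi} -> lo <= median R ds <= hi.
Proof.
move=> size_gt0 ds_bounds; rewrite /median; set t := sort leq ds.
have size_t : size t = size ds by rewrite size_sort.
have nth_bounds i : (i < size ds)%N -> lo <= (nth 0%N t i)%:R <= hi.
  by move=> i_lt; apply: ds_bounds; rewrite -(mem_sort leq) mem_nth ?size_t.
have /andP[? ?] := nth_bounds ((size t).-1 %/ 2)%N ltac:(by rewrite size_t; lia).
have /andP[? ?] := nth_bounds (size t %/ 2)%N ltac:(by rewrite size_t; lia).
by apply/andP; split; lra.
Qed.

Lemma median_estimate_error G S (del : R) : (2 <= #|S|)%N ->
    {in S, forall v, `|\sum_(u in S) centered_adj p (graph_coords G) v u| <= del} ->
  `|median_estimate R (edges G) S - p| <= del / (#|S|%:R - 1).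
Proof.
move=> cardS row_le; rewrite /median_estimate.
have cardS_ge2 : 2 <= #|S|%:R :> R by rewrite (ler_nat R 2).
have cardS_gt1 : 0 < #|S|%:R - 1 :> R by lra.
set ds := [seq _ | v <- enum S].
have /andP[median_ge median_le] :
    (#|S|%:R - 1) * p - del <= median R ds <= (#|S|%:R - 1) * p + del.
  apply: median_bounds => [|d /mapP[v]]; first by rewrite size_map -cardE ltnW.
  rewrite mem_enum => vS ->; have := row_le v vS.
  by rewrite sum_centered_adj_row // ler_norml => /andP[? ?]; apply/andP; split; lra.
rewrite -subn1 natrB 1?ltnW // ler_pdivlMr // -[X in _ * X](gtr0_norm cardS_gt1) -normrM.
by rewrite mulrBl divfK ?gt_eqF // ler_norml; apply/andP; split; lra.
Qed.

End Estimators.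

Lemma combined_error_le (R : realFieldType) (N L k s r C F total D : R) :
    2 <= N -> 1 / 2 <= L -> 0 <= s <= k -> 4 * k <= N -> r ^+ 2 = N * L -> 0 <= C ->
    F = 4 * N + 6 * N * (1 + (6 * L + 3 * L)) -> total = 6 * N * (1 + (6 * L + 1)) ->
    D = 3 * F + 2 * k + 4 * k * s + 8 * s * (60 * r + s) ->
  s * (4 * (60 * r) + 3 * s + 8 * k) + total + 2 * D
    + (C * (N * L + k * (s + 1)) + 2 * D + total + s * (2 * (60 * r) + 6 * k))
  <= (2 * C + 3000) * (N * L + k * s).
Proof.
move=> N_ge2 L_ge /andP[s_ge0 s_le] k_le r_sqr C_ge0 -> -> ->.
have sr_le : 2 * (s * r) <= s * s + N * L by have := sqr_ge0 (s - r); rewrite -r_sqr; lra.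
have ss_le : s * s <= k * s by apply: ler_wpM2r.
have N_le : N * (1 / 2) <= N * L by apply: ler_wpM2l; lra.
have ks_ge0 : 0 <= k * s by apply: mulr_ge0; lra.
have Ck_le : C * k <= C * (N * L) by apply: ler_wpM2l => //; lra.
have Cks_ge0 : 0 <= C * (k * s) by apply: mulr_ge0.
by lra.
Qed.

Lemma card_survivors (R : realFieldType) (n k : nat) (X : {set 'I_n}) :
    (2 <= n)%N -> (4 * k < n)%N -> #|X| = (2 * k)%N ->
  [/\ (2 <= #|~: X|)%N, n%:R / 4 <= #|~: X|%:R - 1 :> R
    & n%:R ^+ 2 / 8 <= #|~: X|%:R * (#|~: X|%:R - 1) :> R].
Proof.
move=> n_ge2 k_lt cardX; have : (#|~: X| = n - 2 * k)%N by rewrite cardsCs setCK cardX card_ord.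
move: #|~: X| => m m_eq; have m_ge2 : (2 <= m)%N by lia.
have n_le : n%:R <= 2 * m%:R :> R by rewrite -(natrM R 2) ler_nat; lia.
have m_ge2R : 2 <= m%:R :> R by rewrite (ler_nat R 2).
have quarter_le : n%:R / 4 <= m%:R - 1 :> R by lra.
split=> //; apply: (@le_trans _ _ (n%:R / 2 * (n%:R / 4))); first by rewrite expr2; lra.
by apply: ler_pM => //; [exact: divr_ge0|exact: divr_ge0|lra].
Qed.

Section TypicalGraphs.
Variables (R : realType) (n k s : nat) (p K : R).
Local Notation coord := ('I_n * 'I_n)%type.
Local Notation N := (@GRing.natmul R 1 n).
Local Notation L := (ln N).
Local Notation kR := (@GRing.natmul R 1 k).
Local Notation sR := (@GRing.natmul R 1 s).
Local Notation m := (Num.truncn (n.-1%:R * p)).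
Hypotheses (p01 : 0 <= p <= 1) (n_ge2 : (2 <= n)%N) (k_lt : (4 * k < n)%N) (s_le : (s <= k)%N)
  (K_ge : 16 * 12 ^+ 4 <= K).

Definition typical (w : {set coord}) : Prop :=
  [/\ forall v, `|centered_degree p w v| <= 60 * Num.sqrt (N * L),
      `|discrepancy p w setT setT| <= 6 * N * (1 + (6 * L + 1)),
      forall i : 'I_n.+1, `|\sum_v soft_threshold i%:R ((degree w v)%:R - m%:R)|
        <= 4 * N + 6 * N * (1 + (6 * L + 3 * L))
    & pruned_discrepancy_bounded k s p K w].

Lemma truncn_mean_bounds : m%:R <= n.-1%:R * p /\ n.-1%:R * p < m%:R + 1.
Proof.
have /andP[p_ge0 _] := p01.
by have /andP[? ?] := truncn_itv (mulr_ge0 (ler0n R n.-1) p_ge0); rewrite natr1.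
Qed.

Lemma failure_prob_typical : failure_prob (@edge_prob R n p) typical <= N ^- 2.
Proof.
have N_ge2 := natr_ge2 R n_ge2; have [m_le m_gt] := truncn_mean_bounds.
have p01' := @edge_prob01 R n p p01; have and_le := failure_prob_and p01'.
have global := and_le _ _ _ _ (failure_prob_centered_degree p01 n_ge2)
  (failure_prob_discrepancy_total p01 n_ge2).
have local := and_le _ _ _ _ (failure_prob_soft_threshold p01 (6 * L) (ltnW n_ge2) m_le m_gt
  (double_natrS_le_expR R n_ge2)) (failure_prob_pruned_discrepancy p01 n_ge2 (ltnW k_lt) s_le K_ge).
apply: le_trans (failure_prob_mono p01' _) (le_trans (and_le _ _ _ _ global local) _).
  by move=> w [[? ?] [? ?]].
have N2_gt0 : 0 < N ^+ 2 by rewrite exprn_gt0 // ltr0n (leq_trans _ n_ge2).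
have N4_ge : 2 ^+ 4 <= N ^+ 4 by rewrite lerXn2r ?nnegrE.
rewrite expRN (expR_mul_ln R n_ge2 6) (exprD _ 2 4) invfM.
rewrite (_ : _ + _ = N ^- 2 * (11 / N ^+ 4)); last by ring.
rewrite ler_piMr ?invr_ge0 ?(ltW N2_gt0) // ler_pdivrMr; lra.
Qed.

Variables (w x : {set coord}) (B T Lo T0 L0 : {set 'I_n}).
Hypotheses (typ : typical w) (cardB : (#|B| <= s)%N) (x_eq : rewires B w x)
  (trim : trims k (centered_degree p x) T Lo) (true_trim : trims k (centered_degree p w) T0 L0).
Local Notation S := (~: (T :|: Lo)).

Lemma typical_survivor_discrepancy :
  `|discrepancy p x S S| <= (2 * (900 * 900 * 2 * K) + 3000) * (N * L + kR * sR).
Proof.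
have [degree_le total_le soft_le pruned_bounded] := typ; have [m_le m_gt] := truncn_mean_bounds.
have N_ge2 := natr_ge2 R n_ge2; have L_ge := ln_natr_ge R n_ge2.
have r_sqr : Num.sqrt (N * L) ^+ 2 = N * L.
  by rewrite sqr_sqrtr // mulr_ge0 // (le_trans _ L_ge) ?divr_ge0.
have sum_le := sum_pruned_le p01 n_ge2 k_lt s_le m_le m_gt cardB x_eq trim true_trim degree_le soft_le.
have pruned_le := pruned_bounded x B T Lo _ cardB x_eq trim degree_le.
have survivor_le := survivor_discrepancy_le p01 n_ge2 k_lt s_le m_le m_gt cardB x_eq trim true_trim
  degree_le soft_le total_le pruned_le.
have s_ge0 : 0 <= sR <= kR by rewrite ler0n ler_nat.
have k_le : 4 * kR <= N by rewrite -(natrM R 4) ler_nat ltnW.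
have K_ge0 : 0 <= K by apply: le_trans K_ge; lra.
have C_ge0 : 0 <= 900 * 900 * 2 * K by rewrite !mulr_ge0.
have combined_le := combined_error_le N_ge2 L_ge s_ge0 k_le r_sqr C_ge0 erefl erefl erefl.
by lra.
Qed.

Lemma typical_survivor_row v : v \in S ->
  `|\sum_(u in S) centered_adj p x v u| <= 60 * Num.sqrt (N * L) + sR + 2 * kR.
Proof.
have [degree_le _ _ _] := typ; rewrite inE => vS.
apply: (sum_survivor_row_le p01 trim).
exact: (survivor_degree_le k_lt s_le cardB x_eq trim degree_le).
Qed.

End TypicalGraphs.

Section PruningErrors.
Variables (R : realType) (n : nat) (p gamma c : R).
Variables (A : sgraph n -> sgraph n) (T L : sgraph n -> {set 'I_n}).
Hypotheses (n_ge2 : (2 <= n)%N) (p01 : 0 <= p <= 1) (c_ge1 : 1 <= c)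
  (gc_gt0 : 0 < gamma * c) (gc_lt : gamma * c < 1 / 4)
  (adversary : omniscient_adversary gamma A) (rule : pruning_rule gamma c T L).
Local Notation N := (@GRing.natmul R 1 n).
Local Notation k := (prune_size n gamma c).
Local Notation s := (Num.truncn (gamma * N)).
Local Notation K := ((16 * 12 ^+ 4) : R).
Local Notation C0 := (2 * (900 * 900 * 2 * K) + 3000).

Lemma adversary_gamma_gt0 : 0 < gamma.
Proof. by move: gc_gt0; rewrite pmulr_lgt0 //; apply: lt_le_trans c_ge1. Qed.

Lemma prune_size_bounds :
  [/\ k%:R <= c * gamma * N, s%:R <= gamma * N, (s <= k)%N & (4 * k < n)%N].
Proof.
have gamma_gt0 := adversary_gamma_gt0; have N_gt0 : 0 < N by rewrite ltr0n (leq_trans _ n_ge2).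
have gN_ge0 : 0 <= gamma * N by rewrite mulr_ge0 // ltW.
have cgN_ge0 : 0 <= c * gamma * N by rewrite mulr_ge0 // mulrC ltW.
have k_le : k%:R <= c * gamma * N by have := truncn_le (c * gamma * N); rewrite cgN_ge0.
have s_le : s%:R <= gamma * N by have := truncn_le (gamma * N); rewrite gN_ge0.
split=> //; first by rewrite truncn_ge_nat // (le_trans s_le) // -mulrA ler_peMl.
have : c * gamma * N < 1 / 4 * N by rewrite ltr_pM2r // mulrC.
by rewrite -(ltr_nat R) (natrM R 4); lra.
Qed.

Lemma pruning_trims G : trims k (centered_degree p (graph_coords G)) (T G) (L G).
Proof.
have [cardT cardL dTL topT topL] := rule G; split=> // u v uX vX.
  by rewrite centered_degree_le !degree_graph_coords topT.
by rewrite lerN2 centered_degree_le !degree_graph_coords topL.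
Qed.

Lemma adversary_rewires G : exists2 B : {set 'I_n}, (#|B| <= s)%N &
  rewires B (graph_coords G) (graph_coords (A G)).
Proof.
have [B [cardB edges_eq]] := adversary G; exists B.
  by rewrite truncn_ge_nat // mulr_ge0 // ltW ?adversary_gamma_gt0.
move=> u v uB vB; rewrite !adj_graph_coords edges_eq // -setI_eq0; apply/eqP/setP => y.
by rewrite !inE; apply/negP => /andP[/orP[/eqP ->|/eqP ->]]; apply/negP.
Qed.

Lemma card_pruned G : #|pruned T L G| = (2 * k)%N.
Proof. exact: card_trims (pruning_trims G). Qed.

Variable G : sgraph n.
Hypothesis typ : typical k s p K (graph_coords G).

Let L_ge0 : 0 <= ln N.
Proof. by have := ln_natr_ge R n_ge2; lra. Qed.

Let N_gt0 : 0 < N.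
Proof. by rewrite ltr0n (leq_trans _ n_ge2). Qed.

Lemma prune_then_mean_error :
  `|prune_then_mean R T L (A G) - p| <= 8 * C0 * (c * gamma ^+ 2 + ln N / N).
Proof.
have [k_le s_le s_le_k k_lt] := prune_size_bounds; have [B cardB x_eq] := adversary_rewires G.
have [card_ge2 _ pairs_ge] := card_survivors R n_ge2 k_lt (card_pruned (A G)).
have disc_le := typical_survivor_discrepancy p01 n_ge2 k_lt s_le_k (lexx K) typ cardB x_eq
  (pruning_trims (A G)) (pruning_trims G).
have N2_gt0 : 0 < N ^+ 2 / 8 by rewrite divr_gt0 // exprn_gt0.
have target_ge0 : 0 <= c * gamma ^+ 2 + ln N / N.
  by rewrite addr_ge0 ?divr_ge0 // mulr_ge0 ?sqr_ge0 // (le_trans ler01).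
have C0_ge0 : 0 <= C0 by lra.
rewrite /prune_then_mean (mean_estimate_error p) // ler_pdivrMr ?(lt_le_trans N2_gt0) //.
apply: le_trans disc_le _; apply: (@le_trans _ _ (8 * C0 * (c * gamma ^+ 2 + ln N / N) * (N ^+ 2 / 8))).
  rewrite (_ : 8 * C0 * _ * _ = C0 * (N * ln N + c * gamma * N * (gamma * N))); last first.
    by field; rewrite gt_eqF.
  by rewrite ler_wpM2l // lerD2l ler_pM.
by rewrite ler_wpM2l // mulr_ge0 // mulr_ge0.
Qed.

Lemma prune_then_median_error :
  `|prune_then_median R T L (A G) - p| <= 8 * C0 * (c * gamma + Num.sqrt (ln N / N)).
Proof.
have [k_le s_le s_le_k k_lt] := prune_size_bounds; have [B cardB x_eq] := adversary_rewires G.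
have [card_ge2 card_ge _] := card_survivors R n_ge2 k_lt (card_pruned (A G)).
have row_le := typical_survivor_row p01 k_lt s_le_k typ cardB x_eq (pruning_trims (A G)).
have N4_gt0 : 0 < N / 4 by rewrite divr_gt0.
have sqrt_ratio : Num.sqrt (ln N / N) = Num.sqrt (N * ln N) / N.
  rewrite -[RHS]ger0_norm ?divr_ge0 ?sqrtr_ge0 // -sqrtr_sqr exprMn sqr_sqrtr ?mulr_ge0 //.
  by congr Num.sqrt; field; rewrite gt_eqF.
have target_ge0 : 0 <= c * gamma + Num.sqrt (ln N / N).
  by rewrite addr_ge0 ?sqrtr_ge0 // mulrC ltW.
apply: le_trans (median_estimate_error card_ge2 row_le) _.
rewrite ler_pdivrMr ?(lt_le_trans N4_gt0) //.
apply: (@le_trans _ _ (240 * (c * gamma + Num.sqrt (ln N / N)) * (N / 4))); last first.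
  apply: ler_pM => //; [exact: mulr_ge0|exact: ltW|].
  by rewrite ler_wpM2r //; lra.
rewrite sqrt_ratio (_ : 240 * _ * _ = 60 * (c * gamma * N) + 60 * Num.sqrt (N * ln N)); last first.
  by field; rewrite gt_eqF.
have s_le_kR : s%:R <= k%:R :> R by rewrite ler_nat.
have k_ge0 := ler0n R k.
by lra.
Qed.

End PruningErrors.

Theorem theorem3p3 (R : realType) :
  exists C : R, 0 < C /\
  forall (n : nat) (p gamma c : R)
         (A : sgraph n -> sgraph n) (T L : sgraph n -> {set 'I_n}),
    (0 < n)%N ->
    0 <= p <= 1 ->
    1 <= c ->
    0 < gamma * c < 1 / 4 ->
    omniscient_adversary gamma A ->
    pruning_rule gamma c T L ->
    (forall G : sgraph n,
       #|pruned T L (A G)| = (2 * prune_size n gamma c)%N) /\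
    1 - n%:R ^- 2 <=
      Pr_gnp p (fun G : sgraph n =>
        (`|prune_then_mean R T L (A G) - p|
           <= C * (c * gamma ^+ 2 + ln n%:R / n%:R)) &&
        (`|prune_then_median R T L (A G) - p|
           <= C * (c * gamma + Num.sqrt (ln n%:R / n%:R)))).
Proof.
exists (8 * (2 * (900 * 900 * 2 * (16 * 12 ^+ 4)) + 3000)); split; first by lra.
move=> n p gamma c A T L n_gt0 p01 c_ge1 /andP[gc_gt0 gc_lt] adversary rule; split.
  by move=> G; exact: (card_pruned p rule).
have [n_ge2|n_le1] := ltnP 1 n; last first.
  have n_eq1 : n = 1%N by apply/eqP; rewrite eqn_leq n_le1.
  rewrite {1}n_eq1 expr1n invr1 subrr; apply: sumr_ge0 => G _; apply: prodr_ge0 => e _.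
  by case: ifP => _; lra.
have [_ _ s_le k_lt] := prune_size_bounds n_ge2 c_ge1 gc_gt0 gc_lt.
apply: le_trans (Pr_gnp_ge p01 (P := typical (prune_size n gamma c)
  (Num.truncn (gamma * n%:R)) p (16 * 12 ^+ 4)) _).
  by rewrite lerD2l lerN2 failure_prob_typical.
move=> G typ; apply/andP; split; first exact: prune_then_mean_error.
exact: prune_then_median_error.
Qed.
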